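(* Let $X_1,X_2,X_3$ be the standard vector fields on $\mathbb{S}^3$, $X_1(x)=xi$, $X_2(x)=xj$, $X_3(x)=xk$. Let $\beta$ be a solution of the differential equations $$X_1(\beta)=0,\qquad X_2(X_2(\beta))+X_3(X_3(\beta))=\frac{2(3-e^{4\beta})}{e^{4\beta}}$$ on a connected, simply connected open subset $U$ of $\mathbb{S}^3$. Then there exists a Lagrangian immersion $f:U\to\mathbb{S}^3\times\mathbb{S}^3$, $x\mapsto(p(x),q(x))$, into the nearly Kähler $\mathbb{S}^3\times\mathbb{S}^3$, where $p(x)=xix^{-1}$ and $q$ is determined by $$X_1(q)=-2q\,xix^{-1},$$ $$X_2(q)=q\left(-X_3(\beta)\,xix^{-1}-(1-\sqrt3\,e^{-2\beta})\,xjx^{-1}\right),$$ $$X_3(q)=q\left(X_2(\beta)\,xix^{-1}-(1+\sqrt3\,e^{-2\beta})\,xkx^{-1}\right).$$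
   Context: $\mathbb{S}^3$ is the set of unit quaternions in $\mathbb{H}$ with imaginary units $i,j,k$; products are quaternionic. Tangent vectors of $\mathbb{S}^3\times\mathbb{S}^3$ at $(p,q)$ are pairs $(U',V')$ with $U'\in T_p\mathbb{S}^3$, $V'\in T_q\mathbb{S}^3$. The nearly Kähler structure is $J(U',V')_{(p,q)}=\tfrac{1}{\sqrt3}(2pq^{-1}V'-U',\,-2qp^{-1}U'+V')$ with metric $g(Z,Z')=\tfrac12(\langle Z,Z'\rangle+\langle JZ,JZ'\rangle)$, where $\langle\cdot,\cdot\rangle$ is the Euclidean product metric. An immersion of a $3$-manifold is Lagrangian if $J$ maps tangent vectors to normal vectors (with respect to $g$). *)

(* Defs.v *)
From HB Require Import structures.
From mathcomp Require Import all_boot all_order all_algebra.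
From mathcomp Require Import all_classical all_reals all_analysis.

Set Implicit Arguments.
Unset Strict Implicit.
Unset Printing Implicit Defensive.

Import Order.TTheory GRing.Theory Num.Theory.
Import numFieldNormedType.Exports.

Local Open Scope classical_set_scope.
Local Open Scope ring_scope.

(* Quaternions: the row (a, b, c, d) stands for a + b i + c j + d k. The norm
   carried by 'rV[R]_4 in the library is the sup norm, which is only used
   through the topology and the differential structure it induces. *)
Notation quat R := 'rV[R]_4.

Section Quaternions.
Variable R : realType.
Implicit Types x y : quat R.

Definition mkq (a b c d : R) : quat R := \row_(m < 4) [:: a; b; c; d]`_m.

Definition qi : quat R := mkq 0 1 0 0.
Definition qj : quat R := mkq 0 0 1 0.
Definition qk : quat R := mkq 0 0 0 1.

Definition qmul x y : quat R :=
  mkq (x 0 0 * y 0 0 - x 0 1 * y 0 1 - x 0 2 * y 0 2 - x 0 3 * y 0 3)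
      (x 0 0 * y 0 1 + x 0 1 * y 0 0 + x 0 2 * y 0 3 - x 0 3 * y 0 2)
      (x 0 0 * y 0 2 - x 0 1 * y 0 3 + x 0 2 * y 0 0 + x 0 3 * y 0 1)
      (x 0 0 * y 0 3 + x 0 1 * y 0 2 - x 0 2 * y 0 1 + x 0 3 * y 0 0).

Definition edot x y : R := \sum_(m < 4) x 0 m * y 0 m.
Definition enorm x : R := Num.sqrt (edot x x).

Definition qconj x : quat R := mkq (x 0 0) (- x 0 1) (- x 0 2) (- x 0 3).
Definition qinv x : quat R := (edot x x)^-1 *: qconj x.

Definition S3 : set (quat R) := [set x | enorm x = 1].

Definition tangentS3 x : set (quat R) := [set v | edot x v = 0].

Definition open_in_S3 (U : set (quat R)) : Prop :=
  exists2 O : set (quat R), open O & U = O `&` S3.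

End Quaternions.

Arguments qi {R}.
Arguments qj {R}.
Arguments qk {R}.
Arguments S3 {R}.
Notation "x *q y" := (qmul x y) (at level 40, left associativity) : ring_scope.

Section SimplyConnected.
Variables (R : realType) (T : topologicalType).

(* A path in A is a map R -> T, of which only the values on [0, 1] matter. *)
Definition path_in (A : set T) (c : R -> T) : Prop :=
  {within `[0, 1], continuous c} /\ (forall t, t \in `[0, 1] -> A (c t)).

Definition path_connected (A : set T) : Prop :=
  forall x y, A x -> A y -> exists c, [/\ path_in A c, c 0 = x & c 1 = y].

Definition null_homotopic_in (A : set T) (c : R -> T) : Prop :=
  exists F : R * R -> T,
    [/\ {within `[0, 1] `*` `[0, 1], continuous F},
        forall s t, s \in `[0, 1] -> t \in `[0, 1] -> A (F (s, t)),
        forall t, t \in `[0, 1] -> F (0, t) = c t /\ F (1, t) = c 0 &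
        forall s, s \in `[0, 1] -> F (s, 0) = c 0 /\ F (s, 1) = c 0].

Definition simply_connected (A : set T) : Prop :=
  path_connected A /\
  (forall c, path_in A c -> c 0 = c 1 -> null_homotopic_in A c).

End SimplyConnected.

Arguments path_connected R {T} A.
Arguments simply_connected R {T} A.

Section Calculus.
Variable R : realType.

(* Used for open W only. Frechet differentiability at every order, phrased
   through all iterated directional derivatives. *)
Fixpoint Ck (E V : normedModType R) (n : nat) (W : set E) (f : E -> V) : Prop :=
  match n with
  | 0%N => forall x, W x -> {for x, continuous f}
  | n'.+1 => (forall x, W x -> differentiable f x) /\
             (forall v : E, Ck n' W (fun x => 'D_v f x))
  end.

Definition Cinfty (E V : normedModType R) (W : set E) (f : E -> V) : Prop :=
  forall n, Ck n W f.

Variable V : normedModType R.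
Implicit Types (U : set (quat R)) (f : quat R -> V).

(* Functions on a subset of S^3 are represented by maps on all quaternions, of
   which only the values on that subset are relevant. Smoothness is, as usual
   for submanifolds, local extendability to a smooth map of the ambient space. *)
Definition smoothS3 U f : Prop :=
  forall x, U x -> exists (W : set (quat R)) (h : quat R -> V),
    [/\ open W, W x, Cinfty W h & forall y, W y -> U y -> h y = f y].

Definition normalize (y : quat R) : quat R := (enorm y)^-1 *: y.

(* The differential at x in S^3, applied to v in T_x S^3: the derivative at
   t = 0 of f along the curve t |-> (x + t v) / |x + t v|, which lies in S^3 and
   has velocity v at t = 0. It only depends on f near x in S^3. *)
Definition dS3 f (x v : quat R) : V := 'D_v (f \o @normalize) x.

Definition X1 f (x : quat R) : V := dS3 f x (x *q qi).
Definition X2 f (x : quat R) : V := dS3 f x (x *q qj).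
Definition X3 f (x : quat R) : V := dS3 f x (x *q qk).

End Calculus.

Section NearlyKahler.
Variable R : realType.
Notation H2 := (quat R * quat R)%type.
Implicit Types (z Z : H2) (U : set (quat R)) (f : quat R -> H2).

Definition S3xS3 : set H2 := S3 `*` S3.

Definition tangentS3xS3 z : set H2 := tangentS3 z.1 `*` tangentS3 z.2.

Definition nkJ z Z : H2 :=
  ((Num.sqrt 3)^-1 *: (2 *: (z.1 *q qinv z.2 *q Z.2) - Z.1),
   (Num.sqrt 3)^-1 *: (- (2 *: (z.2 *q qinv z.1 *q Z.1)) + Z.2)).

Definition edot2 Z Z' : R := edot Z.1 Z'.1 + edot Z.2 Z'.2.

Definition nkg z Z Z' : R :=
  2^-1 * (edot2 Z Z' + edot2 (nkJ z Z) (nkJ z Z')).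

Definition immersion U f : Prop :=
  [/\ forall x, U x -> S3xS3 (f x),
      smoothS3 U f &
      forall x, U x -> forall v, tangentS3 x v -> dS3 f x v = 0 -> v = 0].

Definition normal_to U f (x : quat R) : set H2 :=
  [set N | tangentS3xS3 (f x) N /\
           forall w, tangentS3 x w -> nkg (f x) N (dS3 f x w) = 0].

Definition lagrangian U f : Prop :=
  forall x, U x -> forall v, tangentS3 x v ->
    normal_to U f x (nkJ (f x) (dS3 f x v)).

Definition lagrangian_immersion U f : Prop := immersion U f /\ lagrangian U f.

Definition q_system U (beta : quat R -> R) (q : quat R -> quat R) : Prop :=
  forall x, U x ->
    let e1 := x *q qi *q qinv x in
    let e2 := x *q qj *q qinv x in
    let e3 := x *q qk *q qinv x in
    [/\ X1 q x = - (2 *: (q x *q e1)),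
        X2 q x = q x *q (- X3 beta x *: e1
                 - (1 - Num.sqrt 3 * expR (- 2 * beta x)) *: e2) &
        X3 q x = q x *q (X2 beta x *: e1
                 - (1 + Num.sqrt 3 * expR (- 2 * beta x)) *: e3)].

(* Smooth maps U -> S^3 satisfying the system for q. *)
Definition q_solution U (beta : quat R -> R) (q : quat R -> quat R) : Prop :=
  [/\ forall x, U x -> S3 (q x), smoothS3 U q & q_system U beta q].

End NearlyKahler.

(* Main.v *)
Require Import Defs.
From HB Require Import structures.
From mathcomp Require Import all_boot all_order all_algebra.
From mathcomp Require Import all_classical all_reals all_analysis.
From mathcomp Require Import ring lra.

(** The system prescribes dq = q w for a 1-form w on U with imaginary
    quaternion values.  The hypotheses on beta say exactly that w is flat,
    dw + w /\ w = 0, so that on a simply connected U the equation has a solution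
    with values in the unit quaternions, unique up to a constant left factor.

    Passing to r = q x removes the conjugations by x from w, and extending
    everything radially to the cone over U gives an equation dr = r Om on an
    open subset of the quaternions.  The flatness of Om (conn_flat) is an
    algebraic identity (gauge_flat) once the derivatives of the coefficients
    along x i, x j, x k are known.  They come from the two equations for beta and
    the commutators of these fields (dS3_commutator), hence from the symmetry of
    second derivatives (derive_sym).

    Locally, transport along a segment is the limit of Euler's method under
    repeated bisection, projected to the unit sphere, where multiplication is
    isometric and errors add up without amplification.  By Goursat's argument it
    is independent of the path (transport_trans): the defect around a square is
    additive under subdivision, and flatness makes it o(h^2) for squares of side
    h around each point (transport_second_order).  So transport from a base
    point solves the equation near it (local_parallel), and two local solutions
    differ by a constant left factor (parallel_unique).

    Globally, local solutions are continued along paths in U and, by bisection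
    and gluing, over homotopies (square_section).  Two paths with the same ends
    form a null-homotopic loop, and a section over the null homotopy shows that
    they give the same value (reach_unique).  The resulting solution is smooth,
    because dr = r Om expresses its derivatives through r itself.

    The Lagrangian condition is pointwise.  In a frame of right translations at
    (x i x^-1, q) the map J has constant coefficients, and g (J df v, df w) is
    the antisymmetrization of a bilinear form that is diagonal, hence symmetric,
    in the basis x i, x j, x k (lagrangian_frame). *)

Set Implicit Arguments.
Unset Strict Implicit.
Unset Printing Implicit Defensive.

Import Order.TTheory GRing.Theory Num.Theory.
Import numFieldNormedType.Exports.

Local Open Scope classical_set_scope.
Local Open Scope ring_scope.

(** * Quaternion algebra *)

Section Coordinates.
Variable R : realType.
Implicit Types (x y : quat R) (a b : R).

Definition qone : quat R := mkq 1 0 0 0.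

Lemma ord4P (m : 'I_4) : [\/ m = 0, m = 1, m = 2 | m = 3].
Proof.
by case: m => -[|[|[|[|//]]]] p; [constructor 1|constructor 2|constructor 3|
  constructor 4]; apply/val_inj.
Qed.

Lemma quatP x y : x 0 0 = y 0 0 -> x 0 1 = y 0 1 -> x 0 2 = y 0 2 ->
  x 0 3 = y 0 3 -> x = y.
Proof.
move=> h0 h1 h2 h3; apply/rowP => m.
by have [->|->|->|->] := ord4P m.
Qed.

Lemma mkqE a b c d : (mkq a b c d 0 0 = a) * (mkq a b c d 0 1 = b) *
  (mkq a b c d 0 2 = c) * (mkq a b c d 0 3 = d).
Proof. by rewrite !mxE. Qed.

Lemma edotE x y : edot x y =
  x 0 0 * y 0 0 + x 0 1 * y 0 1 + x 0 2 * y 0 2 + x 0 3 * y 0 3.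
Proof.
rewrite /edot !big_ord_recl big_ord0 !addr0 !addrA.
by congr (_ * _ + _ * _ + _ * _ + _ * _); congr (_ _ _); apply/val_inj.
Qed.

Lemma quatDE x y m : (x + y) 0 m = x 0 m + y 0 m. Proof. by rewrite mxE. Qed.
Lemma quatNE x m : (- x) 0 m = - x 0 m. Proof. by rewrite mxE. Qed.
Lemma quatZE a x m : (a *: x) 0 m = a * x 0 m. Proof. by rewrite mxE. Qed.
Lemma quat0E m : (0 : quat R) 0 m = 0. Proof. by rewrite mxE. Qed.

Definition quatE := (quatDE, quatNE, quatZE, quat0E, mkqE).

End Coordinates.

Ltac quat_ring := apply: quatP;
  rewrite /qmul /qconj /qone /qi /qj /qk !quatE; ring.

Section QuaternionAlgebra.
Variable R : realType.
Implicit Types (x y z u v w : quat R) (a b : R).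

Lemma qmulA x y z : x *q (y *q z) = x *q y *q z. Proof. quat_ring. Qed.
Lemma qmulDl x y z : (x + y) *q z = x *q z + y *q z. Proof. quat_ring. Qed.
Lemma qmulDr x y z : z *q (x + y) = z *q x + z *q y. Proof. quat_ring. Qed.
Lemma qmulNl x y : (- x) *q y = - (x *q y). Proof. quat_ring. Qed.
Lemma qmulNr x y : x *q (- y) = - (x *q y). Proof. quat_ring. Qed.
Lemma qmulBl x y z : (x - y) *q z = x *q z - y *q z. Proof. quat_ring. Qed.
Lemma qmulBr x y z : z *q (x - y) = z *q x - z *q y. Proof. quat_ring. Qed.
Lemma qmulZl a x y : (a *: x) *q y = a *: (x *q y). Proof. quat_ring. Qed.
Lemma qmulZr a x y : x *q (a *: y) = a *: (x *q y). Proof. quat_ring. Qed.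
Lemma qmul1 x : x *q qone R = x. Proof. quat_ring. Qed.
Lemma q1mul x : qone R *q x = x. Proof. quat_ring. Qed.
Lemma qmul0 x : x *q 0 = 0. Proof. quat_ring. Qed.
Lemma q0mul x : 0 *q x = 0. Proof. quat_ring. Qed.
Lemma qconjM x y : qconj (x *q y) = qconj y *q qconj x. Proof. quat_ring. Qed.
Lemma qconjK x : qconj (qconj x) = x. Proof. quat_ring. Qed.
Lemma qmulC x : x *q qconj x = edot x x *: qone R.
Proof. apply: quatP; rewrite edotE /qmul /qconj /qone !quatE; ring. Qed.
Lemma qCmul x : qconj x *q x = edot x x *: qone R.
Proof. apply: quatP; rewrite edotE /qmul /qconj /qone !quatE; ring. Qed.

Lemma edotM x y : edot (x *q y) (x *q y) = edot x x * edot y y.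
Proof. rewrite !edotE /qmul !quatE; ring. Qed.
Lemma edotMl x y z : edot (x *q y) (x *q z) = edot x x * edot y z.
Proof. rewrite !edotE /qmul !quatE; ring. Qed.
Lemma edotMr x y z : edot (y *q x) (z *q x) = edot x x * edot y z.
Proof. rewrite !edotE /qmul !quatE; ring. Qed.
Lemma edotC x y : edot x y = edot y x.
Proof. rewrite !edotE; ring. Qed.
Lemma edotDl x y z : edot (x + y) z = edot x z + edot y z.
Proof. rewrite !edotE !quatE; ring. Qed.
Lemma edotDr x y z : edot z (x + y) = edot z x + edot z y.
Proof. rewrite !edotE !quatE; ring. Qed.
Lemma edotZl a x y : edot (a *: x) y = a * edot x y.
Proof. rewrite !edotE !quatE; ring. Qed.
Lemma edotZr a x y : edot x (a *: y) = a * edot x y.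
Proof. rewrite !edotE !quatE; ring. Qed.
Lemma edot_conj x : edot (qconj x) (qconj x) = edot x x.
Proof. rewrite !edotE /qconj !quatE; ring. Qed.
Lemma edot_ge0 x : 0 <= edot x x.
Proof. by rewrite edotE -!expr2; do ?apply: addr_ge0; exact: sqr_ge0. Qed.
Lemma edot_eq0 x : edot x x = 0 -> x = 0.
Proof.
rewrite edotE => h.
have := sqr_ge0 (x 0 0); have := sqr_ge0 (x 0 1).
have := sqr_ge0 (x 0 2); have := sqr_ge0 (x 0 3); rewrite !expr2 => h3 h2 h1 h0.
by apply: quatP; rewrite !quatE; apply/eqP; rewrite -sqrf_eq0 expr2; apply/eqP;
  lra.
Qed.

(** Lagrange's identity: edot x y is the real part of x *q qconj y, whose
    squared norm is the product of the squared norms. *)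
Lemma edot_CS x y : edot x y ^+ 2 <= edot x x * edot y y.
Proof.
have -> : edot x x * edot y y =
  edot (x *q qconj y) (x *q qconj y) by rewrite edotM edot_conj.
rewrite [leRHS]edotE -!expr2.
have -> : edot x y = (x *q qconj y) 0 0.
  rewrite edotE /qmul /qconj !quatE; ring.
rewrite -!addrA lerDl; do ?apply: addr_ge0; exact: sqr_ge0.
Qed.

Lemma enorm_ge0 x : 0 <= enorm x. Proof. exact: sqrtr_ge0. Qed.
Lemma enorm_sqr x : enorm x ^+ 2 = edot x x.
Proof. by rewrite sqr_sqrtr // edot_ge0. Qed.
Lemma enormM x y : enorm (x *q y) = enorm x * enorm y.
Proof. by rewrite /enorm edotM sqrtrM // edot_ge0. Qed.
Lemma enorm0 : enorm (0 : quat R) = 0.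
Proof. by rewrite /enorm -[X in edot X]( scale0r 0) edotZl mul0r sqrtr0. Qed.
Lemma enorm_eq0 x : (enorm x == 0) = (x == 0).
Proof.
apply/eqP/eqP => [h|->]; last exact: enorm0.
by apply: edot_eq0; rewrite -enorm_sqr h expr0n.
Qed.
Lemma enorm_gt0 x : (0 < enorm x) = (x != 0).
Proof. by rewrite lt_neqAle enorm_ge0 andbT eq_sym enorm_eq0. Qed.
Lemma enormZ a x : enorm (a *: x) = `|a| * enorm x.
Proof.
by rewrite /enorm edotZl edotZr mulrA -expr2 sqrtrM ?sqr_ge0 // sqrtr_sqr.
Qed.
Lemma enormN x : enorm (- x) = enorm x.
Proof. by rewrite -scaleN1r enormZ normrN1 mul1r. Qed.
Lemma enormB x y : enorm (x - y) = enorm (y - x).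
Proof. by rewrite -enormN opprB. Qed.
Lemma enorm1 : enorm (qone R) = 1.
Proof.
rewrite /enorm edotE /qone !quatE -[RHS]sqrtr1; congr Num.sqrt; ring.
Qed.
Lemma enorm_conj x : enorm (qconj x) = enorm x.
Proof. by rewrite /enorm edot_conj. Qed.

Lemma enormD x y : enorm (x + y) <= enorm x + enorm y.
Proof.
rewrite -(@ler_pXn2r _ 2) ?nnegrE ?addr_ge0 ?enorm_ge0 //.
rewrite sqrrD !enorm_sqr edotDl !edotDr (edotC y x).
have : edot x y <= enorm x * enorm y.
  apply: le_trans (ler_norm _) _.
  rewrite -(@ler_pXn2r _ 2) ?nnegrE ?mulr_ge0 ?enorm_ge0 //.
  by rewrite real_normK ?num_real // exprMn !enorm_sqr edot_CS.
lra.
Qed.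

Lemma enorm_sum_le n (F : 'I_n -> quat R) :
  enorm (\sum_i F i) <= \sum_i enorm (F i).
Proof.
elim/big_ind2: _ => [|x a y b ha hb|//]; first by rewrite enorm0.
exact: le_trans (enormD _ _) (lerD ha hb).
Qed.

Lemma enormBD x y z : enorm (x - z) <= enorm (x - y) + enorm (y - z).
Proof. by rewrite -[x - z](subrKA y) enormD. Qed.

Lemma coord_le_enorm x m : `|x 0 m| <= enorm x.
Proof.
rewrite -(@ler_pXn2r _ 2) ?nnegrE ?enorm_ge0 //.
rewrite real_normK ?num_real // enorm_sqr edotE.
have := sqr_ge0 (x 0 0); have := sqr_ge0 (x 0 1).
have := sqr_ge0 (x 0 2); have := sqr_ge0 (x 0 3).
by have [->|->|->|->] := ord4P m; rewrite !expr2; lra.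
Qed.

Lemma mx_norm_le_enorm x : `|x| <= enorm x.
Proof.
rewrite {1}/Num.norm /= mx_normrE; apply/bigmax_leP; split; first exact: enorm_ge0.
by move=> -[i m] _; rewrite /= ord1; exact: coord_le_enorm.
Qed.

Lemma coord_le_norm x m : `|x 0 m| <= `|x|.
Proof.
rewrite {2}/Num.norm /= mx_normrE.
exact: (le_bigmax _ (fun ij : 'I_1 * 'I_4 => `|x ij.1 ij.2|) (0, m)).
Qed.

Lemma enorm_le_mx_norm x : enorm x <= 2 * `|x|.
Proof.
rewrite -(@ler_pXn2r _ 2) ?nnegrE ?enorm_ge0 ?mulr_ge0 //.
rewrite enorm_sqr edotE.
have h m : x 0 m * x 0 m <= `|x| ^+ 2.
  rewrite -expr2 -real_normK ?num_real // ler_pXn2r ?nnegrE //.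
  exact: coord_le_norm.
have := h 0; have := h 1; have := h 2; have := h 3; rewrite exprMn; lra.
Qed.


Lemma S3P x : S3 x <-> edot x x = 1.
Proof.
rewrite /S3 /=; split => h; first by rewrite -enorm_sqr h expr1n.
by rewrite /enorm h sqrtr1.
Qed.

Lemma S3M x y : S3 x -> S3 y -> S3 (x *q y).
Proof. by rewrite /S3 /= => hx hy; rewrite enormM hx hy mulr1. Qed.
Lemma S3conj x : S3 x -> S3 (qconj x).
Proof. by rewrite /S3 /= enorm_conj. Qed.
Lemma S3one : S3 (qone R). Proof. exact: enorm1. Qed.
Lemma S3_mulC x : S3 x -> x *q qconj x = qone R.
Proof. by move=> /S3P h; rewrite qmulC h scale1r. Qed.
Lemma S3_Cmul x : S3 x -> qconj x *q x = qone R.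
Proof. by move=> /S3P h; rewrite qCmul h scale1r. Qed.
Lemma S3_qinv x : S3 x -> qinv x = qconj x.
Proof. by move=> /S3P h; rewrite /qinv h invr1 scale1r. Qed.
Lemma S3_neq0 x : S3 x -> x != 0.
Proof. by rewrite -enorm_eq0 => ->; rewrite oner_eq0. Qed.

Lemma enorm_S3l u x : S3 u -> enorm (u *q x) = enorm x.
Proof. by rewrite /S3 /= => h; rewrite enormM h mul1r. Qed.
Lemma enorm_S3r u x : S3 u -> enorm (x *q u) = enorm x.
Proof. by rewrite /S3 /= => h; rewrite enormM h mulr1. Qed.

Lemma S3_normalize x : x != 0 -> S3 (normalize x).
Proof.
move=> x0; rewrite /S3 /= enormZ ger0_norm ?invr_ge0 ?enorm_ge0 //.
by rewrite mulVf // enorm_eq0.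
Qed.

Lemma normalize_S3 x : S3 x -> normalize x = x.
Proof. by rewrite /S3 /= /normalize => ->; rewrite invr1 scale1r. Qed.

End QuaternionAlgebra.

(** * Dyadic subdivision *)

Section Dyadic.
Variable R : realType.

Lemma cvg_geometric0 (K : R) : (fun n => K / 2 ^+ n) @ \oo --> 0.
Proof.
have -> : (fun n => K / 2 ^+ n) = (fun n => K * 2^-1 ^+ n).
  by apply/funext => n; rewrite exprVn.
rewrite -[X in _ --> X](mulr0 K); apply: cvgM; first exact: cvg_cst.
by apply: cvg_expr; rewrite ger0_norm ?invr_ge0 // invf_lt1 // ltr1n.
Qed.

Lemma le0_of_geometric (a K : R) : (forall n, a <= K / 2 ^+ n) -> a <= 0.
Proof.
move=> h; apply: (ler_cvg_to (cvg_cst a) (cvg_geometric0 K)).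
by near=> n; exact: h.
Unshelve. all: by end_near. Qed.

Lemma geometric_cvg (u : nat -> R) c : (forall n, `|u n.+1 - u n| <= c / 2 ^+ n) ->
  forall n, `|limn u - u n| <= 2 * c / 2 ^+ n.
Proof.
move=> h.
pose w n := u n + 2 * c / 2 ^+ n.
have h' n : - (c / 2 ^+ n) <= u n.+1 - u n <= c / 2 ^+ n by rewrite -ler_norml.
have hS n : c / 2 ^+ n = 2 * (c / 2 ^+ n.+1).
  by rewrite exprS; field; rewrite expf_neq0.
have c0 n : 0 <= c / 2 ^+ n by apply: le_trans (h n); exact: normr_ge0.
have wd : {homo w : m n / (m <= n)%N >-> n <= m}.
  apply: (homo_leq (r := fun a b => b <= a)) => //= [b a d ab bd|n].
    exact: le_trans bd ab.
  by rewrite /w; have := h' n; rewrite -!(mulrA 2) (hS n); lra.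
have dist n k : `|u (n + k)%N - u n| <= 2 * c / 2 ^+ n - 2 * c / 2 ^+ (n + k).
  elim: k => [|k ih]; first by rewrite addn0 !subrr normr0.
  rewrite addnS; have := h' (n + k)%N; have := hS (n + k)%N.
  move: ih; rewrite !ler_norml -!(mulrA 2); lra.
have wlb : has_lbound (range w).
  exists (u 0 - 2 * c); move=> _ [n _ <-]; rewrite /w.
  have := dist 0 n; rewrite add0n expr0 divr1 ler_norml -!(mulrA 2).
  have := c0 n; lra.
have cw := nonincreasing_is_cvgn wd wlb.
have cu : u @ \oo --> limn w.
  have -> : u = (fun n => w n - 2 * c / 2 ^+ n) by apply/funext => n; rewrite /w addrK.
  by rewrite -[X in _ --> X]subr0; apply: cvgB => //; exact: cvg_geometric0.
move=> n; rewrite (cvg_lim _ cu) //.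
apply: (ler_cvg_to (cvg_norm (cvgB cu (cvg_cst (u n)))) (cvg_cst _)).
near=> m; have nm : (n <= m)%N by near: m; exact: nbhs_infty_ge.
have := dist n (m - n)%N; rewrite subnKC //= => /le_trans; apply.
by rewrite gerBl -mulrA mulr_ge0.
Unshelve. all: by end_near. Qed.

(** A two-dimensional Heine-Borel principle.  A bad square has a bad quarter, so
    if the unit square were bad, nested bad squares would shrink to a point,
    around which all small squares are good. *)
Lemma square_induction (Q : R -> R -> R -> Prop) :
  (forall a b h, 0 < h -> 0 <= a -> a + 2 * h <= 1 -> 0 <= b -> b + 2 * h <= 1 ->
    Q a b h -> Q (a + h) b h -> Q a (b + h) h -> Q (a + h) (b + h) h ->
    Q a b (2 * h)) ->
  (forall x y, 0 <= x <= 1 -> 0 <= y <= 1 -> exists2 d, 0 < d &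
    forall a b h, 0 < h < d -> 0 <= a -> a + h <= 1 -> 0 <= b -> b + h <= 1 ->
    a <= x <= a + h -> b <= y <= b + h -> Q a b h) ->
  Q 0 0 1.
Proof.
move=> Q4 Qloc; apply: contrapT => nQ.
pose h n : R := (2 ^+ n)^-1.
have h_gt0 n : 0 < h n by rewrite invr_gt0 exprn_gt0.
have hS n : h n = 2 * h n.+1 by rewrite /h exprS; field; rewrite expf_neq0.
pose next n (p : R * R) : R * R :=
  let k := h n.+1 in
  if ~~ `[< Q p.1 p.2 k >] then p
  else if ~~ `[< Q (p.1 + k) p.2 k >] then (p.1 + k, p.2)
  else if ~~ `[< Q p.1 (p.2 + k) k >] then (p.1, p.2 + k)
  else (p.1 + k, p.2 + k).
pose fix sq n : R * R := if n is n'.+1 then next n' (sq n') else (0, 0).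
have sqP n : [/\ 0 <= (sq n).1, (sq n).1 + h n <= 1, 0 <= (sq n).2,
                 (sq n).2 + h n <= 1 & ~ Q (sq n).1 (sq n).2 (h n)].
  elim: n => [|n [a0 a1 b0 b1 nq]]; first by rewrite /= /h expr0 invr1 add0r.
  have k0 := h_gt0 n.+1; rewrite hS in a1 b1 nq; rewrite /= /next.
  case: asboolP => q1 /=; last by split => //; lra.
  case: asboolP => q2 /=; last by split => //; lra.
  case: asboolP => q3 /=; last by split => //; lra.
  by split; [lra|lra|lra|lra|move=> q4; apply: nq; exact: Q4].
have sqS n : (sq n).1 <= (sq n.+1).1 <= (sq n).1 + h n.+1 /\
             (sq n).2 <= (sq n.+1).2 <= (sq n).2 + h n.+1.
  have k0 := h_gt0 n.+1; rewrite /= /next.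
  by do 3?[case: asboolP => _ /=]; split; lra.
have nested (f : R * R -> R) : (forall n, f (sq n) <= f (sq n.+1) <= f (sq n) + h n.+1) ->
    (forall n, 0 <= f (sq n)) -> (forall n, f (sq n) + h n <= 1) ->
    exists2 x, 0 <= x <= 1 & forall n, f (sq n) <= x <= f (sq n) + h n.
  move=> fS f0 f1; pose u n := f (sq n).
  have u_nd : {homo u : m n / (m <= n)%N >-> m <= n}.
    by apply: homo_leq => [//|? ? ?|n]; [exact: le_trans|have /andP[] := fS n].
  have v_ni : {homo (fun n => u n + h n) : m n / (m <= n)%N >-> n <= m}.
    apply: (homo_leq (r := fun a b => b <= a)) => //= [b a d ab bd|n].
      exact: le_trans bd ab.
    by rewrite (hS n); have := fS n; rewrite -/(u n) -/(u n.+1); lra.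
  have uub m n : u m <= u n + h n.
    have [mn|/ltnW nm] := leqP m n.
      by apply: le_trans (u_nd _ _ mn) _; rewrite lerDl ltW.
    by apply: le_trans _ (v_ni _ _ nm); rewrite lerDl ltW.
  have sup_u : has_sup (range u).
    by split; [exists (u 0), 0|exists (u 0 + h 0) => _ [m _ <-]].
  have le_sup n : u n <= sup (range u) by apply: sup_ubound (sup_u).2 _ _; exists n.
  have sup_le n : sup (range u) <= u n + h n.
    by apply: ge_sup; [exact: sup_u.1|move=> _ [m _ <-]].
  exists (sup (range u)); last by move=> n; rewrite le_sup sup_le.
  by rewrite (le_trans (f0 0) (le_sup 0)) (le_trans (sup_le 0) (f1 0)).
have [||n|x x01 xP] := nested fst.
- by move=> n; have [] := sqS n.
- by move=> n; have [] := sqP n.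
- by have [] := sqP n.
have [||n|y y01 yP] := nested snd.
- by move=> n; have [] := sqS n.
- by move=> n; have [] := sqP n.
- by have [] := sqP n.
have [d d0 dP] := Qloc x y x01 y01.
have [n hn] : exists n, h n < d.
  have [n _ /(_ n (leqnn n)) hn] := near_infty_natSinv_expn_lt (PosNum d0).
  by exists n; move: hn; rewrite div1r.
have [a0 a1 b0 b1 nq] := sqP n.
by apply: nq; apply: dP => //; rewrite h_gt0.
Qed.

End Dyadic.

(** * Transport along segments *)

Section Transport.
Variable R : realType.
Implicit Types (x y z u v w : quat R).

Definition mid x y : quat R := 2^-1 *: (x + y).

Lemma midBl x y : mid x y - x = 2^-1 *: (y - x).
Proof. by apply/rowP => m; rewrite !mxE; field. Qed.
Lemma midBr x y : y - mid x y = 2^-1 *: (y - x).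
Proof. by apply/rowP => m; rewrite !mxE; field. Qed.

Lemma enorm_half x : enorm (2^-1 *: x) = enorm x / 2.
Proof. by rewrite enormZ ger0_norm ?invr_ge0 // mulrC. Qed.

(** The unit quaternion nearest to qone + w is a second-order approximation of
    it, because |qone + w|^2 = 1 + |w|^2 for imaginary w. *)
Lemma normalize_1D w : w 0 0 = 0 ->
  enorm (normalize (qone R + w) - (qone R + w)) <= enorm w ^+ 2.
Proof.
move=> w0; set s := qone R + w; pose n := enorm s.
have n2 : n ^+ 2 = 1 + enorm w ^+ 2.
  by rewrite !enorm_sqr !edotE /s /qone !quatE w0; ring.
have n1 : 1 <= n.
  rewrite -(@ler_pXn2r _ 2) ?nnegrE ?enorm_ge0 // expr1n n2 lerDl.
  exact: sqr_ge0.
rewrite /normalize -/n -[X in _ - X]scale1r -scalerBl enormZ -/n.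
have -> : `|n^-1 - 1| * n = n - 1.
  rewrite ler0_norm ?subr_le0 ?invf_le1 ?(lt_le_trans ltr01) //.
  by field; rewrite lt0r_neq0 // (lt_le_trans ltr01).
have -> : enorm w ^+ 2 = n ^+ 2 - 1 by rewrite n2; ring.
by nra.
Qed.

Lemma S3_normalize_1D w : w 0 0 = 0 -> S3 (normalize (qone R + w)).
Proof.
move=> w0; apply: S3_normalize; apply/eqP => /rowP /(_ 0).
by rewrite /qone !quatE w0 addr0 => /eqP; rewrite oner_eq0.
Qed.

(** Multiplication by unit quaternions is isometric, so the errors made in the
    factors of a product add up and are not amplified. *)
Lemma enormM_sub_le u v u' v' : S3 u' -> S3 v ->
  enorm (u *q v - u' *q v') <= enorm (u - u') + enorm (v - v').
Proof.
move=> hu' hv.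
have -> : u *q v - u' *q v' = (u - u') *q v + u' *q (v - v').
  by rewrite qmulBl qmulBr addrA subrK.
apply: le_trans (enormD _ _) _.
by rewrite enorm_S3r // enorm_S3l.
Qed.

(** The path along the bottom and right edges of a square is moved to the path
    along its left and top edges by crossing one quarter at a time; the factors
    in front of and behind that quarter are units. *)
Lemma square_defect_le (a1 a2 m1 m2 t1 t2 l1 l2 c1 c2 r1 r2 : quat R) :
  S3 a1 -> S3 r2 -> S3 m2 -> S3 l1 -> S3 m1 -> S3 t2 ->
  enorm (a1 *q a2 *q (r1 *q r2) - l1 *q l2 *q (t1 *q t2)) <=
  enorm (a1 *q c1 - l1 *q m1) + enorm (a2 *q r1 - c1 *q m2) +
  enorm (m1 *q c2 - l2 *q t1) + enorm (m2 *q r2 - c2 *q t2).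
Proof.
move=> *.
have -> : a1 *q a2 *q (r1 *q r2) - l1 *q l2 *q (t1 *q t2) =
  (a1 *q c1 - l1 *q m1) *q (m2 *q r2) + a1 *q (a2 *q r1 - c1 *q m2) *q r2 +
  l1 *q (m1 *q c2 - l2 *q t1) *q t2 + l1 *q m1 *q (m2 *q r2 - c2 *q t2).
  rewrite !(qmulBl, qmulBr, qmulA).
  by apply/rowP => m; rewrite !quatE; ring.
apply: le_trans (enormD _ _) _; apply: lerD.
  apply: le_trans (enormD _ _) _; apply: lerD; last by rewrite enorm_S3r // enorm_S3l.
  apply: le_trans (enormD _ _) _; apply: lerD; last by rewrite enorm_S3r // enorm_S3l.
  by rewrite enorm_S3r //; exact: S3M.
by rewrite enorm_S3l //; exact: S3M.
Qed.

Lemma comparison_two_steps (p1 p2 p3 q1 q2 : quat R) k1 k2 : S3 q2 ->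
  enorm (p1 *q q1 - p2) <= k1 -> enorm (p2 *q q2 - p3) <= k2 ->
  enorm (p1 *q (q1 *q q2) - p3) <= k1 + k2.
Proof.
move=> S2 h1 h2.
have -> : p1 *q (q1 *q q2) - p3 = (p1 *q q1 - p2) *q q2 + (p2 *q q2 - p3).
  by rewrite qmulBl qmulA subrKA.
by apply: le_trans (enormD _ _) _; rewrite enorm_S3r //; exact: lerD.
Qed.

Lemma dist_of_itv (p q r h : R) : 0 <= h -> r <= p <= r + h -> r <= q <= r + h ->
  `|q - p| <= h.
Proof. by rewrite ler_norml; lra. Qed.

Variables (B : set (quat R)) (Om : quat R -> quat R -> quat R) (M : R).
Hypothesis M0 : 0 <= M.
Hypothesis B_convex : forall x y (t : R), B x -> B y -> 0 <= t <= 1 ->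
  B (x + t *: (y - x)).
Hypothesis B_small : forall x y, B x -> B y -> M * enorm (x - y) <= 1.
Hypothesis Om_im : forall x v, B x -> Om x v 0 0 = 0.
Hypothesis OmD : forall x u v, Om x (u + v) = Om x u + Om x v.
Hypothesis OmZ : forall x a u, Om x (a *: u) = a *: Om x u.
Hypothesis Om_bound : forall x v, B x -> enorm (Om x v) <= M * enorm v.
Hypothesis Om_lip : forall x y v, B x -> B y ->
  enorm (Om x v - Om y v) <= M * enorm (x - y) * enorm v.

Lemma B_mid x y : B x -> B y -> B (mid x y).
Proof.
move=> Bx By; have -> : mid x y = x + 2^-1 *: (y - x).
  by rewrite -midBl addrC subrK.
by apply: B_convex => //; rewrite invr_ge0 ler0n invf_le1 // ler1n.
Qed.

(** One step of Euler's method for dr = r Om along the segment from x to y,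
    projected back to the unit sphere. *)
Definition euler x y : quat R := normalize (qone R + Om x (y - x)).

Fixpoint eulern n x y : quat R :=
  if n is n'.+1 then eulern n' x (mid x y) *q eulern n' (mid x y) y
  else euler x y.

Lemma S3_eulern n x y : B x -> B y -> S3 (eulern n x y).
Proof.
elim: n x y => [|n ih] x y Bx By /=.
  by apply: S3_normalize_1D; exact: Om_im.
by apply: S3M; apply: ih => //; exact: B_mid.
Qed.

Let C := 2 * M ^+ 2 + M.

Let C_ge0 : 0 <= C.
Proof. by rewrite addr_ge0 // mulr_ge0 // sqr_ge0. Qed.

(** Bisecting a step has an effect of second order, because Om is Lipschitz. *)
Lemma euler_mid x y : B x -> B y ->
  enorm (euler x (mid x y) *q euler (mid x y) y - euler x y) <=
  C * enorm (y - x) ^+ 2.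
Proof.
move=> Bx By; have Bm := B_mid Bx By; set m := mid x y in Bm *.
set d := y - x; set D := enorm d.
have D0 : 0 <= D by exact: enorm_ge0.
pose a := Om x (m - x); pose b := Om m (y - m); pose c := Om x d.
have ca : c = a + a.
  by rewrite /c /a midBl -/d -OmD -scalerDl -mulr2n -(mulr_natr 2^-1) mulVf // scale1r.
have ha : enorm a <= M * (D / 2).
  by apply: le_trans (Om_bound _ Bx) _; rewrite midBl enorm_half.
have hb : enorm b <= M * (D / 2).
  by apply: le_trans (Om_bound _ Bm) _; rewrite midBr enorm_half.
have hc : enorm c <= M * D by exact: Om_bound.
have hab : enorm (b - a) <= M * (D / 2) * (D / 2).
  apply: le_trans (_ : enorm (Om m (m - x) - Om x (m - x)) <= _).
    by rewrite /b midBr -midBl.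
  by apply: le_trans (Om_lip _ Bm Bx) _; rewrite midBl enorm_half.
have MD : M * D <= 1 by exact: B_small.
have sa : enorm (euler x m - (qone R + a)) <= (M * (D / 2)) ^+ 2.
  apply: le_trans (normalize_1D (Om_im _ Bx)) _.
  by rewrite ler_pXn2r ?nnegrE ?enorm_ge0 ?mulr_ge0 ?divr_ge0.
have sb : enorm (euler m y - (qone R + b)) <= (M * (D / 2)) ^+ 2.
  apply: le_trans (normalize_1D (Om_im _ Bm)) _.
  by rewrite ler_pXn2r ?nnegrE ?enorm_ge0 ?mulr_ge0 ?divr_ge0.
have sc : enorm ((qone R + c) - euler x y) <= (M * D) ^+ 2.
  rewrite enormB; apply: le_trans (normalize_1D (Om_im _ Bx)) _.
  by rewrite ler_pXn2r ?nnegrE ?enorm_ge0 ?mulr_ge0 ?divr_ge0.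
have Sm : S3 (euler m y) by exact: (@S3_eulern 0).
have -> : euler x m *q euler m y - euler x y =
    (euler x m - (qone R + a)) *q euler m y +
    (qone R + a) *q (euler m y - (qone R + b)) + (b - a) + a *q b +
    (qone R + c - euler x y).
  rewrite ca; clear; move: (euler x m) (euler m y) (euler x y) => p q r.
  quat_ring.
have h1 : enorm ((qone R + a) *q (euler m y - (qone R + b))) <= 2 * (M * (D / 2)) ^+ 2.
  rewrite enormM ler_pM ?enorm_ge0 //.
  by apply: le_trans (enormD _ _) _; rewrite enorm1; lra.
have h2 : enorm (a *q b) <= (M * (D / 2)) ^+ 2.
  by rewrite enormM expr2 ler_pM ?enorm_ge0.
apply: le_trans (_ : (M * (D / 2)) ^+ 2 + 2 * (M * (D / 2)) ^+ 2 +
  M * (D / 2) * (D / 2) + (M * (D / 2)) ^+ 2 + (M * D) ^+ 2 <= _).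
  do 4![apply: le_trans (enormD _ _) _; apply: lerD => //].
  by rewrite enorm_S3r.
rewrite /C; have -> : (2 * M ^+ 2 + M) * D ^+ 2 = 2 * (M * D) ^+ 2 + M * D ^+ 2.
  by ring.
have -> : M * (D / 2) * (D / 2) = M * D ^+ 2 / 4 by field.
have -> : (M * (D / 2)) ^+ 2 = (M * D) ^+ 2 / 4 by field.
have : 0 <= M * D ^+ 2 by rewrite mulr_ge0 // sqr_ge0.
lra.
Qed.

(** The n-th bisection replaces 2^n steps, and the effect on each of them is of
    order 4^-n. *)
Lemma eulern_step n x y : B x -> B y ->
  enorm (eulern n.+1 x y - eulern n x y) <= C * enorm (y - x) ^+ 2 / 2 ^+ n.
Proof.
elim: n x y => [|n ih] x y Bx By.
  by rewrite expr0 divr1; exact: euler_mid.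
have Bm := B_mid Bx By; set m := mid x y in Bm.
have -> : eulern n.+2 x y = eulern n.+1 x m *q eulern n.+1 m y by [].
have -> : eulern n.+1 x y = eulern n x m *q eulern n m y by [].
apply: le_trans (enormM_sub_le _ _ _ _) _; [exact: S3_eulern|exact: S3_eulern|].
apply: le_trans (lerD (ih _ _ Bx Bm) (ih _ _ Bm By)) _.
rewrite midBl midBr enorm_half (exprS 2 n).
rewrite le_eqVlt; apply/orP; left; apply/eqP; by field; rewrite expf_neq0.
Qed.

(** The value at y of the solution of dr = r Om along the segment from x to y
    that starts at 1. *)
Definition transport x y : quat R :=
  \row_m limn (fun n => eulern n x y 0 m).

Lemma transport_lim n x y : B x -> B y ->
  enorm (transport x y - eulern n x y) <= 4 * C * enorm (y - x) ^+ 2 / 2 ^+ n.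
Proof.
move=> Bx By; apply: le_trans (enorm_le_mx_norm _) _.
have K0 : 0 <= C * enorm (y - x) ^+ 2 / 2 ^+ n.
  by rewrite divr_ge0 ?exprn_ge0 // mulr_ge0 // sqr_ge0.
suff : `|transport x y - eulern n x y| <= 2 * (C * enorm (y - x) ^+ 2) / 2 ^+ n.
  by rewrite -!mulrA; lra.
rewrite {1}/Num.norm /= mx_normrE; apply/bigmax_leP; split.
  by rewrite -mulrA mulr_ge0.
move=> -[i m] _ /=; rewrite ord1 !mxE.
apply: (@geometric_cvg _ (fun n => eulern n x y 0 m)) => k.
have := eulern_step k Bx By; apply: le_trans.
by apply: le_trans _ (coord_le_enorm _ m); rewrite !mxE.
Qed.

Lemma S3_transport x y : B x -> B y -> S3 (transport x y).
Proof.
move=> Bx By; apply/eqP; rewrite -subr_eq0 -normr_le0.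
apply: (@le0_of_geometric _ _ (4 * C * enorm (y - x) ^+ 2)) => n.
have := transport_lim n Bx By; apply: le_trans.
have S1 : enorm (eulern n x y) = 1 by exact: S3_eulern.
rewrite ler_norml; apply/andP; split.
  have := enormD (transport x y) (eulern n x y - transport x y).
  by rewrite addrC subrK enormB S1; lra.
have := enormD (eulern n x y) (transport x y - eulern n x y).
by rewrite addrC subrK S1; lra.
Qed.

Lemma transport_mid x y : B x -> B y ->
  transport x y = transport x (mid x y) *q transport (mid x y) y.
Proof.
move=> Bx By; have Bm := B_mid Bx By; set m := mid x y in Bm *.
apply/eqP; rewrite -subr_eq0 -enorm_eq0 eq_le enorm_ge0 andbT.
set K := 4 * C * enorm (y - x) ^+ 2.
have K0 : 0 <= K by rewrite mulr_ge0 ?sqr_ge0 // mulr_ge0.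
apply: (@le0_of_geometric _ _ (2 * K)) => n.
apply: le_trans (enormBD _ (eulern n.+1 x y) _) _.
have h1 := transport_lim n.+1 Bx By.
have h2 : enorm (eulern n.+1 x y - transport x m *q transport m y) <=
    2 * (K / 4 / 2 ^+ n).
  apply: le_trans (enormM_sub_le _ _ _ _) _; [exact: S3_transport|exact: S3_eulern|].
  rewrite enormB (enormB (eulern n m y)).
  have := lerD (transport_lim n Bx Bm) (transport_lim n Bm By).
  rewrite midBl midBr enorm_half => /le_trans; apply.
  rewrite le_eqVlt; apply/orP; left; apply/eqP; by rewrite /K; field; rewrite expf_neq0.
apply: le_trans (lerD h1 h2) _; rewrite -/K (exprS 2 n).
have -> : K / (2 * 2 ^+ n) = K / 2 ^+ n / 2 by field; rewrite expf_neq0.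
have -> : K / 4 / 2 ^+ n = K / 2 ^+ n / 4 by field; rewrite expf_neq0.
have : 0 <= K / 2 ^+ n by rewrite divr_ge0 // exprn_ge0.
lra.
Qed.

Lemma transport_linear x y : B x -> B y ->
  enorm (transport x y - (qone R + Om x (y - x))) <=
  (4 * C + M ^+ 2) * enorm (y - x) ^+ 2.
Proof.
move=> Bx By; apply: le_trans (enormBD _ (euler x y) _) _.
have := transport_lim 0 Bx By; rewrite expr0 divr1 => h.
rewrite mulrDl; apply: lerD h _; apply: le_trans (normalize_1D (Om_im _ Bx)) _.
by rewrite -exprMn ler_pXn2r ?nnegrE ?enorm_ge0 ?mulr_ge0 ?enorm_ge0 ?Om_bound.
Qed.

Lemma transportxx x : B x -> transport x x = qone R.
Proof.
move=> Bx; apply/eqP; rewrite -subr_eq0 -enorm_eq0 eq_le enorm_ge0 andbT.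
have := transport_linear Bx Bx; rewrite subrr enorm0 expr0n mulr0.
have -> : Om x 0 = 0 by have := OmZ x 0 0; rewrite !scale0r.
by rewrite addr0.
Qed.

(** Flatness at z: Om is differentiable there, with a derivative K that makes
    the curvature d Om + Om /\ Om vanish. *)
Hypothesis Om_flat : forall z, B z -> exists (K : quat R -> quat R -> quat R) (N : R),
  [/\ 0 <= N,
      forall u v w, K (u + v) w = K u w + K v w /\
                    K w (u + v) = K w u + K w v,
      forall u v, enorm (K u v) <= N * enorm u * enorm v,
      forall u v, K u v - K v u + (Om z u *q Om z v - Om z v *q Om z u) = 0 &
      forall e, 0 < e -> exists2 d, 0 < d & forall x v, B x -> enorm (x - z) <= d ->
        enorm (Om x v - Om z v - K (x - z) v) <= e * enorm (x - z) * enorm v].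

Lemma small_factor (c e : R) : 0 <= c -> 0 < e -> exists2 d, 0 < d & c * d <= e.
Proof.
move=> c0 e0; exists (e / (c + 1)); first by rewrite divr_gt0 // ltr_wpDl.
rewrite mulrCA ler_piMr ?(ltW e0) // ler_pdivrMr ?ltr_wpDl // mul1r.
by rewrite lerDl.
Qed.

Lemma enorm_mid_le z x y r : enorm (x - z) <= r -> enorm (y - z) <= r ->
  enorm (mid x y - z) <= r.
Proof.
move=> hx hy; have -> : mid x y - z = 2^-1 *: (x - z) + 2^-1 *: (y - z).
  by apply/rowP => m; rewrite !mxE; field.
by apply: le_trans (enormD _ _) _; rewrite !enorm_half; lra.
Qed.

(** Near a point where the connection is flat, the equation dg = g Om has a
    solution up to second order, namely the polynomial
    g = 1 + L u + (K u u + L u * L u) / 2 in u = x - z; flatness says that the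
    derivative of its quadratic part is the linear part of g Om.  Comparing the
    transport with g on 2^n pieces of a segment shows that transport is path
    independent up to an error o(r) times the length of the segment. *)
Lemma transport_second_order z e : B z -> 0 < e ->
  exists (g : quat R -> quat R) (d : R), 0 < d /\
  forall r x y, 0 < r <= d -> B x -> B y ->
    enorm (x - z) <= r -> enorm (y - z) <= r ->
    1 / 2 <= enorm (g x) /\
    enorm (g x *q transport x y - g y) <= e * r * enorm (y - x).
Proof.
move=> Bz e0; have [K [N [N0 KD KN Kflat Kdiff]]] := Om_flat Bz.
have KDl u v w : K (u + v) w = K u w + K v w by have [] := KD u v w.
have KDr u v w : K w (u + v) = K w u + K w v by have [] := KD u v w.
have [d0 d0_gt0 Kd] := Kdiff _ (divr_gt0 e0 (ltr0Sn _ 1)).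
pose L := Om z; pose q u := 2^-1 *: (K u u + L u *q L u).
pose g x := qone R + L (x - z) + q (x - z).
have qN u : enorm (q u) <= (N + M ^+ 2) / 2 * enorm u ^+ 2.
  rewrite enorm_half -mulrA (mulrC 2^-1) mulrA ler_wpM2r ?invr_ge0 //.
  apply: le_trans (enormD _ _) _; rewrite enormM mulrDl; apply: lerD.
    by rewrite expr2 mulrA.
  by rewrite -exprMn expr2 ler_pM ?enorm_ge0 // Om_bound.
have c1_ge0 : 0 <= M + (N + M ^+ 2) / 2.
  by rewrite addr_ge0 // divr_ge0 // addr_ge0 // sqr_ge0.
have c2_ge0 : 0 <= M ^+ 2 + (N + M ^+ 2) / 2 * M.
  by rewrite addr_ge0 ?sqr_ge0 // mulr_ge0 // divr_ge0 // addr_ge0 // sqr_ge0.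
have [d1 d1_gt0 c1d] := small_factor c1_ge0 (ltac:(lra) : (0 : R) < 1 / 2).
have [d2 d2_gt0 c2d] := small_factor c2_ge0 (divr_gt0 e0 (ltr0Sn _ 1)).
pose d := Num.min (Num.min d0 d1) (Num.min d2 1).
have d_gt0 : 0 < d by rewrite !lt_min d0_gt0 d1_gt0 d2_gt0 ltr01.
exists g, d; split=> // r x y /andP[r0 rd].
move: rd; rewrite !le_min => /andP[/andP[rd0 rd1] /andP[rd2 r1]].
have g1 w : B w -> enorm (w - z) <= r -> enorm (L (w - z) + q (w - z)) <= 1 / 2.
  move=> Bw hw; apply: le_trans (enormD _ _) _.
  have h1 : enorm (L (w - z)) <= M * r.
    by apply: le_trans (Om_bound _ Bz) _; rewrite ler_wpM2l.
  have h2 : enorm (q (w - z)) <= (N + M ^+ 2) / 2 * r.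
    apply: le_trans (qN _) _; rewrite ler_wpM2l ?divr_ge0 ?addr_ge0 ?sqr_ge0 //.
    rewrite expr2 -[leRHS]mulr1 ler_pM ?enorm_ge0 //; exact: le_trans hw r1.
  have : (M + (N + M ^+ 2) / 2) * r <= 1 / 2.
    by apply: le_trans _ c1d; rewrite ler_wpM2l.
  by rewrite mulrDl; lra.
have g2 w : B w -> enorm (w - z) <= r -> 1 / 2 <= enorm (g w) <= 2.
  move=> Bw hw; have h := g1 w Bw hw; rewrite /g -addrA.
  have := enormD (qone R) (L (w - z) + q (w - z)).
  have := enormD (qone R + (L (w - z) + q (w - z))) (- (L (w - z) + q (w - z))).
  rewrite addrK enorm1 enormN => h1 h2.
  by apply/andP; split; lra.
pose C2 := 2 * (4 * C + M ^+ 2) + (N + M ^+ 2) / 2.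
have step x' y' : B x' -> B y' -> enorm (x' - z) <= r -> enorm (y' - z) <= r ->
    enorm (g x' *q transport x' y' - g y') <=
    e * r * enorm (y' - x') + C2 * enorm (y' - x') ^+ 2.
  move=> Bx' By' hx hy; set D := enorm (y' - x').
  have D0 : 0 <= D by exact: enorm_ge0.
  pose u := x' - z; pose v := y' - x'; pose O := Om x' v.
  pose E := O - L v - K u v.
  have hE : enorm E <= e / 2 * r * D.
    apply: le_trans (Kd _ _ Bx' (le_trans hx rd0)) _.
    by rewrite ler_wpM2r // ler_wpM2l // divr_ge0 // ltW.
  have -> : g x' *q transport x' y' - g y' =
     g x' *q (transport x' y' - (qone R + O)) + E + L u *q (O - L v) + q u *q O -
     q v.
    have -> : g y' = qone R + L (u + v) + q (u + v).
      by rewrite /g; have -> : y' - z = u + v by rewrite /u /v [RHS]addrC subrKA.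
    rewrite /g -/u /q (KDl u v) !(KDr u v) /L (OmD z u v) -/L.
    (* Flatness makes the quadratic part of g symmetric in u and v. *)
    have := Kflat u v; rewrite -/L => /eqP; rewrite addr_eq0 => /eqP fl.
    have {}fl : K u v = K v u - (L u *q L v - L v *q L u).
      by rewrite -fl addrCA subrr addr0.
    rewrite /E fl; clear E hE.
    rewrite !(qmulDl, qmulDr, qmulNl, qmulNr, qmulZl, qmul1, q1mul).
    by apply/rowP => m; rewrite !quatE; field.
  have h1 : enorm (g x' *q (transport x' y' - (qone R + O))) <=
      2 * ((4 * C + M ^+ 2) * D ^+ 2).
    rewrite enormM ler_pM ?enorm_ge0 //; last exact: transport_linear.
    by have /andP[] := g2 _ Bx' hx.
  have h2 : enorm (L u *q (O - L v)) <= M ^+ 2 * r * r * D.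
    rewrite enormM; have -> : M ^+ 2 * r * r * D = (M * r) * (M * r * D) by ring.
    rewrite ler_pM ?enorm_ge0 //.
      by apply: le_trans (Om_bound _ Bz) _; rewrite ler_wpM2l.
    by apply: le_trans (Om_lip _ Bx' Bz) _; rewrite ler_wpM2r // ler_wpM2l.
  have h3 : enorm (q u *q O) <= (N + M ^+ 2) / 2 * M * r * r * D.
    rewrite enormM.
    have -> : (N + M ^+ 2) / 2 * M * r * r * D = ((N + M ^+ 2) / 2 * r ^+ 2) * (M * D).
      by ring.
    rewrite ler_pM ?enorm_ge0 //; last exact: Om_bound.
    apply: le_trans (qN _) _; rewrite ler_wpM2l ?divr_ge0 ?addr_ge0 ?sqr_ge0 //.
    by rewrite ler_pXn2r ?nnegrE ?enorm_ge0 ?(ltW r0).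
  have h4 := qN v.
  have h5 : (M ^+ 2 + (N + M ^+ 2) / 2 * M) * r * (r * D) <= e / 2 * (r * D).
    rewrite ler_wpM2r ?mulr_ge0 ?(ltW r0) //.
    by apply: le_trans _ c2d; rewrite ler_wpM2l.
  apply: le_trans (_ : 2 * ((4 * C + M ^+ 2) * D ^+ 2) + e / 2 * r * D +
     M ^+ 2 * r * r * D + (N + M ^+ 2) / 2 * M * r * r * D +
     (N + M ^+ 2) / 2 * D ^+ 2 <= _).
    rewrite -enormN in h4.
    by do 4![apply: le_trans (enormD _ _) _; apply: lerD => //].
  rewrite /C2; move: h5; set c := N + M ^+ 2; lra.
(* The terms of second order in the length of the segment disappear under
   repeated bisection. *)
have refine n x' y' : B x' -> B y' -> enorm (x' - z) <= r -> enorm (y' - z) <= r ->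
    enorm (g x' *q transport x' y' - g y') <=
    e * r * enorm (y' - x') + C2 * enorm (y' - x') ^+ 2 / 2 ^+ n.
  elim: n x' y' => [|n ih] x' y' Bx' By' hx hy; first by rewrite expr0 divr1; exact: step.
  have Bm := B_mid Bx' By'; have hm := enorm_mid_le hx hy.
  rewrite (transport_mid Bx' By').
  set t1 := transport x' _; set t2 := transport _ y'.
  have -> : g x' *q (t1 *q t2) - g y' =
     (g x' *q t1 - g (mid x' y')) *q t2 + (g (mid x' y') *q t2 - g y').
    by rewrite qmulBl qmulA addrA subrK.
  apply: le_trans (enormD _ _) _; rewrite enorm_S3r; last exact: S3_transport.
  apply: le_trans (lerD (ih _ _ Bx' Bm hx hm) (ih _ _ Bm By' hm hy)) _.
  rewrite midBl midBr enorm_half (exprS 2 n).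
  rewrite le_eqVlt; apply/orP; left; apply/eqP.
  by field; rewrite expf_neq0.
move=> Bx By hx hy; split; first by have /andP[] := g2 _ Bx hx.
rewrite -subr_le0; apply: (@le0_of_geometric _ _ (C2 * enorm (y - x) ^+ 2)) => n.
by rewrite lerBlDl; exact: refine.
Qed.

(** Goursat's argument: the defect of path independence around a square of
    side h is at most the sum of the defects of its quarters, and is o(h^2)
    near each point, so it vanishes.  The square is mapped to the triangle
    x, y, z by a map that is affine on horizontal and vertical segments. *)
Lemma transport_trans x y z : B x -> B y -> B z ->
  transport x y *q transport y z = transport x z.
Proof.
move=> Bx By Bz; pose u : quat R := y - x; pose v : quat R := z - y.
pose F (s t : R) : quat R := x + s *: (u + t *: v).
have BF s t : 0 <= s <= 1 -> 0 <= t <= 1 -> B (F s t).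
  move=> hs ht; have -> : F s t = x + s *: ((y + t *: (z - y)) - x).
    by rewrite /F /u /v addrAC.
  by apply: B_convex => //; exact: B_convex.
have F0 t : F 0 t = x by rewrite /F scale0r addr0.
have F10 : F 1 0 = y by rewrite /F scale0r addr0 scale1r addrC subrK.
have F11 : F 1 1 = z by apply/rowP => m; rewrite !mxE; ring.
have Fmidl s h t : mid (F s t) (F (s + h + h) t) = F (s + h) t.
  by apply/rowP => m; rewrite !mxE; field.
have Fmidr s h t : mid (F s t) (F s (t + h + h)) = F s (t + h).
  by apply/rowP => m; rewrite !mxE; field.
have FB s t s' t' :
    F s t - F s' t' = (s - s') *: u + ((s - s') * t) *: v + (s' * (t - t')) *: v.
  by apply/rowP => m; rewrite !mxE; ring.
clearbody u v F.
pose T s t s' t' := transport (F s t) (F s' t').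
pose defect a b h := enorm (T a b (a + h) b *q T (a + h) b (a + h) (b + h) -
                            T a b a (b + h) *q T a (b + h) (a + h) (b + h)).
suff : defect 0 0 1 <= 0.
  rewrite /defect /T !add0r !F0 F10 F11 transportxx // q1mul => h.
  by apply/eqP; rewrite -subr_eq0 -enorm_eq0 eq_le enorm_ge0 andbT.
clear F0 F10 F11.
pose l := enorm u + 2 * enorm v + 1.
have l_gt0 : 0 < l by rewrite ltr_wpDl // addr_ge0 ?mulr_ge0 ?enorm_ge0.
apply/ler_addgt0Pl => e e0; rewrite addr0.
have defect4 a b h : 0 < h -> 0 <= a -> a + 2 * h <= 1 -> 0 <= b -> b + 2 * h <= 1 ->
    defect a b (2 * h) <= defect a b h + defect (a + h) b h + defect a (b + h) h +
                         defect (a + h) (b + h) h.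
  move=> h0 a0 a1 b0 b1.
  have Ba : [/\ 0 <= a <= 1, 0 <= a + h <= 1 & 0 <= a + h + h <= 1] by split; lra.
  have Bb : [/\ 0 <= b <= 1, 0 <= b + h <= 1 & 0 <= b + h + h <= 1] by split; lra.
  have [? ? ?] := Ba; have [? ? ?] := Bb.
  rewrite /defect; have -> : a + 2 * h = a + h + h by ring.
  have -> : b + 2 * h = b + h + h by ring.
  have TS s t s' t' : 0 <= s <= 1 -> 0 <= t <= 1 -> 0 <= s' <= 1 -> 0 <= t' <= 1 ->
    S3 (T s t s' t') by move=> *; apply: S3_transport; exact: BF.
  have horiz t : 0 <= t <= 1 -> T a t (a + h + h) t = T a t (a + h) t *q T (a + h) t (a + h + h) t.
    move=> ht; rewrite /T (transport_mid (BF a t _ ht) (BF (a + h + h) t _ ht)) //.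
    by rewrite Fmidl.
  have vert s : 0 <= s <= 1 -> T s b s (b + h + h) = T s b s (b + h) *q T s (b + h) s (b + h + h).
    move=> hs; rewrite /T (transport_mid (BF s b hs _) (BF s (b + h + h) hs _)) //.
    by rewrite Fmidr.
  rewrite !horiz // !vert //.
  by apply: square_defect_le; apply: TS.
suff : defect 0 0 1 <= e * 1 ^+ 2 by rewrite expr1n mulr1.
apply: (@square_induction _ (fun a b h => defect a b h <= e * h ^+ 2)).
  move=> a b h h0 a0 a1 b0 b1 q1 q2 q3 q4.
  apply: le_trans (defect4 _ _ _ h0 a0 a1 b0 b1) _; move: q1 q2 q3 q4.
  move: (defect a b h) (defect (a + h) b h) (defect a (b + h) h).
  by move: (defect (a + h) (b + h) h) => d1 d2 d3 d4; lra.
move=> s0 t0 hs0 ht0.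
have e'0 : 0 < e / (8 * l ^+ 2) by rewrite divr_gt0 // mulr_gt0 // exprn_gt0.
(* Sides of length at most l h and points within l h of the centre: each of the
   four comparisons below costs e h^2 / 8, and g is at least 1 / 2. *)
have [g [d [d0 gP]]] := transport_second_order (BF _ _ hs0 ht0) e'0.
exists (d / l); first by rewrite divr_gt0.
move=> a b h /andP[h0 hd] a0 a1 b0 b1 /andP[as0 s0a] /andP[bt0 t0b].
have lh : 0 < l * h by rewrite mulr_gt0.
have lhd : 0 < l * h <= d by rewrite lh -ler_pdivlMl // mulrC ltW.
have close s t s' t' : 0 <= t <= 1 -> 0 <= s' <= 1 -> `|s - s'| <= h -> `|t - t'| <= h ->
    enorm (F s t - F s' t') <= l * h.
  move=> /andP[t0' t1'] /andP[s0' s1'] hs ht.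
  rewrite FB.
  apply: le_trans (_ : h * enorm u + h * enorm v + h * enorm v <= _); last first.
    have -> : l * h = h * enorm u + h * enorm v + h * enorm v + h by rewrite /l; ring.
    by rewrite lerDl ltW.
  apply: le_trans (enormD _ _) _; apply: lerD.
    apply: le_trans (enormD _ _) _; apply: lerD.
      by rewrite enormZ ler_wpM2r ?enorm_ge0.
    rewrite enormZ ler_wpM2r ?enorm_ge0 // normrM (ger0_norm t0').
    by rewrite -[leRHS]mulr1 ler_pM.
  - rewrite enormZ ler_wpM2r ?enorm_ge0 // normrM (ger0_norm s0').
    by rewrite -[leRHS]mul1r ler_pM.
have [ha ha' hb hb'] : [/\ 0 <= a <= 1, 0 <= a + h <= 1, 0 <= b <= 1 & 0 <= b + h <= 1].
  by move: a0 a1 b0 b1 h0; split; lra.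
have step s t s' t' : (s = a \/ s = a + h) -> (s' = a \/ s' = a + h) ->
    (t = b \/ t = b + h) -> (t' = b \/ t' = b + h) ->
    1 / 2 <= enorm (g (F s t)) /\
    enorm (g (F s t) *q T s t s' t' - g (F s' t')) <= e / (8 * l ^+ 2) * (l * h) * (l * h).
  move=> hs hs' ht ht'.
  have s01 : 0 <= s <= 1 by case: hs => ->.
  have s'01 : 0 <= s' <= 1 by case: hs' => ->.
  have t01 : 0 <= t <= 1 by case: ht => ->.
  have t'01 : 0 <= t' <= 1 by case: ht' => ->.
  have corner (p r : R) : (p = r \/ p = r + h) -> r <= p <= r + h.
    by move=> [->|->]; rewrite lexx ?andbT lerDl ltW.
  have h_ge0 := ltW h0.
  have sa := corner _ _ hs; have s'a := corner _ _ hs'.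
  have tb := corner _ _ ht; have t'b := corner _ _ ht'.
  have [||h1 h2] := gP (l * h) _ _ lhd (BF _ _ s01 t01) (BF _ _ s'01 t'01).
  - by apply: close => //; [apply: (@dist_of_itv _ _ a)|apply: (@dist_of_itv _ _ b)]; rewrite ?as0 ?bt0.
  - by apply: close => //; [apply: (@dist_of_itv _ _ a)|apply: (@dist_of_itv _ _ b)]; rewrite ?as0 ?bt0.
  split=> //; apply: le_trans h2 _; apply: ler_wpM2l.
    by rewrite mulr_ge0 // ltW.
  by apply: close => //; [apply: (@dist_of_itv _ _ a)|apply: (@dist_of_itv _ _ b)].
have [g0 e1] := step a b (a + h) b (or_introl erefl) (or_intror erefl)
  (or_introl erefl) (or_introl erefl).
have [_ e2] := step (a + h) b (a + h) (b + h) (or_intror erefl) (or_intror erefl)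
  (or_introl erefl) (or_intror erefl).
have [_ e3] := step a b a (b + h) (or_introl erefl) (or_introl erefl)
  (or_introl erefl) (or_intror erefl).
have [_ e4] := step a (b + h) (a + h) (b + h) (or_introl erefl) (or_intror erefl)
  (or_intror erefl) (or_intror erefl).
set k := e / (8 * l ^+ 2) * (l * h) * (l * h) in e1 e2 e3 e4.
have kE : k = e * h ^+ 2 / 8 by rewrite /k; field; rewrite lt0r_neq0.
have h1 := comparison_two_steps (S3_transport (BF _ _ ha' hb) (BF _ _ ha' hb')) e1 e2.
have h2 := comparison_two_steps (S3_transport (BF _ _ ha hb') (BF _ _ ha' hb')) e3 e4.
have h3 : enorm (g (F a b)) * defect a b h <= 4 * k.
  rewrite /defect -enormM qmulBr.
  apply: le_trans (enormBD _ (g (F (a + h) (b + h))) _) _; rewrite [X in _ + X]enormB.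
  by apply: le_trans (lerD h1 h2) _; rewrite !mulr_natl !mulrSr mulr0n add0r !addrA.
have h4 : 1 / 2 * defect a b h <= enorm (g (F a b)) * defect a b h.
  by rewrite ler_wpM2r // enorm_ge0.
rewrite kE in h3; move: h3 h4; move: (enorm (g (F a b)) * defect a b h) => X; move: (defect a b h) => Y; lra.
Qed.

End Transport.

(** * Calculus of maps of class C^k *)

Section Differentials.
Variables (R : realType) (E V : normedModType R).
Implicit Types (f g : E -> V) (x v : E).

Lemma linear_le_continuous (L : {linear E -> V}) (C : R) :
  (forall h, `|L h| <= C * `|h|) -> continuous L.
Proof.
move=> LC; apply: bounded_linear_continuous; apply/linear_boundedP.
near=> r; move=> h; apply: le_trans (LC h) _; rewrite ler_wpM2r //.
Unshelve. all: by end_near. Qed.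

Lemma differentiable_intro f (L : {linear E -> V}) x : continuous L ->
  (forall e, 0 < e -> \forall h \near (0 : E), `|f (h + x) - f x - L h| <= e * `|h|) ->
  differentiable f x /\ 'd f x = L :> (E -> V).
Proof.
move=> cL fL.
have fE : f \o shift x = cst (f x) + L +o_ (0 : E) id.
  apply/eqaddoP => e e0; near=> h.
  have -> : (f \o shift x - (cst (f x) + L)) h = f (h + x) - f x - L h.
    by rewrite !fctE /= opprD addrA.
  by near: h; exact: fL.
have dE := diff_unique cL fE; split=> //.
by apply/diff_locallyP; rewrite dE.
Unshelve. all: by end_near. Qed.

Lemma differentiable_near_eq f g x : (\near x, f x = g x) -> differentiable f x ->
  differentiable g x.
Proof.
move=> fg df; apply: (proj1 (@differentiable_intro g ('d f x) x _ _)).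
  exact: diff_continuous.
move=> e e0; have /eqaddoP /(_ e e0) := diff_locally df.
have fgx := nbhs_singleton fg.
have : \forall h \near (0 : E), f (h + x) = g (h + x).
  by move: fg; rewrite (near_shift 0) /= subr0.
apply: filterS2 => h fgh.
by rewrite !fctE /= opprD addrA fgh fgx.
Qed.

Lemma deriveDv f x v w : differentiable f x ->
  'D_(v + w) f x = 'D_v f x + 'D_w f x.
Proof. by move=> df; rewrite !deriveE // linearD. Qed.

Lemma deriveZv f x (a : R) v : differentiable f x ->
  'D_(a *: v) f x = a *: 'D_v f x.
Proof. by move=> df; rewrite !deriveE // linearZ. Qed.

End Differentials.

Section ContinuousDifferentiability.
Variables (R : realType) (E : normedModType R).
Implicit Types (W : set E) (n : nat).

Lemma open_near (T : topologicalType) (W : set T) (P : T -> Prop) x : open W -> W x ->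
  (forall y, W y -> P y) -> \near x, P x.
Proof.
move=> oW Wx WP; have : nbhs x W by exact: open_nbhs_nbhs.
exact: filterS.
Qed.

Lemma Ck_ext (V : normedModType R) n W (f g : E -> V) : open W ->
  (forall x, W x -> f x = g x) -> Ck n W f -> Ck n W g.
Proof.
move=> oW; elim: n f g => [|n ih] f g fg /=.
  move=> cf x Wx; change (g @ x --> g x); rewrite -fg //.
  apply: cvg_trans (cf x Wx); apply: near_eq_cvg.
  by apply: (open_near oW Wx) => y Wy; rewrite fg.
move=> [df ddf]; split=> [x Wx|v].
  by apply: differentiable_near_eq (df x Wx); exact: (open_near oW Wx).
apply: ih (ddf v) => x Wx; apply: near_eq_derive; exact: (open_near oW Wx).
Qed.

Lemma Ck_sub (V : normedModType R) n W W' (f : E -> V) : W' `<=` W -> Ck n W f -> Ck n W' f.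
Proof.
move=> sW; elim: n f => [|n ih] f /= => [cf x /sW /cf //|[df ddf]].
by split=> [x /sW /df //|v]; exact: ih.
Qed.

Lemma Ck_local (V : normedModType R) n W (f : E -> V) :
  (forall x, W x -> exists2 W', W' x & Ck n W' f) -> Ck n W f.
Proof.
elim: n f => [|n ih] f h.
  by move=> x /h [W' W'x cf]; exact: cf.
split=> [x /h [W' W'x [df _]]|v]; first exact: df.
by apply: ih => x /h [W' W'x [_ ddf]]; exists W' => //; exact: ddf.
Qed.

Lemma CkW (V : normedModType R) n W (f : E -> V) : Ck n.+1 W f -> Ck n W f.
Proof.
elim: n f => [|n ih] f [df ddf] /=.
  by move=> x /df; exact: differentiable_continuous.
by split=> // v; apply: ih; exact: ddf.
Qed.

Lemma Ck_cst (V : normedModType R) n W (c : V) : Ck n W (fun=> c).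
Proof.
elim: n c => [|n ih] c /=; first by move=> x _; exact: cst_continuous.
split=> [x _|v]; first exact: differentiable_cst.
have -> : (fun x => 'D_v (fun=> c) x) = (fun=> 0) :> (E -> V).
  by apply/funext => x; exact: derive_cst.
exact: ih.
Qed.

Lemma CkD (V : normedModType R) n W (f g : E -> V) : open W -> Ck n W f -> Ck n W g ->
  Ck n W (fun x => f x + g x).
Proof.
move=> oW; elim: n f g => [|n ih] f g /=.
  by move=> cf cg x Wx; apply: cvgD; [exact: cf|exact: cg].
move=> [df ddf] [dg ddg]; split=> [x Wx|v].
  by apply: differentiableD; [exact: df|exact: dg].
apply: (Ck_ext oW) (ih _ _ (ddf v) (ddg v)) => x Wx.
by rewrite -deriveD //; apply: diff_derivable; [exact: df|exact: dg].
Qed.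

Lemma CkM n W (f g : E -> R) : open W -> Ck n W f -> Ck n W g ->
  Ck n W (fun x => f x * g x).
Proof.
move=> oW; elim: n f g => [|n ih] f g.
  by move=> cf cg x Wx; apply: cvgM; [exact: cf|exact: cg].
move=> cf cg; have cf' := CkW cf; have cg' := CkW cg.
case: cf cg => df ddf [dg ddg]; split=> [x Wx|v].
  by apply: differentiableM; [exact: df|exact: dg].
apply: (Ck_ext oW) (CkD oW (ih _ _ cf' (ddg v)) (ih _ _ cg' (ddf v))) => x Wx.
have := @deriveM _ _ f g x v (diff_derivable (df x Wx)) (diff_derivable (dg x Wx)).
exact: esym.
Qed.

Lemma CkN n W (f : E -> R) : open W -> Ck n W f -> Ck n W (fun x => - f x).
Proof.
move=> oW cf; apply: (Ck_ext oW) (CkM oW (Ck_cst n W (-1 : R)) cf) => x _.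
by rewrite mulN1r.
Qed.

Lemma CkB n W (f g : E -> R) : open W -> Ck n W f -> Ck n W g ->
  Ck n W (fun x => f x - g x).
Proof. by move=> oW cf cg; apply: CkD => //; exact: CkN. Qed.

Lemma Ck_sum n W k (F : 'I_k -> E -> R) : open W -> (forall i, Ck n W (F i)) ->
  Ck n W (fun x => \sum_i F i x).
Proof.
move=> oW cF; elim: k F cF => [|k ih] F cF.
  by apply: (Ck_ext oW) (Ck_cst n W 0) => x _; rewrite big_ord0.
apply: (Ck_ext oW) (CkD oW (cF ord0) (ih (fun i => F (lift ord0 i)) (fun i => cF _))).
by move=> x _; rewrite big_ord_recl.
Qed.

Lemma derive_comp1 (f : E -> R) (g : R -> R) x v d : differentiable f x ->
  is_derive (f x) 1 g d ->
  differentiable (g \o f) x /\ 'D_v (g \o f) x = d * 'D_v f x.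
Proof.
move=> df dg.
have dg' : differentiable g (f x) by apply/derivable1_diffP; exact: ex_derive.
have dg1 : 'd g (f x) 1 = d by rewrite -deriveE // derive_val.
have dfg : differentiable (g \o f) x by exact: differentiable_comp.
split=> //; rewrite !deriveE // diff_comp //=; set y := 'd f x v.
have {1}-> : y = y *: (1 : R) by rewrite /GRing.scale /= mulr1.
by rewrite linearZ /= dg1 mulrC.
Qed.

(** For the inverse, the square root and the exponential, the derivative is an
    algebraic expression in the function itself, so the induction on the order
    of differentiability closes without knowing the higher derivatives. *)
Lemma Ck_comp1 n W (f : E -> R) (g d : R -> R) : open W ->
  (forall x, W x -> is_derive (f x) 1 g (d (f x))) ->
  (forall k, (k < n)%N -> Ck k W (g \o f) -> Ck k W f -> Ck k W (d \o f)) ->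
  Ck n W f -> Ck n W (g \o f).
Proof.
move=> oW gd; elim: n => [|n ih] dk.
  move=> cf x Wx; apply: (@continuous_comp _ _ _ f g); first exact: cf.
  apply: differentiable_continuous; apply/derivable1_diffP.
  by have [] := gd x Wx.
move=> cf; have cf' := CkW cf.
have cgf : Ck n W (g \o f) by apply: ih => // k kn; apply: dk; exact: ltnW.
case: cf => df ddf; split=> [x Wx|v].
  by have [] := derive_comp1 0 (df x Wx) (gd x Wx).
apply: (Ck_ext oW) (CkM oW (dk n (ltnSn n) cgf cf') (ddf v)) => x Wx.
by have [_ ->] := derive_comp1 v (df x Wx) (gd x Wx).
Qed.

Lemma CkV n W (f : E -> R) : open W -> (forall x, W x -> f x != 0) -> Ck n W f ->
  Ck n W (fun x => (f x)^-1).
Proof.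
move=> oW f0; apply: (@Ck_comp1 n W f (fun y => y^-1) (fun y => - (y^-1 * y^-1))) => //.
  move=> x /f0 fx0; have dI := @derivable_id R R (f x) 1.
  split; first exact: (@derivableV R R id (f x) 1 fx0 dI).
  rewrite (@deriveV R R id (f x) 1 fx0 dI) derive_id /GRing.scale /= mulr1.
  by rewrite expr2 invfM.
by move=> k _ h _; apply: CkN => //; exact: CkM.
Qed.

Lemma Ck_sqrt n W (f : E -> R) : open W -> (forall x, W x -> 0 < f x) -> Ck n W f ->
  Ck n W (fun x => Num.sqrt (f x)).
Proof.
move=> oW f0; apply: (@Ck_comp1 n W f Num.sqrt (fun y => (2 * Num.sqrt y)^-1)) => //.
  by move=> x /f0 fx0; exact: is_derive1_sqrt.
move=> k _ h _; apply: (CkV oW) (CkM oW (Ck_cst k W (2 : R)) h) => x /f0 fx0.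
by rewrite mulf_neq0 // gt_eqF // sqrtr_gt0.
Qed.

Lemma Ck_expR n W (f : E -> R) : open W -> Ck n W f -> Ck n W (fun x => expR (f x)).
Proof. by move=> oW; exact: (@Ck_comp1 n W f expR expR). Qed.

Lemma derive_pair (V V' : normedModType R) (f : E -> V) (g : E -> V') x v :
  differentiable f x -> differentiable g x ->
  'D_v (fun y => (f y, g y)) x = ('D_v f x, 'D_v g x).
Proof.
move=> df dg; rewrite deriveE; last exact: differentiable_pair.
by rewrite diff_pair // (deriveE _ df) (deriveE _ dg).
Qed.

Lemma Ck_pair (V V' : normedModType R) n W (f : E -> V) (g : E -> V') : open W ->
  Ck n W f -> Ck n W g -> Ck n W (fun x => (f x, g x)).
Proof.
move=> oW; elim: n f g => [|n ih] f g.
  by move=> cf cg x Wx; apply: cvg_pair; [exact: cf|exact: cg].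
move=> [df ddf] [dg ddg]; split=> [x Wx|v].
  by apply: differentiable_pair; [exact: df|exact: dg].
apply: (Ck_ext oW) (ih _ _ (ddf v) (ddg v)) => x Wx.
by rewrite derive_pair //; [exact: df|exact: dg].
Qed.

Lemma differentiable_coordinate (f : E -> quat R) x m : differentiable f x ->
  differentiable (fun y => f y 0 m) x.
Proof.
move=> df; apply: (@differentiable_comp _ _ _ _ f (fun z : quat R => z 0 m)) => //.
exact: differentiable_coord.
Qed.

Lemma derive_coordinate (f : E -> quat R) x v m : differentiable f x ->
  'D_v (fun y => f y 0 m) x = 'D_v f x 0 m.
Proof. by move=> df; rewrite derive_mx ?mxE //; exact: diff_derivable. Qed.

Lemma quat_sum_delta (z : quat R) : z = \sum_m z 0 m *: delta_mx 0 m.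
Proof. exact: row_sum_delta. Qed.

Lemma differentiable_quatP (f : E -> quat R) x :
  (forall m, differentiable (fun y => f y 0 m) x) -> differentiable f x.
Proof.
move=> df; have -> : f = \sum_m (fun y => f y 0 m *: (delta_mx 0 m : quat R)).
  by apply/funext => y; rewrite fct_sumE -quat_sum_delta.
by apply: differentiable_sum => m; exact: differentiableZl.
Qed.

Lemma Ck_quatP n W (f : E -> quat R) : open W ->
  Ck n W f <-> (forall m, Ck n W (fun x => f x 0 m)).
Proof.
move=> oW; elim: n f => [|n ih] f; split.
- move=> cf m x Wx; apply: (@continuous_comp _ _ _ f (fun z : quat R => z 0 m)).
    exact: cf.
  exact: coord_continuous.
- move=> cf x Wx; change (f @ x --> f x); rewrite [f in f @ _](_ : _ = (fun y => \sum_m f y 0 m *: delta_mx 0 m)).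
    rewrite (quat_sum_delta (f x)) 4!big_ord_recl big_ord0.
    under eq_fun do rewrite 4!big_ord_recl big_ord0.
    do 4![apply: cvgD; first by apply: cvgZr_tmp; exact: cf].
    exact: cvg_cst.
  by apply/funext => y; rewrite -quat_sum_delta.
- move=> [df ddf] m; split=> [x Wx|v]; first by apply: differentiable_coordinate; exact: df.
  have := (ih _).1 (ddf v) m; apply: (Ck_ext oW) => x Wx.
  by rewrite derive_coordinate //; exact: df.
- move=> cf; have df x : W x -> differentiable f x.
    by move=> Wx; apply: differentiable_quatP => m; have [df _] := cf m; exact: df.
  split=> // v; apply/ih => m; have [_ /(_ v)] := cf m.
  by apply: (Ck_ext oW) => x Wx; rewrite derive_coordinate //; exact: df.
Qed.

Lemma derive_sum_delta (V : normedModType R) (g : quat R -> V) y v : differentiable g y ->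
  'D_v g y = \sum_m v 0 m *: 'D_(delta_mx 0 m) g y.
Proof.
move=> dg; rewrite deriveE // {1}(quat_sum_delta v) raddf_sum.
by apply: eq_bigr => m _; rewrite deriveE // -linearZ.
Qed.

Lemma derive_comp (V : normedModType R) (f : E -> quat R) (g : quat R -> V) x v :
  differentiable f x -> differentiable g (f x) ->
  differentiable (g \o f) x /\ 'D_v (g \o f) x = 'D_('D_v f x) g (f x).
Proof.
move=> df dg; split; first exact: differentiable_comp.
rewrite deriveE; last exact: differentiable_comp.
by rewrite diff_comp // !deriveE.
Qed.

(** In coordinates, D_v (g o f) is a sum of products of derivatives of f with
    derivatives of g composed with f, to which the induction applies. *)
Lemma Ck_comp n W (W' : set (quat R)) (f : E -> quat R) (g : quat R -> R) :
  open W -> open W' -> (forall x, W x -> W' (f x)) -> Ck n W f -> Ck n W' g ->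
  Ck n W (g \o f).
Proof.
move=> oW oW' fW; elim: n g => [|n ih] g cf.
  move=> cg x Wx; apply: (@continuous_comp _ _ _ f g); first exact: cf.
  by apply: cg; exact: fW.
have cf' := CkW cf; case: cf => df ddf [dg ddg]; split=> [x Wx|v].
  by apply: differentiable_comp; [exact: df|apply: dg; exact: fW].
have : Ck n W (fun x => \sum_m 'D_v f x 0 m * 'D_(delta_mx 0 m) g (f x)).
  apply: Ck_sum => // m; apply: CkM => //.
    exact: ((Ck_quatP _ _ oW).1 (ddf v)).
  exact: (ih (fun y => 'D_(delta_mx 0 m) g y) cf' (ddg _)).
apply: (Ck_ext oW) => x Wx.
have dgx := dg _ (fW x Wx).
have [_ ->] := derive_comp v (df x Wx) dgx.
by rewrite derive_sum_delta.
Qed.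

End ContinuousDifferentiability.

(** * Mean values and symmetry of second derivatives *)

Section MeanValue.
Variable R : realType.
Implicit Types (W : set (quat R)) (x y z u v p : quat R).

Lemma derive_line x v (t : R) :
  differentiable (fun s : R => x + s *: v) t /\ 'D_1 (fun s : R => x + s *: v) t = v.
Proof.
have d : is_diff t (fun s : R => x + s *: v) (fun s : R => s *: v).
  have := @is_diffD _ _ _ (cst x) (fun s : R => s *: v) 0 (fun s : R => s *: v) t _ _.
  by rewrite add0r; exact.
split; first exact: ex_diff.
by rewrite deriveE ?diff_val ?scale1r //; exact: ex_diff.
Qed.

Lemma mean_value (f : quat R -> R) x v :
  (forall t : R, 0 <= t <= 1 -> differentiable f (x + t *: v)) ->
  exists2 t : R, 0 <= t <= 1 & f (x + v) - f x = 'D_v f (x + t *: v).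
Proof.
move=> df; pose g (t : R) := f (x + t *: v).
have dg (t : R) : 0 <= t <= 1 -> differentiable g t /\ 'D_1 g t = 'D_v f (x + t *: v).
  move=> t01; have [dl dlE] := derive_line x v t.
  have [dgt ->] := @derive_comp R R R (fun s : R => x + s *: v) f t 1 dl (df t t01).
  by rewrite dlE.
have [||t tI] := @MVT_segment R g (fun t => 'D_v f (x + t *: v)) 0 1 ler01.
- move=> t; rewrite in_itv /= => /andP[t0 t1].
  have [dgt <-] := dg t (ltac:(by rewrite !ltW)).
  by apply: derivableP; exact/derivable1_diffP.
- apply: continuous_in_subspaceT => t; rewrite inE /= in_itv /= => t01.
  by apply: differentiable_continuous; have [] := dg t t01.
rewrite /g scale0r scale1r addr0 subr0 mulr1 => ->.
by exists t => //; move: tI; rewrite in_itv.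
Qed.

Lemma norm_segment_lt p x y (t r : R) : `|x - p| < r -> `|y - p| < r ->
  0 <= t <= 1 -> `|x + t *: (y - x) - p| < r.
Proof.
move=> xr yr /andP[t0 t1].
have -> : x + t *: (y - x) - p = (1 - t) *: (x - p) + t *: (y - p).
  by apply/rowP => m; rewrite !mxE; ring.
apply: le_lt_trans (ler_normD _ _) _; rewrite !normrZ (ger0_norm t0).
rewrite (ger0_norm (_ : 0 <= 1 - t)) ?subr_ge0 //.
have [->|t_neq0] := eqVneq t 0; first by rewrite mul0r addr0 subr0 mul1r.
have t_gt0 : 0 < t by rewrite lt0r t_neq0.
have h1 : (1 - t) * `|x - p| <= (1 - t) * r by rewrite ler_wpM2l ?subr_ge0 // ltW.
have h2 : t * `|y - p| < t * r by rewrite ltr_pM2l.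
by apply: lt_le_trans (ler_ltD h1 h2) _; rewrite -mulrDl subrK mul1r.
Qed.

Lemma open_ballP W p : open W -> W p ->
  exists2 d, 0 < d & forall x, `|x - p| < d -> W x.
Proof.
move=> oW Wp; have /nbhs_ballP[d d0 dW] : nbhs p W by exact: open_nbhs_nbhs.
by exists d => // x xd; apply: dW; rewrite -ball_normE /= distrC.
Qed.

Lemma open_norm_ball p (d : R) : open [set x | `|x - p| < d].
Proof.
have -> : [set x | `|x - p| < d] = ball p d.
  by apply/seteqP; split=> x /=; rewrite -ball_normE /= distrC.
exact: ball_open.
Qed.

Lemma continuous_ball (f : quat R -> R) p e : {for p, continuous f} -> 0 < e ->
  exists2 d, 0 < d & forall x, `|x - p| < d -> `|f x - f p| < e.
Proof.
move=> cf e0; have /cvgrPdist_lt /(_ e e0) /nbhs_ballP[d d0 h] := cf.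
by exists d => // x xd; rewrite distrC; apply: h; rewrite -ball_normE /= distrC.
Qed.

Lemma close_to_equal (a b a' b' e : R) : a' = b' ->
  `|b' - a| < e / 2 -> `|a' - b| < e / 2 -> `|a - b| <= e.
Proof. by move=> ->; rewrite !ltr_norml ler_norml; lra. Qed.

(** Symmetry of second derivatives: both orders of differentiation are limits
    of the same second difference quotient. *)
Lemma derive_sym W (f : quat R -> R) x u v : open W -> W x -> Ck 2 W f ->
  'D_u (fun y => 'D_v f y) x = 'D_v (fun y => 'D_u f y) x.
Proof.
move=> oW Wx cf; have [d0 d0_gt0 d0W] := open_ballP oW Wx.
have [df ddf] := cf.
pose l := `|u| + `|v| + 1.
have l_gt0 : 0 < l by rewrite ltr_wpDl // addr_ge0.
have near_x (h s t : R) : 0 <= h -> 0 <= s <= 1 -> 0 <= t <= 1 ->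
    `|x + s *: (h *: u) + t *: (h *: v) - x| <= h * l.
  move=> h0 /andP[s0 s1] /andP[t0 t1]; rewrite -(addrA x) addrAC subrr add0r.
  apply: le_trans (ler_normD _ _) _; rewrite !normrZ (ger0_norm s0) (ger0_norm t0) (ger0_norm h0).
  have h1 : s * (h * `|u|) <= h * `|u| by rewrite ler_piMl // mulr_ge0.
  have h2 : t * (h * `|v|) <= h * `|v| by rewrite ler_piMl // mulr_ge0.
  by rewrite /l !mulrDr mulr1; lra.
(* The mean value theorem, first in the direction u' and then in the
   direction v'. *)
have second (u' v' : quat R) (h : R) : 0 < h ->
    (forall s t : R, 0 <= s <= 1 -> 0 <= t <= 1 -> W (x + s *: (h *: u') + t *: (h *: v'))) ->
    exists s t : R, [/\ 0 <= s <= 1, 0 <= t <= 1 &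
      f (x + h *: u' + h *: v') - f (x + h *: u') - (f (x + h *: v') - f x) =
      h ^+ 2 * 'D_v' (fun y => 'D_u' f y) (x + s *: (h *: u') + t *: (h *: v'))].
  move=> h0 hW; pose F y := f (y + h *: v') - f y.
  have dF y : W y -> W (y + h *: v') -> differentiable F y /\
      'D_(h *: u') F y = h * ('D_u' f (y + h *: v') - 'D_u' f y).
    move=> Wy Wyv.
    have [dl dlE] : differentiable (fun y => y + h *: v') y /\
        'D_(h *: u') (fun y => y + h *: v') y = h *: u'.
      split; first by apply: differentiableD.
      by rewrite deriveD ?derive_id ?derive_cst ?addr0.
    have [dc dcE] := derive_comp (h *: u') dl (df _ Wyv).
    have dfy := df _ Wy.
    split; first exact: (differentiableB dc dfy).
    have -> : F = (f \o (fun y => y + h *: v')) - f by [].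
    rewrite (deriveB (diff_derivable dc) (diff_derivable dfy)) dcE dlE.
    by rewrite !deriveZv // -?scalerBr //; exact: df.
  have W0 (s : R) : 0 <= s <= 1 -> W (x + s *: (h *: u')).
    by move=> hs; have := hW s 0 hs; rewrite scale0r addr0; apply; rewrite lexx ler01.
  have W1 (s : R) : 0 <= s <= 1 -> W (x + s *: (h *: u') + h *: v').
    by move=> hs; have := hW s 1 hs; rewrite scale1r; apply; rewrite lexx ler01.
  have [s s01] := @mean_value F x (h *: u') (fun s hs => (dF _ (W0 s hs) (W1 s hs)).1).
  rewrite (dF _ (W0 s s01) (W1 s s01)).2.
  have [t t01 ->] := @mean_value (fun y => 'D_u' f y) (x + s *: (h *: u')) (h *: v')
    (fun t ht => (ddf u').1 _ (hW s t s01 ht)).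
  move=> E; exists s, t; split; [exact: s01|exact: t01|].
  apply: etrans E _; rewrite expr2 -mulrA; congr (_ * _).
  by rewrite deriveZv //; exact: (ddf u').1 _ (hW s t s01 t01).
apply/eqP; rewrite -subr_eq0 -normr_le0; apply/ler_addgt0Pl => e e0; rewrite addr0.
have e2 : 0 < e / 2 by rewrite divr_gt0.
have [d1 d1_gt0 d1P] := continuous_ball ((ddf v).2 u x Wx) e2.
have [d2 d2_gt0 d2P] := continuous_ball ((ddf u).2 v x Wx) e2.
pose d := Num.min d0 (Num.min d1 d2).
have d_gt0 : 0 < d by rewrite !lt_min d0_gt0 d1_gt0.
pose h := d / (2 * l).
have h_gt0 : 0 < h by rewrite divr_gt0 // mulr_gt0.
have hl : h * l < d.
  have -> : h * l = d / 2 by rewrite /h; field; rewrite lt0r_neq0.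
  by rewrite ltr_pdivrMr // mulr_natr mulr2n ltrDl.
have close (s t : R) : 0 <= s <= 1 -> 0 <= t <= 1 -> `|x + s *: (h *: u) + t *: (h *: v) - x| < d.
  by move=> hs ht; apply: le_lt_trans hl; exact: near_x (ltW _) _ _.
have close' (s t : R) : 0 <= s <= 1 -> 0 <= t <= 1 -> `|x + s *: (h *: v) + t *: (h *: u) - x| < d.
  by move=> hs ht; rewrite (addrAC x (s *: (h *: v))); exact: close.
have dd0 : d <= d0 by rewrite ge_min lexx.
have dd1 : d <= d1 by rewrite !ge_min lexx orbT.
have dd2 : d <= d2 by rewrite !ge_min lexx !orbT.
have Wclose s t hs ht := d0W _ (lt_le_trans (close s t hs ht) dd0).
have Wclose' s t hs ht := d0W _ (lt_le_trans (close' s t hs ht) dd0).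
have [s [t [hs ht E1]]] := second u v h h_gt0 Wclose.
have [s' [t' [hs' ht' E2]]] := second v u h h_gt0 Wclose'.
have E : 'D_v (fun y => 'D_u f y) (x + s *: (h *: u) + t *: (h *: v)) =
         'D_u (fun y => 'D_v f y) (x + s' *: (h *: v) + t' *: (h *: u)).
  have h2 : h ^+ 2 != 0 by rewrite expf_neq0 // lt0r_neq0.
  have E12 : f (x + h *: u + h *: v) - f (x + h *: u) - (f (x + h *: v) - f x) =
             f (x + h *: v + h *: u) - f (x + h *: v) - (f (x + h *: u) - f x).
    by rewrite (addrAC x (h *: u)); ring.
  exact: mulfI h2 _ _ (etrans (esym E1) (etrans E12 E2)).
exact: close_to_equal E (d1P _ (lt_le_trans (close' s' t' hs' ht') dd1))
  (d2P _ (lt_le_trans (close s t hs ht) dd2)).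
Qed.

End MeanValue.

(** * Local solutions of the equation dr = r Om *)

Section LocalFlatSections.
Variable R : realType.
Implicit Types (W : set (quat R)) (x y z u v p : quat R).

Lemma finite_radius_bound k (P : 'I_k -> R -> R -> Prop) :
  (forall i d d' M M', d' <= d -> M <= M' -> P i d M -> P i d' M') ->
  (forall i, exists d M, [/\ 0 < d, 0 <= M & P i d M]) ->
  exists d M, [/\ 0 < d, 0 <= M & forall i, P i d M].
Proof.
elim: k P => [|k ih] P mono hP; first by exists 1, 0; split=> // -[].
have [d1 [M1 [d1_gt0 M1_ge0 P1]]] := hP ord0.
have [||d2 [M2 [d2_gt0 M2_ge0 P2]]] := ih (fun i => P (lift ord0 i)).
- by move=> i; exact: mono.
- by move=> i; exact: hP.
exists (Num.min d1 d2), (Num.max M1 M2).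
split; [by rewrite lt_min d1_gt0|by rewrite le_max M1_ge0|].
move=> i; have [j ->|->] := unliftP ord0 i.
  by apply: mono (P2 j); rewrite ?ge_min ?le_max lexx orbT.
by apply: mono P1; rewrite ?ge_min ?le_max lexx.
Qed.

Lemma enorm_delta (m : 'I_4) : enorm (delta_mx 0 m : quat R) = 1.
Proof.
apply/S3P; rewrite edotE !mxE /=.
by have [->|->|->|->] := ord4P m; rewrite /= !(mulr0, mulr1, addr0, add0r).
Qed.

Lemma enorm_sum_coord_le (F : 'I_4 -> quat R) (c : 'I_4 -> R) v :
  (forall m, enorm (F m) <= c m) ->
  enorm (\sum_m v 0 m *: F m) <= (\sum_m c m) * enorm v.
Proof.
move=> Fc; apply: le_trans (enorm_sum_le _) _; rewrite mulr_suml.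
apply: ler_sum => m _; rewrite enormZ mulrC ler_pM ?enorm_ge0 //.
exact: coord_le_enorm.
Qed.

Lemma enorm_le_sum_coord v : enorm v <= \sum_m `|v 0 m|.
Proof.
rewrite {1}(quat_sum_delta v); apply: le_trans (enorm_sum_le _) _.
by apply: ler_sum => m _; rewrite enormZ enorm_delta mulr1.
Qed.

Lemma C1_lipschitz W (f : quat R -> R) p : open W -> W p -> Ck 1 W f ->
  exists d M, [/\ 0 < d, 0 <= M &
    forall x y, `|x - p| < d -> `|y - p| < d -> `|f y - f x| <= M * enorm (y - x)].
Proof.
move=> oW Wp [df ddf]; have [d0 d0_gt0 d0W] := open_ballP oW Wp.
have [||d [M [d_gt0 M0 dM]]] := @finite_radius_bound 4 (fun m d M =>
    forall y, `|y - p| < d -> `|'D_(delta_mx 0 m) f y| <= M).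
- move=> m d d' M M' dd MM h y yd.
  exact: le_trans (h y (lt_le_trans yd dd)) MM.
- move=> m; have [d d_gt0 dP] := continuous_ball (ddf (delta_mx 0 m) p Wp) ltr01.
  exists d, (`|'D_(delta_mx 0 m) f p| + 1); split=> //.
  move=> y yd; rewrite -[X in `|X|](subrK ('D_(delta_mx 0 m) f p)).
  apply: le_trans (ler_normD _ _) _; rewrite addrC lerD2l ltW //.
  exact: dP.
exists (Num.min d0 d), (4 * M); split=> [||x y].
- by rewrite lt_min d0_gt0.
- by rewrite mulr_ge0.
rewrite !lt_min => /andP[xd0 xd] /andP[yd0 yd].
have [t t01] := @mean_value _ f x (y - x) (fun t ht => df _ (d0W _ (norm_segment_lt xd0 yd0 ht))).
rewrite subrKC => ->; set z := x + _.
have zd0 : W z := d0W _ (norm_segment_lt xd0 yd0 t01).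
have zd : `|z - p| < d := norm_segment_lt xd yd t01.
rewrite (derive_sum_delta _ (df z zd0)).
apply: le_trans (ler_norm_sum _ _ _) _.
apply: le_trans (_ : \sum_(m < 4) enorm (y - x) * M <= _); last first.
  by rewrite sumr_const card_ord -mulr_natr le_eqVlt; apply/orP; left; apply/eqP; ring.
apply: ler_sum => m _; rewrite normrM ler_pM //; first exact: coord_le_enorm.
exact: dM.
Qed.

Lemma C1_lipschitz_quat W (F : quat R -> quat R) p : open W -> W p -> Ck 1 W F ->
  exists d M, [/\ 0 < d, 0 <= M & forall x y, `|x - p| < d -> `|y - p| < d ->
    enorm (F y - F x) <= M * enorm (y - x)].
Proof.
move=> oW Wp cF.
have [||d [M [d_gt0 M0 dM]]] := @finite_radius_bound 4 (fun m d M => forall x y,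
    `|x - p| < d -> `|y - p| < d -> `|F y 0 m - F x 0 m| <= M * enorm (y - x)).
- move=> m d d' M M' dd MM h x y xd yd.
  apply: le_trans (h x y (lt_le_trans xd dd) (lt_le_trans yd dd)) _.
  by rewrite ler_wpM2r ?enorm_ge0.
- by move=> m; apply: (C1_lipschitz oW Wp _); exact: ((Ck_quatP _ _ oW).1 cF).
exists d, (4 * M); split=> [//||x y xd yd]; first by rewrite mulr_ge0.
apply: le_trans (enorm_le_sum_coord _) _.
apply: le_trans (_ : \sum_(m < 4) M * enorm (y - x) <= _); last first.
  by rewrite sumr_const card_ord -mulr_natr le_eqVlt; apply/orP; left; apply/eqP; ring.
by apply: ler_sum => m _; rewrite !quatE; exact: dM.
Qed.

(** The curvature dOm + Om /\ Om vanishes at z. *)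
Definition flat_at (Om : quat R -> quat R -> quat R) z := forall u v,
  'D_u (fun x => Om x v) z - 'D_v (fun x => Om x u) z +
  (Om z u *q Om z v - Om z v *q Om z u) = 0.

Definition parallel (Om : quat R -> quat R -> quat R) (r : quat R -> quat R) W :=
  forall y, W y -> [/\ S3 (r y), differentiable r y &
                       forall v, 'D_v r y = r y *q Om y v].

(** The solution is the transport from p.  By path independence its increment
    from y to y + h is the transport along a segment of length |h|, which is
    1 + Om y h up to a term of second order. *)
Lemma local_parallel W (Om : quat R -> quat R -> quat R) p : open W -> W p ->
  (forall x u v, Om x (u + v) = Om x u + Om x v) ->
  (forall x (a : R) u, Om x (a *: u) = a *: Om x u) ->
  (forall x v, W x -> Om x v 0 0 = 0) ->
  (forall v, Ck 1 W (fun x => Om x v)) ->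
  (forall z, W z -> flat_at Om z) ->
  exists d r, [/\ 0 < d, (forall y, `|y - p| < d -> W y),
    parallel Om r [set y | `|y - p| < d] & r p = qone R].
Proof.
move=> oW Wp OmD OmZ Om_im Om_C1 Om_flat.
have OmE x v : Om x v = \sum_m v 0 m *: Om x (delta_mx 0 m).
  have Om_sum (F : 'I_4 -> quat R) : Om x (\sum_m F m) = \sum_m Om x (F m).
    by rewrite !big_ord_recl !big_ord0 !addr0 !OmD.
  by rewrite {1}(quat_sum_delta v) Om_sum; apply: eq_bigr => m _; rewrite OmZ.
have OmB x u v : Om x (u - v) = Om x u - Om x v by rewrite -scaleN1r OmD OmZ scaleN1r.
have [||d1 [L [d1_gt0 L0 d1L]]] := @finite_radius_bound 4 (fun m d M => forall x y,
    `|x - p| < d -> `|y - p| < d ->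
    enorm (Om y (delta_mx 0 m) - Om x (delta_mx 0 m)) <= M * enorm (y - x)).
- move=> m d d' M M' dd MM h x y xd yd.
  apply: le_trans (h x y (lt_le_trans xd dd) (lt_le_trans yd dd)) _.
  by rewrite ler_wpM2r ?enorm_ge0.
- by move=> m; apply: (C1_lipschitz_quat oW Wp _); exact: Om_C1.
(* One constant that bounds Om on the ball of radius d1 and serves as Lipschitz
   constant; sup-norm balls of radius d1 have Euclidean radius at most 2 d1. *)
pose M := \sum_m (enorm (Om p (delta_mx 0 m)) + L * (2 * d1) + L).
have M0 : 0 <= M.
  apply: sumr_ge0 => m _; do 2![apply: addr_ge0 => //]; first exact: enorm_ge0.
  by rewrite !mulr_ge0 // ltW.
have [d0 d0_gt0 d0W] := open_ballP oW Wp.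
have [d2 d2_gt0 d2P] := small_factor (mulr_ge0 (ler0n R 4) M0) (@ltr01 R).
pose d := Num.min d0 (Num.min d1 d2).
have d_gt0 : 0 < d by rewrite !lt_min d0_gt0 d1_gt0.
have dd0 : d <= d0 by rewrite ge_min lexx.
have dd1 : d <= d1 by rewrite !ge_min lexx orbT.
have dd2 : d <= d2 by rewrite !ge_min lexx !orbT.
pose B := [set y | `|y - p| < d].
have BW x : B x -> W x by move=> xd; apply: d0W; exact: lt_le_trans xd dd0.
have B_convex x y (t : R) : B x -> B y -> 0 <= t <= 1 -> B (x + t *: (y - x)).
  exact: norm_segment_lt.
have enorm_lt x r : `|x - p| < r -> enorm (x - p) <= 2 * r.
  by move=> xr; apply: le_trans (enorm_le_mx_norm _) _; rewrite ler_pM2l // ltW.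
have B_small x y : B x -> B y -> M * enorm (x - y) <= 1.
  move=> xd yd; apply: le_trans _ d2P; rewrite (mulrC 4) -mulrA ler_wpM2l //.
  apply: le_trans (enormBD _ p _) _; rewrite (enormB p).
  apply: le_trans (lerD (enorm_lt _ _ xd) (enorm_lt _ _ yd)) _.
  by rewrite -mulrDr; move: dd2; lra.
have Om_bound x v : B x -> enorm (Om x v) <= M * enorm v.
  move=> xd; rewrite OmE; apply: enorm_sum_coord_le => m.
  have xd1 := lt_le_trans xd dd1; have pd1 : `|p - p| < d1 by rewrite subrr normr0.
  have := d1L m _ _ pd1 xd1 => h.
  have h' : L * enorm (x - p) <= L * (2 * d1) by rewrite ler_wpM2l // enorm_lt.
  rewrite -[X in enorm X](subrK (Om p (delta_mx 0 m))) addrC.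
  apply: le_trans (enormD _ _) _; rewrite -!addrA lerD2l.
  by apply: le_trans h _; apply: le_trans h' _; rewrite lerDl.
have Om_lip x y v : B x -> B y -> enorm (Om x v - Om y v) <= M * enorm (x - y) * enorm v.
  move=> xd yd; have -> : Om x v - Om y v =
      \sum_m v 0 m *: (Om x (delta_mx 0 m) - Om y (delta_mx 0 m)).
    rewrite (OmE x) (OmE y) -sumrB; apply: eq_bigr => m _.
    by rewrite scalerBr.
  rewrite /M mulr_suml; apply: enorm_sum_coord_le => m.
  apply: le_trans (d1L m _ _ (lt_le_trans yd dd1) (lt_le_trans xd dd1)) _.
  rewrite ler_wpM2r ?enorm_ge0 // lerDr addr_ge0 ?enorm_ge0 //.
  by rewrite !mulr_ge0 // ltW.
have dOm v z : W z -> differentiable (fun x => Om x v) z by have [h _] := Om_C1 v; exact: h.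
have flat z : B z -> exists (K : quat R -> quat R -> quat R) (N : R),
  [/\ 0 <= N,
      forall u v w, K (u + v) w = K u w + K v w /\
                    K w (u + v) = K w u + K w v,
      forall u v, enorm (K u v) <= N * enorm u * enorm v,
      forall u v, K u v - K v u + (Om z u *q Om z v - Om z v *q Om z u) = 0 &
      forall e, 0 < e -> exists2 d, 0 < d & forall x v, B x -> enorm (x - z) <= d ->
        enorm (Om x v - Om z v - K (x - z) v) <= e * enorm (x - z) * enorm v].
  move=> /BW Wz; pose K u v := 'D_u (fun x => Om x v) z.
  have KE u v : K u v = \sum_m v 0 m *: K u (delta_mx 0 m).
    have dZ m : differentiable (fun x => v 0 m *: Om x (delta_mx 0 m)) z.
      by apply: differentiableZ; exact: dOm.
    have dZ' m := @diff_derivable _ _ _ _ _ u (dZ m).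
    rewrite /K [fun x => Om x v](_ : _ = \sum_m (fun x => v 0 m *: Om x (delta_mx 0 m))).
      rewrite derive_sum //; apply: eq_bigr => m _.
      by rewrite deriveZ //; apply: diff_derivable; exact: dOm.
    by apply/funext => x; rewrite fct_sumE OmE.
  have KE' u m : K u (delta_mx 0 m) = \sum_l u 0 l *: K (delta_mx 0 l) (delta_mx 0 m).
    by apply: derive_sum_delta; exact: dOm.
  pose N := \sum_m \sum_l enorm (K (delta_mx 0 l) (delta_mx 0 m)).
  exists K, N; split.
  - by apply: sumr_ge0 => m _; apply: sumr_ge0 => l _; exact: enorm_ge0.
  - move=> u v w; split; first by apply: deriveDv; exact: dOm.
    rewrite /K [fun x => Om x (u + v)](_ : _ = (fun x => Om x u) + (fun x => Om x v)).
      by rewrite deriveD //; apply: diff_derivable; exact: dOm.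
    by apply/funext => x; exact: OmD.
  - move=> u v; rewrite KE /N mulr_suml; apply: enorm_sum_coord_le => m.
    by rewrite KE'; exact: enorm_sum_coord_le.
  - exact: Om_flat.
  - move=> e e0; have e4 : 0 < e / 8 by rewrite divr_gt0.
    have [||d' [M' [d'_gt0 _ d'P]]] := @finite_radius_bound 4 (fun m r _ => forall x,
      `|x - z| < r -> enorm (Om x (delta_mx 0 m) - Om z (delta_mx 0 m) -
         K (x - z) (delta_mx 0 m)) <= e / 4 * enorm (x - z)).
    + by move=> m r r' Ma Mb rr _ h x xr; apply: h; exact: lt_le_trans xr rr.
    + move=> m; have /eqaddoP /(_ _ e4) /nbhs_ballP[r r_gt0 rP] := diff_locally (dOm (delta_mx 0 m) z Wz).
      exists r, 0; split=> // x xr.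
      have := rP (x - z); rewrite -ball_normE /= sub0r normrN => /(_ xr).
      rewrite !fctE /= subrK opprD addrA -deriveE; last exact: dOm.
      move=> h; apply: le_trans (enorm_le_mx_norm _) _.
      have := mx_norm_le_enorm (x - z); move: h; rewrite /K.
      set X := `|_|; set Y := `|x - z|; move=> h1 h2.
      have : e / 8 * Y <= e / 8 * enorm (x - z) by rewrite ler_wpM2l // ltW.
      by move: h1; lra.
    exists (d' / 2); first by rewrite divr_gt0.
    move=> x v _ xz.
    have -> : Om x v - Om z v - K (x - z) v = \sum_m v 0 m *:
        (Om x (delta_mx 0 m) - Om z (delta_mx 0 m) - K (x - z) (delta_mx 0 m)).
      rewrite (OmE x) (OmE z) KE -!sumrB; apply: eq_bigr => m _.
      by rewrite !scalerBr.
    have -> : e * enorm (x - z) = \sum_(m < 4) e / 4 * enorm (x - z).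
      by rewrite sumr_const card_ord -mulr_natr; field.
    apply: enorm_sum_coord_le => m; apply: d'P.
    apply: le_lt_trans (mx_norm_le_enorm _) _; apply: le_lt_trans xz _.
    by rewrite ltr_pdivrMr // mulr_natr mulr2n ltrDl.
have Om_imB x v (Bx : B x) := Om_im x v (BW x Bx).
have Bp : B p by rewrite /B /= subrr normr0.
have trans := transport_trans M0 B_convex B_small Om_imB OmD OmZ Om_bound Om_lip flat.
have S3t := S3_transport M0 B_convex B_small Om_imB OmD Om_bound Om_lip.
have lin := transport_linear M0 B_convex B_small Om_imB OmD Om_bound Om_lip.
exists d, (transport Om p); split=> //; first last.
- exact: transportxx M0 B_convex B_small Om_imB OmD OmZ Om_bound Om_lip _ Bp.
- move=> y By; set r := transport Om p.
  pose D h := r y *q Om y h.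
  have D_lin : linear D.
    by move=> a u v; rewrite /D OmD OmZ qmulDr qmulZr.
  pose D_mixin := GRing.isLinear.Build _ _ _ _ _ D_lin.
  pose DL : {linear quat R -> quat R} := HB.pack D D_mixin.
  have D_le h : `|DL h| <= (M * 2) * `|h|.
    apply: le_trans (mx_norm_le_enorm _) _; rewrite /= /D enorm_S3l; last exact: S3t.
    apply: le_trans (Om_bound _ _ By) _.
    by rewrite -mulrA ler_wpM2l // enorm_le_mx_norm.
  set K := 4 * (2 * M ^+ 2 + M) + M ^+ 2 in lin.
  have K0 : 0 <= K.
    by rewrite addr_ge0 ?sqr_ge0 // mulr_ge0 // addr_ge0 // mulr_ge0 // sqr_ge0.
  have [e e0 |dr drE] := @differentiable_intro R _ _ r DL y (linear_le_continuous D_le).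
    have [d3 d3_gt0 d3P] := small_factor (mulr_ge0 (ler0n R 4) K0) e0.
    have s0 : 0 < d - `|y - p| by rewrite subr_gt0.
    apply/nbhs_ballP; exists (Num.min d3 (d - `|y - p|)).
      by rewrite /= lt_min d3_gt0.
    move=> h; rewrite -ball_normE /= sub0r normrN lt_min => /andP[h3 hd].
    have Byh : B (h + y).
      rewrite /B /= -addrA; apply: le_lt_trans (ler_normD _ _) _.
      by rewrite -ltrBrDr.
    have -> : r (h + y) - r y - D h = r y *q (transport Om y (h + y) - (qone R + Om y h)).
      by rewrite /r -(trans p y (h + y)) // qmulBr qmulDr qmul1 opprD addrA.
    apply: le_trans (mx_norm_le_enorm _) _; rewrite enorm_S3l; last exact: S3t.
    have := lin y (h + y) By Byh; rewrite addrK => /le_trans; apply.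
    have h2 : enorm h ^+ 2 <= 4 * `|h| ^+ 2.
      have -> : 4 * `|h| ^+ 2 = (2 * `|h|) ^+ 2 by ring.
      by rewrite ler_pXn2r ?nnegrE ?enorm_ge0 ?mulr_ge0 // enorm_le_mx_norm.
    apply: le_trans (ler_wpM2l K0 h2) _.
    have -> : K * (4 * `|h| ^+ 2) = 4 * K * `|h| * `|h| by ring.
    rewrite ler_wpM2r //; apply: le_trans _ d3P.
    by rewrite ler_wpM2l ?mulr_ge0 // ltW.
  split; [exact: S3t|exact: dr|move=> v].
  by rewrite deriveE // drE.
Qed.

End LocalFlatSections.

(** * Derivatives of quaternion products *)

Section QuaternionCalculus.
Variables (R : realType) (E : normedModType R).
Implicit Types (F G : E -> quat R) (x v : E).

Lemma derive_qmul F G x v : differentiable F x -> differentiable G x ->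
  differentiable (fun y => F y *q G y) x /\
  'D_v (fun y => F y *q G y) x = 'D_v F x *q G x + F x *q 'D_v G x.
Proof.
move=> dF dG.
pose e (m : 'I_4) : quat R := delta_mx 0 m.
pose k m l y : R := F y 0 m * G y 0 l.
have dk m l : is_diff x (k m l) ('d (k m l) x).
  apply: differentiableP; apply: differentiableM; exact: differentiable_coordinate.
have kD m l : 'D_v (k m l) x = F x 0 m * 'D_v G x 0 l + G x 0 l * 'D_v F x 0 m.
  have := @deriveM _ _ (fun y => F y 0 m) (fun y => G y 0 l) x v
    (diff_derivable (differentiable_coordinate m dF))
    (diff_derivable (differentiable_coordinate l dG)).
  by rewrite !derive_coordinate.
have dkc m l c : differentiable (fun y => k m l y *: (c : quat R)) x /\
    'D_v (fun y => k m l y *: (c : quat R)) x = 'D_v (k m l) x *: c.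
  have d : differentiable (k m l) x by exact: ex_diff.
  split; first exact: differentiableZl.
  by rewrite deriveE ?diffZl ?deriveE //; exact: differentiableZl.
have qsum (n : nat) (H : 'I_n -> quat R) z : (\sum_i H i) *q z = \sum_i (H i *q z).
  elim: n H => [|n ih] H; first by rewrite !big_ord0 q0mul.
  by rewrite !big_ord_recl qmulDl ih.
have sumq (n : nat) (H : 'I_n -> quat R) z : z *q (\sum_i H i) = \sum_i (z *q H i).
  elim: n H => [|n ih] H; first by rewrite !big_ord0 qmul0.
  by rewrite !big_ord_recl qmulDr ih.
have expand y z : y *q z = \sum_m \sum_l (y 0 m * z 0 l) *: (e m *q e l).
  rewrite {1}(quat_sum_delta y) qsum; apply: eq_bigr => m _.
  rewrite {1}(quat_sum_delta z) sumq; apply: eq_bigr => l _.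
  by rewrite qmulZl qmulZr scalerA.
have -> : (fun y => F y *q G y) =
    \sum_m \sum_l (fun y => k m l y *: (e m *q e l)).
  apply/funext => y; rewrite expand fct_sumE; apply: eq_bigr => m _.
  by rewrite fct_sumE.
have dS m : differentiable (\sum_l (fun y => k m l y *: (e m *q e l))) x.
  by apply: differentiable_sum => l; have [] := dkc m l (e m *q e l).
split; first exact: differentiable_sum.
rewrite derive_sum; last by move=> m; exact: diff_derivable.
rewrite 2!expand -big_split; apply: eq_bigr => m _ /=.
rewrite derive_sum; last first.
  by move=> l; apply: diff_derivable; have [] := dkc m l (e m *q e l).
rewrite -big_split; apply: eq_bigr => l _ /=.
have [_ ->] := dkc m l (e m *q e l).
by rewrite kD -scalerDl addrC [in LHS](mulrC (G x 0 l)).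
Qed.

Lemma derive_qconj F x v : differentiable F x ->
  differentiable (fun y => qconj (F y)) x /\
  'D_v (fun y => qconj (F y)) x = qconj ('D_v F x).
Proof.
move=> dF.
have d : differentiable (fun y => qconj (F y)) x.
  apply: differentiable_quatP => m; rewrite /qconj.
  have dm l := differentiable_coordinate l dF.
  by have [->|->|->|->] := ord4P m; under eq_fun do rewrite quatE; rewrite -?[fun y => - _]/(- _);
    do ?apply: differentiableN; exact: dm.
split=> //; apply/rowP => m; rewrite -derive_coordinate // /qconj.
have dm l := diff_derivable (v := v) (differentiable_coordinate l dF).
by have [->|->|->|->] := ord4P m; rewrite quatE -derive_coordinate //;
   under eq_fun do rewrite quatE; rewrite ?deriveN //; exact: dm.
Qed.

Lemma Ck_qmul n (W : set E) F G : open W -> Ck n W F -> Ck n W G ->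
  Ck n W (fun y => F y *q G y).
Proof.
move=> oW /(Ck_quatP _ _ oW) cF /(Ck_quatP _ _ oW) cG.
apply/Ck_quatP => // m; rewrite /qmul.
by have [->|->|->|->] := ord4P m; under eq_fun do rewrite quatE;
  do ?[apply: CkB => //|apply: CkD => //]; exact: CkM.
Qed.

Lemma Ck_qconj n (W : set E) F : open W -> Ck n W F -> Ck n W (fun y => qconj (F y)).
Proof.
move=> oW /(Ck_quatP _ _ oW) cF; apply/Ck_quatP => // m; rewrite /qconj.
by have [->|->|->|->] := ord4P m; under eq_fun do rewrite quatE; do ?apply: CkN.
Qed.

End QuaternionCalculus.

Section ParallelUniqueness.
Variable R : realType.
Implicit Types (x y u v p : quat R) (f g r : quat R -> quat R).

Lemma constant_of_derive0 f p (d : R) :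
  (forall y, `|y - p| < d -> differentiable f y) ->
  (forall y v, `|y - p| < d -> 'D_v f y = 0) ->
  forall y, `|y - p| < d -> f y = f p.
Proof.
move=> df f0 y yd; apply/rowP => m; apply/eqP; rewrite -subr_eq0; apply/eqP.
have pd : `|p - p| < d by rewrite subrr normr0 (le_lt_trans _ yd).
have [t t01] := @mean_value _ (fun z => f z 0 m) p (y - p)
  (fun t ht => differentiable_coordinate m (df _ (norm_segment_lt pd yd ht))).
rewrite subrKC => ->.
have zd := norm_segment_lt pd yd t01.
by rewrite (derive_coordinate _ _ (df _ zd)) f0 ?mxE.
Qed.

Variable Om : quat R -> quat R -> quat R.
Hypothesis Om_im : forall x v, Om x v 0 0 = 0.

Lemma qconj_im x : x 0 0 = 0 -> qconj x = - x.
Proof. by move=> x0; apply: quatP; rewrite /qconj !quatE ?x0 ?oppr0. Qed.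

Lemma parallelM c r (W : set (quat R)) : S3 c -> parallel Om r W ->
  parallel Om (fun y => c *q r y) W.
Proof.
move=> Sc par y /par [Sr dr rE].
have dc : differentiable (fun=> c) y by exact: differentiable_cst.
split; first exact: S3M.
  by have [] := derive_qmul 0 dc dr.
move=> v; have [_ ->] := derive_qmul v dc dr.
by rewrite derive_cst q0mul add0r rE qmulA.
Qed.

(** The product of r with the conjugate of r' has derivative
    r (Om - Om) (conjugate of r') = 0, because Om is imaginary. *)
Lemma parallel_unique r r' p (d : R) :
  parallel Om r [set y | `|y - p| < d] -> parallel Om r' [set y | `|y - p| < d] ->
  r p = r' p -> forall y, `|y - p| < d -> r y = r' y.
Proof.
move=> par par' rp y yd; pose f z := r z *q qconj (r' z).
have fP z v : `|z - p| < d -> differentiable f z /\ 'D_v f z = 0.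
  move=> zd; have [Sr dr rE] := par z zd; have [Sr' dr' r'E] := par' z zd.
  have [dc dcE] := derive_qconj v dr'.
  have [df ->] := derive_qmul v dr dc; split=> //.
  rewrite dcE rE r'E qconjM (qconj_im (Om_im z v)) qmulNl qmulNr.
  by rewrite !qmulA subrr.
have fy : f y = f p.
  by apply: constant_of_derive0 yd => [z zd|z v zd]; [exact: (fP z 0 zd).1|exact: (fP z v zd).2].
have pd : `|p - p| < d by rewrite subrr normr0 (le_lt_trans _ yd).
have [Sy _ _] := par' y yd; have [Sp _ _] := par' p pd.
move: fy; rewrite /f rp S3_mulC // => fy.
by rewrite -[RHS]q1mul -fy -qmulA S3_Cmul // qmul1.
Qed.

Lemma parallel_sub r W W' : W' `<=` W -> parallel Om r W -> parallel Om r W'.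
Proof. by move=> sW par y /sW /par. Qed.

Lemma parallel_ball r p q (d d' : R) : d' <= d - `|q - p| ->
  parallel Om r [set y | `|y - p| < d] -> parallel Om r [set y | `|y - q| < d'].
Proof.
move=> dd; apply: parallel_sub => y /= yq.
rewrite -[y - p](subrKA q); apply: le_lt_trans (ler_normD _ _) _.
by rewrite -ltrBrDr; exact: lt_le_trans dd.
Qed.

(** * Parallel sections along continuous maps *)

Section Sections.
Variable T : topologicalType.
Implicit Types (D : set T) (F a b : T -> quat R).

(** Continuity of F within D, in a form that restricts to subsets and glues
    along closed sets without changing the type of the domain. *)
Definition contin D F := forall z, D z -> forall e, 0 < e ->
  \forall w \near z, D w -> `|F w - F z| < e.

(** A lift of F that locally is the composite of F with a solution of
    dr = r Om, that is, a continuation of local solutions along F. *)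
Definition section D F a := forall z, D z -> exists d r,
  [/\ 0 < d, parallel Om r [set y | `|y - F z| < d] &
      \forall w \near z, D w -> a w = r (F w)].

Lemma continP D F : {within D, continuous F} <-> contin D F.
Proof.
split=> [/subspace_continuousP cF z Dz e e0|cF].
  have := cF z Dz; move=> /cvgrPdist_lt /(_ e e0); rewrite near_withinE.
  by apply: filterS => w h Dw; rewrite distrC; exact: h.
apply/subspace_continuousP => z Dz; apply/cvgrPdist_lt => e e0.
rewrite near_withinE; apply: filterS (cF z Dz e e0) => w h Dw.
by rewrite distrC; exact: h.
Qed.

Lemma section_at D F a z : D z -> section D F a -> S3 (a z).
Proof.
move=> Dz /(_ z Dz) [d [r [d0 par near_r]]].
rewrite (nbhs_singleton near_r Dz).
by have [] := par (F z); rewrite /= ?subrr ?normr0.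
Qed.

Lemma section_sub D D' F a : D' `<=` D -> section D F a -> section D' F a.
Proof.
move=> sD sa z /[dup] D'z /sD Dz; have [d [r [d0 par near_r]]] := sa z Dz.
by exists d, r; split=> //; apply: filterS near_r => w h /sD.
Qed.

Lemma contin_sub D D' F : D' `<=` D -> contin D F -> contin D' F.
Proof.
move=> sD cF z /sD Dz e e0; apply: filterS (cF z Dz e e0) => w h /sD; exact: h.
Qed.

Lemma section_ext D F F' a a' : (forall z, D z -> F z = F' z) ->
  (forall z, D z -> a z = a' z) -> section D F a -> section D F' a'.
Proof.
move=> FF aa sa z Dz; have [d [r [d0 par near_r]]] := sa z Dz.
exists d, r; split=> //; first by rewrite -FF.
by apply: filterS near_r => w h Dw; rewrite -aa // -FF // h.
Qed.

Lemma sectionM D F a c : S3 c -> section D F a -> section D F (fun z => c *q a z).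
Proof.
move=> Sc sa z Dz; have [d [r [d0 par near_r]]] := sa z Dz.
exists d, (fun y => c *q r y); split=> //; first exact: parallelM.
by apply: filterS near_r => w h Dw; rewrite h.
Qed.

Lemma parallel_section D F r p (d : R) : contin D F -> parallel Om r [set y | `|y - p| < d] ->
  (forall z, D z -> `|F z - p| < d) -> section D F (r \o F).
Proof.
move=> cF par FD z Dz; exists (d - `|F z - p|), r; split.
- by rewrite subr_gt0 FD.
- exact: parallel_ball par.
- exact: nearW.
Qed.

Lemma connected_locally_constant D (P : T -> Prop) z0 : connected D ->
  (forall z, D z -> \forall w \near z, D w -> (P w <-> P z)) ->
  D z0 -> P z0 -> forall z, D z -> P z.
Proof.
move=> cD locP Dz0 Pz0.
pose C := (fun z => D z -> P z)°%classic; pose C' := (~` ((fun z => D z -> ~ P z)°))%classic.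
have DP : [set z | D z /\ P z] = D.
  apply: cD; first by exists z0.
    exists C; first exact: open_interior.
    apply/seteqP; split=> z /= [Dz h]; split=> //.
      by apply: filterS (locP z Dz) => w h' Dw; apply/(h' Dw).
    by have := nbhs_singleton h; exact.
  exists C'; first by apply: open_closedC; exact: open_interior.
  apply/seteqP; split=> z /= [Dz h]; split=> //.
    by move=> /nbhs_singleton /(_ Dz); exact.
  apply: contrapT => nP; apply: h.
  by apply: filterS (locP z Dz) => w h' Dw /(h' Dw).
by move=> z; rewrite -DP => -[].
Qed.

Lemma section_const D F a z0 : connected D -> (forall z w, D z -> D w -> F z = F w) ->
  section D F a -> D z0 -> forall z, D z -> a z = a z0.
Proof.
move=> cD Fc sa Dz0; apply: (connected_locally_constant cD _ Dz0) => // z Dz.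
have [d [r [d0 par near_r]]] := sa z Dz.
have az := nbhs_singleton near_r Dz.
by apply: filterS near_r => w h Dw; rewrite h // az (Fc _ _ Dw Dz).
Qed.

Lemma section_local_unique D F a b z : contin D F -> section D F a -> section D F b ->
  D z -> exists2 c, S3 c & (\forall w \near z, D w -> b w = c *q a w).
Proof.
move=> cF sa sb Dz; have [d [r [d0 par near_r]]] := sa z Dz.
have [d' [r' [d'0 par' near_r']]] := sb z Dz.
pose d2 := Num.min d d'.
have d20 : 0 < d2 by rewrite lt_min d0.
have Fd : `|F z - F z| < d2 by rewrite subrr normr0.
have par2 : parallel Om r [set y | `|y - F z| < d2].
  by apply: parallel_ball par; rewrite subrr normr0 subr0 ge_min lexx.
have par2' : parallel Om r' [set y | `|y - F z| < d2].
  by apply: parallel_ball par'; rewrite subrr normr0 subr0 ge_min lexx orbT.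
have [Sr _ _] := par2 _ Fd; have [Sr' _ _] := par2' _ Fd.
exists (r' (F z) *q qconj (r (F z))); first by apply: S3M => //; exact: S3conj.
set c := _ *q _; have Sc : S3 c by apply: S3M => //; exact: S3conj.
have rr : c *q r (F z) = r' (F z) by rewrite /c -qmulA S3_Cmul // qmul1.
have eqr := parallel_unique (parallelM Sc par2) par2' rr.
apply: filterS3 near_r near_r' (cF z Dz d2 d20) => w h h' hw Dw.
by rewrite h // h' // -eqr //; exact: hw.
Qed.

Lemma section_unique D F a b z0 : connected D -> contin D F -> section D F a ->
  section D F b -> D z0 -> a z0 = b z0 -> forall z, D z -> a z = b z.
Proof.
move=> cD cF sa sb Dz0 ab; apply: (connected_locally_constant cD _ Dz0) => // z Dz.
have [c Sc near_c] := section_local_unique cF sa sb Dz.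
have bz := nbhs_singleton near_c Dz.
have cancel w : D w -> a w = c *q a w <-> c = qone R.
  move=> Dw; have Sa := section_at Dw sa.
  split=> [E|->]; last by rewrite q1mul.
  by rewrite -[c]qmul1 -(S3_mulC Sa) qmulA -E.
by apply: filterS near_c => w h Dw; rewrite h // bz !cancel.
Qed.

Lemma contin_union D1 D2 F : closed D1 -> closed D2 -> contin D1 F -> contin D2 F ->
  contin (D1 `|` D2) F.
Proof.
move=> cl1 cl2 c1 c2 z Dz e e0.
have aux D : closed D -> contin D F -> \forall w \near z, D w -> `|F w - F z| < e.
  move=> clD cD; have [/cD|nD] := pselect (D z); first exact.
  have : \forall w \near z, ~ D w by apply: open_nbhs_nbhs; split=> //; exact: closed_openC.
  by apply: filterS => w nDw Dw.
by apply: filterS2 (aux _ cl1 c1) (aux _ cl2 c2) => w h1 h2 [/h1|/h2].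
Qed.

(** Over a connected set two sections differ by a constant left factor; with
    that factor absorbed, they agree on the intersection. *)
Lemma section_glue D1 D2 F a1 a2 z0 : closed D1 -> closed D2 ->
  connected (D1 `&` D2) -> D1 z0 -> D2 z0 -> contin D1 F -> contin D2 F ->
  section D1 F a1 -> section D2 F a2 -> exists a, section (D1 `|` D2) F a.
Proof.
move=> cl1 cl2 cD D1z0 D2z0 cF1 cF2 s1 s2.
pose c := a1 z0 *q qconj (a2 z0).
have Sa2 : S3 (a2 z0) := section_at D2z0 s2.
have Sc : S3 c by apply: S3M; [exact: section_at s1|exact: S3conj].
pose b z := c *q a2 z; have sb : section D2 F b by exact: sectionM.
have a1b z : D1 z -> D2 z -> a1 z = b z.
  move=> D1z D2z; apply: (@section_unique _ F a1 b z0 cD) => //.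
  - by apply: contin_sub cF1 => w [].
  - by apply: section_sub s1 => w [].
  - by apply: section_sub sb => w [].
  - by rewrite /b /c -qmulA S3_Cmul // qmul1.
pose a z := if `[< D1 z >] then a1 z else b z.
have aD1 z : D1 z -> a z = a1 z by move=> D1z; rewrite /a; case: asboolP.
have aD2 z : D2 z -> a z = b z.
  by move=> D2z; rewrite /a; case: asboolP => // D1z; exact: a1b.
exists a => z Dz.
have avoid D : closed D -> ~ D z -> \forall w \near z, ~ D w.
  by move=> clD nD; apply: open_nbhs_nbhs; split=> //; exact: closed_openC.
have [D1z|nD1] := pselect (D1 z); have [D2z|nD2] := pselect (D2 z).
- have [d [r [d0 par near_r]]] := s1 z D1z.
  have [d' [r' [d'0 par' near_r']]] := sb z D2z.
  pose d2 := Num.min d d'.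
  have d20 : 0 < d2 by rewrite lt_min d0.
  have par2 : parallel Om r [set y | `|y - F z| < d2].
    by apply: parallel_ball par; rewrite subrr normr0 subr0 ge_min lexx.
  have par2' : parallel Om r' [set y | `|y - F z| < d2].
    by apply: parallel_ball par'; rewrite subrr normr0 subr0 ge_min lexx orbT.
  have rr : r (F z) = r' (F z).
    by rewrite -(nbhs_singleton near_r D1z) -(nbhs_singleton near_r' D2z) a1b.
  have eqr := parallel_unique par2 par2' rr.
  exists d2, r; split=> //.
  apply: filterS3 near_r near_r' (cF2 z D2z d2 d20) => w h h' hw.
  by case=> Dw; [rewrite aD1 // h|rewrite aD2 // h' // eqr //; exact: hw].
- have [d [r [d0 par near_r]]] := s1 z D1z; exists d, r; split=> //.
  apply: filterS2 near_r (avoid _ cl2 nD2) => w h nD2w.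
  by case=> // Dw; rewrite aD1 // h.
- have [d [r [d0 par near_r]]] := sb z D2z; exists d, r; split=> //.
  apply: filterS2 near_r (avoid _ cl1 nD1) => w h nD1w.
  by case=> // Dw; rewrite aD2 // h.
- by case: Dz.
Qed.

End Sections.

Lemma section_pullback (T1 T2 : topologicalType) (phi : T1 -> T2) D1 D2 F a :
  continuous phi -> (forall z, D1 z -> D2 (phi z)) -> section D2 F a ->
  section D1 (F \o phi) (a \o phi).
Proof.
move=> cphi hD sa z D1z; have [d [r [d0 par near_r]]] := sa _ (hD z D1z).
exists d, r; split=> //.
have := cphi z _ near_r; rewrite nbhs_simpl /=.
by apply: filterS => w h /hD; exact: h.
Qed.

Lemma contin_pullback (T1 T2 : topologicalType) (phi : T1 -> T2) D1 D2 F :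
  continuous phi -> (forall z, D1 z -> D2 (phi z)) -> contin D2 F ->
  contin D1 (F \o phi).
Proof.
move=> cphi hD cF z D1z e e0.
have := cphi z _ (cF _ (hD z D1z) e e0); rewrite nbhs_simpl /=.
by apply: filterS => w h /hD; exact: h.
Qed.

End ParallelUniqueness.

(** * Triviality of the monodromy *)

Section Monodromy.
Variable R : realType.
Implicit Types (t : R).

Definition rect (a a' b b' : R) : set (R * R) :=
  [set z | a <= z.1 <= a' /\ b <= z.2 <= b'].

Definition I01 : set R := [set t | 0 <= t <= 1].

Lemma I01E : [set` `[(0 : R), 1]] = I01.
Proof. by apply/seteqP; split=> t /=; rewrite in_itv. Qed.

Lemma itvE (a b : R) : [set t | a <= t <= b] = [set` `[a, b]].
Proof. by apply/seteqP; split=> t /=; rewrite in_itv. Qed.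

Lemma closed_itv (a b : R) : closed [set t | a <= t <= b].
Proof. by rewrite itvE; exact: itv_closed. Qed.

Lemma connected_itv (a b : R) : connected [set t | a <= t <= b].
Proof. by rewrite itvE; exact: segment_connected. Qed.

Lemma closed_rect (a a' b b' : R) : closed (rect a a' b b').
Proof.
have -> : rect a a' b b' = fst @^-1` [set t | a <= t <= a'] `&` snd @^-1` [set t | b <= t <= b'].
  by [].
apply: closedI; apply: preimage_closed; try exact: closed_itv.
  by move=> z _; exact: cvg_fst.
by move=> z _; exact: cvg_snd.
Qed.

Lemma cont_affine (k l : R) : continuous (fun t : R => k * t + l).
Proof.
move=> t; apply: cvgD; last exact: cvg_cst.
by apply: cvgM; [exact: cvg_cst|exact: cvg_id].
Qed.

Lemma cont_pair0 (m k l : R) : continuous (fun t : R => (m, k * t + l)).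
Proof.
move=> t; exact: (@cvg_pair _ _ _ _ _ _ _ _ _ (fun=> m) (fun t => k * t + l)
  (@cvg_cst _ _ _ _ _) (@cont_affine k l t)).
Qed.

Lemma connected_vertical (m b b' : R) : connected [set z : R * R | z.1 = m /\ b <= z.2 <= b'].
Proof.
have -> : [set z : R * R | z.1 = m /\ b <= z.2 <= b'] =
    (fun t => (m, t)) @` [set t | b <= t <= b'].
  apply/seteqP; split=> [[x y] /= [-> h]|z [t h <-]]; first by exists y.
  by split.
apply: connected_continuous_connected; first exact: connected_itv.
apply: continuous_subspaceT => t.
exact: (@cvg_pair _ _ _ _ _ _ _ _ _ (fun=> m) id (@cvg_cst _ _ _ _ _) cvg_id).
Qed.

Lemma connected_horizontal (m a a' : R) : connected [set z : R * R | a <= z.1 <= a' /\ z.2 = m].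
Proof.
have -> : [set z : R * R | a <= z.1 <= a' /\ z.2 = m] =
    (fun t => (t, m)) @` [set t | a <= t <= a'].
  apply/seteqP; split=> [[x y] /= [h ->]|z [t h <-]]; first by exists x.
  by split.
apply: connected_continuous_connected; first exact: connected_itv.
apply: continuous_subspaceT => t.
exact: (@cvg_pair _ _ _ _ _ _ _ _ _ id (fun=> m) cvg_id (@cvg_cst _ _ _ _ _)).
Qed.

Variables (U : set (quat R)) (Om : quat R -> quat R -> quat R).
Hypothesis Om_im : forall x v, Om x v 0 0 = 0.
Hypothesis Om_loc : forall x, U x -> exists d r,
  [/\ 0 < d, parallel Om r [set y | `|y - x| < d] & r x = qone R].

(** Sections over small squares are given by local solutions, and sections over
    four quarters can be glued to a section over the square. *)
Lemma square_section F : contin (rect 0 1 0 1) F -> (forall z, rect 0 1 0 1 z -> U (F z)) ->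
  exists a, section Om (rect 0 1 0 1) F a.
Proof.
move=> cF FU; pose Q (a b h : R) := exists c, section Om (rect a (a + h) b (b + h)) F c.
suff : Q 0 0 1 by rewrite /Q !add0r.
apply: square_induction.
  move=> a b h h0 a0 a1 b0 b1 [c1 s1] [c2 s2] [c3 s3] [c4 s4].
  have cF' (x x' y y' : R) : 0 <= x -> x' <= 1 -> 0 <= y -> y' <= 1 -> contin (rect x x' y y') F.
    move=> *; apply: contin_sub cF => z [/andP[? ?] /andP[? ?]].
    by split; apply/andP; split; lra.
  have horiz (y y' : R) c c' : 0 <= y -> y <= y' -> y' <= 1 -> section Om (rect a (a + h) y y') F c ->
      section Om (rect (a + h) (a + h + h) y y') F c' ->
      exists c, section Om (rect a (a + 2 * h) y y') F c.
    move=> y0 yy' y1 s s'.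
    have -> : rect a (a + 2 * h) y y' = rect a (a + h) y y' `|` rect (a + h) (a + h + h) y y'.
      apply/seteqP; split=> z /=; rewrite /rect /=.
        by move=> [/andP[h1 h2] ->]; have [h3|h3] := leP z.1 (a + h); [left|right]; split=> //; lra.
      by case=> [] [/andP[h1 h2] ->]; split=> //; lra.
    apply: (@section_glue _ _ Om_im _ _ _ _ _ _ (a + h, y)) s s'.
    - exact: closed_rect.
    - exact: closed_rect.
    - have -> : rect a (a + h) y y' `&` rect (a + h) (a + h + h) y y' =
          [set z | z.1 = a + h /\ y <= z.2 <= y'].
        apply/seteqP; split=> z /=; rewrite /rect /=.
          by move=> [[/andP[h1 h2] ->] [/andP[h3 h4] _]]; split=> //; lra.
        by move=> [-> ->]; split; split=> //; lra.
      exact: connected_vertical.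
    - by rewrite /rect /= lexx yy'; split=> //; lra.
    - by rewrite /rect /= lexx yy'; split=> //; lra.
    - by apply: cF'; lra.
    - by apply: cF'; lra.
  have [c sc] := horiz b (b + h) c1 c2 b0 (ltac:(lra)) (ltac:(lra)) s1 s2.
  have [c' sc'] := horiz (b + h) (b + h + h) c3 c4 (ltac:(lra)) (ltac:(lra)) (ltac:(lra)) s3 s4.
  rewrite /Q.
  have -> : rect a (a + 2 * h) b (b + 2 * h) =
      rect a (a + 2 * h) b (b + h) `|` rect a (a + 2 * h) (b + h) (b + h + h).
    apply/seteqP; split=> z /=; rewrite /rect /=.
      by move=> [-> /andP[h1 h2]]; have [h3|h3] := leP z.2 (b + h); [left|right]; split=> //; lra.
    by case=> [] [-> /andP[h1 h2]]; split=> //; lra.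
  apply: (@section_glue _ _ Om_im _ _ _ _ _ _ (a, b + h)) sc sc'.
  - exact: closed_rect.
  - exact: closed_rect.
  - have -> : rect a (a + 2 * h) b (b + h) `&` rect a (a + 2 * h) (b + h) (b + h + h) =
        [set z | a <= z.1 <= a + 2 * h /\ z.2 = b + h].
      apply/seteqP; split=> z /=; rewrite /rect /=.
        by move=> [[-> /andP[h1 h2]] [_ /andP[h3 h4]]]; split=> //; lra.
      by move=> [-> ->]; split; split=> //; lra.
    exact: connected_horizontal.
  - by rewrite /rect /= lexx; split=> //; lra.
  - by rewrite /rect /= lexx; split=> //; lra.
  - by apply: cF'; lra.
  - by apply: cF'; lra.
move=> x y x01 y01; have xy : rect 0 1 0 1 (x, y) by split.
have [d [r [d0 par _]]] := Om_loc (FU _ xy).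
have /nbhs_ballP[e e0 he] := cF _ xy d d0.
exists e => // a b h /andP[h0 he'] a0 a1 b0 b1 /andP[ax xa] /andP[b_y yb].
exists (r \o F); apply: parallel_section par _.
  apply: contin_sub cF => z [/andP[? ?] /andP[? ?]].
  by split; apply/andP; split; lra.
move=> z [/andP[h1 h2] /andP[h3 h4]]; apply: he; last first.
  by split; apply/andP; split; lra.
split; rewrite /= -ball_normE /= ltr_norml; apply/andP; split; lra.
Qed.

Lemma section_from (T : topologicalType) (D : set T) F a z0 c : section Om D F a -> D z0 -> S3 c ->
  exists2 a', section Om D F a' & a' z0 = c.
Proof.
move=> sa Dz0 Sc; have Sa := section_at Dz0 sa.
exists (fun z => (c *q qconj (a z0)) *q a z).
  by apply: sectionM => //; apply: S3M => //; exact: S3conj.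
by rewrite -qmulA S3_Cmul // qmul1.
Qed.

Lemma contin_ext (T : topologicalType) (D : set T) (F F' : T -> quat R) :
  (forall z, D z -> F z = F' z) -> contin D F -> contin D F'.
Proof.
move=> FF cF z Dz e e0; apply: filterS (cF z Dz e e0) => w h Dw.
by rewrite -!FF //; exact: h.
Qed.

Lemma path_inP c : path_in U c <-> contin I01 c /\ (forall t, I01 t -> U (c t)).
Proof.
rewrite /path_in; split=> [[cc cU]|[cc cU]]; split.
- by apply/continP; rewrite -I01E.
- by move=> t t01; apply: cU; rewrite in_itv.
- by rewrite I01E; apply/continP.
- by move=> t; rewrite in_itv => t01; exact: cU.
Qed.

Lemma path_section c q : path_in U c -> S3 q ->
  exists2 a, section Om I01 c a & a 0 = q.
Proof.
move=> /path_inP[cc cU] Sq.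
(* A path is regarded as a map of the square that only depends on one variable. *)
pose F (z : R * R) := c z.2.
have [||a sa] := @square_section F.
- by apply: (contin_pullback _ _ cc) => [z|z [] //]; exact: cvg_snd.
- by move=> z [_ h]; exact: cU.
pose phi (t : R) : R * R := (0, 1 * t + 0).
have phiI t : I01 t -> rect 0 1 0 1 (phi t).
  by move=> ht; split; rewrite /= ?mul1r ?addr0 ?lexx ?ler01.
have sphi := section_pullback (@cont_pair0 0 1 0) phiI sa.
have sc : section Om I01 c (a \o phi).
  by apply: section_ext sphi => // t _; rewrite /F /= mul1r addr0.
have I0 : I01 0 by rewrite /I01 /= lexx ler01.
exact: section_from sc I0 Sq.
Qed.

Definition concat (c c' : R -> quat R) (t : R) : quat R :=
  if t <= 2^-1 then c (2 * t) else c' (2 * t - 1).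

Lemma concat_fst c c' t : I01 t -> concat c c' (2^-1 * t) = c t.
Proof.
move=> /andP[t0 t1]; rewrite /concat ifT; last by rewrite ler_piMr // invr_ge0.
by rewrite mulrA divff // mul1r.
Qed.

Lemma concat_snd c c' t : c 1 = c' 0 -> I01 t -> concat c c' (2^-1 * t + 2^-1) = c' t.
Proof.
move=> cc /andP[t0 t1]; rewrite /concat.
have [->|t_neq0] := eqVneq t 0.
  by rewrite mulr0 add0r lexx divff.
have t_gt0 : 0 < t by rewrite lt0r t_neq0.
rewrite ifF; first by congr c'; field.
by apply/negbTE; rewrite -ltNge ltrDr mulr_gt0 // invr_gt0.
Qed.

Lemma path_concat c c' : path_in U c -> path_in U c' -> c 1 = c' 0 -> path_in U (concat c c').
Proof.
move=> /path_inP[cc cU] /path_inP[cc' cU'] c10; apply/path_inP; split; last first.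
  move=> t /andP[t0 t1]; rewrite /concat; case: ifPn => [th|]; first by apply: cU; rewrite /I01 /=; lra.
  by rewrite -ltNge => th; apply: cU'; rewrite /I01 /=; lra.
have -> : I01 = [set t : R | 0 <= t <= 2^-1] `|` [set t : R | 2^-1 <= t <= 1].
  apply/seteqP; split=> t /=; rewrite /I01 /=.
    by move=> /andP[h1 h2]; have [h3|h3] := leP t 2^-1; [left|right]; lra.
  by case=> /andP[h1 h2]; lra.
apply: contin_union; [exact: closed_itv|exact: closed_itv| |].
  apply: (@contin_ext _ _ (c \o (fun t => 2 * t + 0))).
    by move=> t /andP[_ th] /=; rewrite /concat th addr0.
  apply: contin_pullback cc; first exact: cont_affine.
  by move=> t /= /andP[h1 h2]; rewrite /I01 /=; lra.
apply: (@contin_ext _ _ (c' \o (fun t => 2 * t + (-1)))).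
  move=> t /andP[th _] /=; rewrite /concat; case: ifPn => // th'.
  have -> : t = 2^-1 by apply/eqP; rewrite eq_le th th'.
  by rewrite divff // subrr c10.
apply: contin_pullback cc'; first exact: cont_affine.
by move=> t /= /andP[h1 h2]; rewrite /I01 /=; lra.
Qed.

Variable x0 : quat R.
Hypothesis U_sc : simply_connected R U.

(** q is the value at y of a continuation along a path from x0 of the local
    solution with value 1 at x0. *)
Definition reach y q := exists c s,
  [/\ path_in U c, c 0 = x0, c 1 = y, section Om I01 c s & s 0 = qone R /\ s 1 = q].

Let I01_0 : I01 0. Proof. by rewrite /I01 /= lexx ler01. Qed.
Let I01_1 : I01 1. Proof. by rewrite /I01 /= lexx ler01. Qed.

Lemma reach_exists y : U x0 -> U y -> exists q, reach y q.
Proof.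
move=> Ux0 Uy; have [c [cp c0 c1]] := U_sc.1 _ _ Ux0 Uy.
have [s sc s0] := path_section cp (@S3one R).
by exists (s 1), c, s.
Qed.

(** Two paths to the same point form a null-homotopic loop; a section over the
    homotopy is constant on the three sides of the square that the homotopy
    sends to the base point, so transport around the loop is trivial. *)
Lemma reach_unique y q q' : reach y q -> reach y q' -> q = q'.
Proof.
move=> [c [s [cp c0 c1 sc [s0 s1]]]] [c' [s' [cp' c'0 c'1 sc' [s'0 s'1]]]].
pose rc t := c' (- 1 * t + 1).
have rc_p : path_in U rc.
  have [cc' cU'] := (path_inP c').1 cp'; apply/path_inP; split.
    apply: (contin_pullback _ _ cc'); first exact: cont_affine.
    by move=> t /andP[h1 h2]; rewrite /I01 /=; lra.
  by move=> t /andP[h1 h2]; apply: cU'; rewrite /I01 /=; lra.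
have c_rc : c 1 = rc 0 by rewrite /rc mulr0 add0r c1 c'1.
pose l := concat c rc.
have l_p : path_in U l := path_concat cp rc_p c_rc.
have l0 : l 0 = x0 by rewrite -c0 -(concat_fst c rc I01_0) mulr0.
have l1 : l 1 = x0.
  rewrite -c'0; have := concat_snd c_rc I01_1.
  by rewrite mulr1 -[2^-1]mul1r -splitr /rc mulN1r addNr.
have [F [cF FU Ft Fs]] := U_sc.2 l l_p (etrans l0 (esym l1)).
have rectE : rect 0 1 0 1 = [set` `[(0 : R), 1]] `*` [set` `[(0 : R), 1]].
  by apply/seteqP; split=> z /=; rewrite /rect /= !in_itv.
have cF' : contin (rect 0 1 0 1) F by rewrite rectE; apply/continP.
have FU' z : rect 0 1 0 1 z -> U (F z).
  by case: z => s'' t [h1 h2]; apply: FU; rewrite in_itv.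
have Ft' t : I01 t -> F (0, t) = l t /\ F (1, t) = l 0 by move=> h; apply: Ft; rewrite in_itv.
have Fs' t : I01 t -> F (t, 0) = l 0 /\ F (t, 1) = l 0 by move=> h; apply: Fs; rewrite in_itv.
have [A0 sA0] := square_section cF' FU'.
have R00 : rect 0 1 0 1 ((0, 0) : R * R) by split; exact: I01_0.
have [A sA A00] := section_from sA0 R00 (@S3one R).
have edge D z z' : connected D -> D `<=` rect 0 1 0 1 -> (forall z, D z -> F z = l 0) ->
    D z -> D z' -> A z = A z'.
  move=> cD sD Fl Dz Dz'; apply: (section_const cD _ (section_sub sD sA)) => //.
  by move=> w w' Dw Dw'; rewrite !Fl.
have A01 : A (0, 1) = qone R.
  have E1 : A (0, 0) = A (1, 0).
    apply: edge (@connected_horizontal 0 0 1) _ _ _ _.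
    - by move=> [x y'] /= [h ->]; split=> //; exact: I01_0.
    - by move=> [x y'] /= [h ->]; exact: (Fs' x h).1.
    - by rewrite /= lexx ler01.
    - by rewrite /= lexx ler01.
  have E2 : A (1, 0) = A (1, 1).
    apply: edge (@connected_vertical 1 0 1) _ _ _ _.
    - by move=> [x y'] /= [-> h]; split=> //; exact: I01_1.
    - by move=> [x y'] /= [-> h]; exact: (Ft' y' h).2.
    - by rewrite /= lexx ler01.
    - by rewrite /= lexx ler01.
  have E3 : A (1, 1) = A (0, 1).
    apply: edge (@connected_horizontal 1 0 1) _ _ _ _.
    - by move=> [x y'] /= [h ->]; split=> //; exact: I01_1.
    - by move=> [x y'] /= [h ->]; exact: (Fs' x h).2.
    - by rewrite /= lexx ler01.
    - by rewrite /= lexx ler01.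
  by rewrite -E3 -E2 -E1.
have half (k m : R) (e : R -> quat R) (se : R -> quat R) : path_in U e ->
    section Om I01 e se -> (forall t, I01 t -> I01 (k * t + m)) ->
    (forall t, I01 t -> l (k * t + m) = e t) -> A (0, m) = se 0 -> A (0, k + m) = se 1.
  move=> /path_inP[ce _] sse km le A0e.
  pose phi (t : R) := ((0, k * t + m) : R * R).
  have sphi : section Om I01 e (A \o phi).
    apply: (@section_ext _ _ _ _ (F \o phi) _ (A \o phi)) => //.
      by move=> t ht /=; rewrite (Ft' _ (km t ht)).1 le.
    apply: (section_pullback (@cont_pair0 0 k m) _ sA) => t ht.
    by split; [exact: I01_0|exact: km].
  have -> : A (0, k + m) = (A \o phi) 1 by rewrite /= /phi mulr1.
  apply: (section_unique Om_im (@connected_itv 0 1) ce sphi sse I01_0) => //.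
  by rewrite /= /phi mulr0 add0r.
have E1 : A (0, 2^-1 + 0) = s 1.
  apply: (half 2^-1 0 c s cp sc).
  - by move=> t /andP[h1 h2]; rewrite /I01 /=; lra.
  - by move=> t ht; rewrite addr0; exact: concat_fst.
  - by rewrite A00 s0.
have E2 : A (0, - 2^-1 + 1) = s' 1.
  apply: (half (- 2^-1) 1 c' s' cp' sc').
  - by move=> t /andP[h1 h2]; rewrite /I01 /=; lra.
  - move=> t ht; have -> : - 2^-1 * t + 1 = 2^-1 * (- 1 * t + 1) + 2^-1 by field.
    rewrite /l concat_snd //; first by rewrite /rc; congr c'; ring.
    by move: ht => /andP[h1 h2]; rewrite /I01 /=; lra.
  - by rewrite A01 s'0.
by rewrite -s1 -s'1 -E1 -E2; congr (A (0, _)); field.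
Qed.

(** A path to y is prolonged by g inside the ball, and r composed with g
    continues the section along it. *)
Lemma reach_local y q r (d : R) : reach y q -> 0 < d ->
  parallel Om r [set z | `|z - y| < d] -> r y = q ->
  forall g, path_in U g -> g 0 = y -> (forall t, I01 t -> `|g t - y| < d) ->
  reach (g 1) (r (g 1)).
Proof.
move=> [c [s [cp c0 c1 sc [s0 s1]]]] d0 par ry g gp g0 gd.
have cg : c 1 = g 0 by rewrite c1 g0.
have l_p := path_concat cp gp cg; set l := concat c g in l_p.
have [A sA A0] := path_section l_p (@S3one R).
have l0 : l 0 = x0 by rewrite -c0 -(concat_fst c g I01_0) mulr0.
have l1 : l 1 = g 1.
  by have := concat_snd cg I01_1; rewrite mulr1 -[2^-1]mul1r -splitr.
exists l, A; split=> //; split=> //.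
have half (k m : R) (e : R -> quat R) (se : R -> quat R) : path_in U e ->
    section Om I01 e se -> (forall t, I01 t -> I01 (k * t + m)) ->
    (forall t, I01 t -> l (k * t + m) = e t) -> A m = se 0 -> A (k + m) = se 1.
  move=> /path_inP[ce _] sse km le A0e.
  pose phi (t : R) := k * t + m.
  have sphi : section Om I01 e (A \o phi).
    apply: (@section_ext _ _ _ _ (l \o phi) _ (A \o phi)) => //.
    exact: (section_pullback (@cont_affine k m) km sA).
  have -> : A (k + m) = (A \o phi) 1 by rewrite /= /phi mulr1.
  apply: (section_unique Om_im (@connected_itv 0 1) ce sphi sse I01_0) => //.
  by rewrite /= /phi mulr0 add0r.
have E1 : A (2^-1 + 0) = s 1.
  apply: (half 2^-1 0 c s cp sc).
  - by move=> t /andP[h1 h2]; rewrite /I01 /=; lra.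
  - by move=> t ht; rewrite addr0; exact: concat_fst.
  - by rewrite A0 s0.
have [cg' _] := (path_inP g).1 gp.
have -> : A 1 = A (2^-1 + 2^-1) by congr A; field.
apply: (half 2^-1 2^-1 g (r \o g) gp).
- exact: parallel_section par gd.
- by move=> t /andP[h1 h2]; rewrite /I01 /=; lra.
- by move=> t ht; exact: concat_snd.
- by rewrite -[2^-1]addr0 E1 s1 /= g0 ry.
Qed.

End Monodromy.

(** * Radial extension of functions on the sphere *)

Section SphereCalculus.
Variable R : realType.
Implicit Types (x y u v w : quat R) (U W : set (quat R)).
Notation N := (@normalize R).

Definition nonzero : set (quat R) := [set y | y != 0].

Lemma derive_coord y v (m : 'I_4) : 'D_v (fun z : quat R => z 0 m) y = v 0 m.
Proof.
have did : differentiable (@id (quat R)) y by exact: ex_diff.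
by rewrite (derive_coordinate v m did) derive_id.
Qed.

Lemma Ck_coord n W (m : 'I_4) : open W -> Ck n W (fun y : quat R => y 0 m).
Proof.
move=> oW; case: n => [|n].
  by move=> y _; apply: differentiable_continuous; exact: differentiable_coord.
split=> [y _|v]; first exact: differentiable_coord.
have -> : (fun y => 'D_v (fun z : quat R => z 0 m) y) = (fun=> v 0 m).
  by apply/funext => y; exact: derive_coord.
exact: Ck_cst.
Qed.

Lemma Ck_id n W : open W -> Ck n W (@id (quat R)).
Proof. by move=> oW; apply/Ck_quatP => // m; exact: Ck_coord. Qed.

Lemma Ck_edot n W : open W -> Ck n W (fun y : quat R => edot y y).
Proof.
by move=> oW; apply: Ck_sum => // m; apply: CkM => //; exact: Ck_coord.
Qed.

Lemma edot_gt0 y : y != 0 -> 0 < edot y y.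
Proof. by move=> y0; rewrite -enorm_sqr exprn_gt0 // enorm_gt0. Qed.

Lemma open_nonzero : open nonzero.
Proof.
have -> : nonzero = (fun y : quat R => edot y y) @^-1` [set t | 0 < t].
  apply/seteqP; split=> y /=; first exact: edot_gt0.
  by apply: contraTN => /eqP ->; rewrite -enorm_sqr enorm0 expr0n ltxx.
apply: open_comp; last exact: open_gt.
by move=> y _; exact: (@Ck_edot 0 setT openT y I).
Qed.

Lemma Ck_normalize n : Ck n nonzero N.
Proof.
have oW := open_nonzero; apply/Ck_quatP => // m.
rewrite /normalize; under eq_fun do rewrite quatZE.
apply: CkM => //; last exact: Ck_coord.
apply: CkV => // [y y0|]; first by rewrite enorm_eq0.
by apply: Ck_sqrt => //; [move=> y; exact: edot_gt0|exact: Ck_edot].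
Qed.

Lemma Ck_qinv n : Ck n nonzero (@qinv R).
Proof.
have oW := open_nonzero; apply/Ck_quatP => // m.
rewrite /qinv; under eq_fun do rewrite quatZE.
apply: CkM => //.
  by apply: CkV => // [y y0|]; [rewrite gt_eqF // edot_gt0|exact: Ck_edot].
have := Ck_qconj oW (Ck_id n oW); move/(Ck_quatP _ _ oW); exact.
Qed.

Lemma differentiable_normalize y : y != 0 -> differentiable N y.
Proof. by move=> y0; have [h _] := Ck_normalize 1; exact: h. Qed.

(** The derivative of the radial projection is the orthogonal projection to the
    tangent space, scaled by the inverse distance to the origin: differentiate
    edot y y = |y|^2 and y = |y| (N y). *)
Lemma derive_normalize y v : y != 0 ->
  'D_v N y = (enorm y)^-1 *: (v - edot (N y) v *: N y).
Proof.
move=> y0; have y_gt0 := edot_gt0 y0; have n_gt0 : 0 < enorm y by rewrite enorm_gt0.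
have dE : differentiable (fun z : quat R => edot z z) y.
  by have [h _] := Ck_edot 1 openT; exact: h.
have DE : 'D_v (fun z : quat R => edot z z) y = 2 * edot y v.
  rewrite /edot (_ : (fun z : quat R => _) = \sum_m (fun z : quat R => z 0 m * z 0 m)); last first.
    by apply/funext => z; rewrite fct_sumE.
  have dm m := @diff_derivable _ _ _ _ _ v (@differentiable_coord _ _ _ y 0 m).
  rewrite derive_sum; last by move=> m; exact: derivableM.
  rewrite mulr_sumr; apply: eq_bigr => m _.
  have := deriveM (dm m) (dm m) => ->.
  by rewrite derive_coord -mulr2n mulr_natl.
have [dn Dn] := derive_comp1 v dE (is_derive1_sqrt y_gt0).
have dNy := differentiable_normalize y0.
apply/rowP => m; rewrite -derive_coordinate // /normalize.
under eq_fun do rewrite quatZE.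
have dninv : derivable (fun z : quat R => (enorm z)^-1) y v.
  by apply: derivableV; [rewrite enorm_eq0|exact: diff_derivable].
have dm := @diff_derivable _ _ _ _ _ v (@differentiable_coord _ _ _ y 0 m).
have := deriveM dninv dm => ->.
rewrite derive_coord.
have -> : 'D_v (fun z : quat R => (enorm z)^-1) y = - (enorm y)^-1 ^+ 3 * edot y v.
  rewrite deriveV; [|by rewrite enorm_eq0|exact: diff_derivable].
  rewrite [X in _ *: X]Dn DE /GRing.scale /= -/(enorm y).
  by field; rewrite lt0r_neq0.
rewrite edotZl !quatE /GRing.scale /=.
by field; rewrite lt0r_neq0.
Qed.

Lemma derive_normalize_tangent y v : y != 0 -> tangentS3 (N y) ('D_v N y).
Proof.
move=> y0; rewrite /tangentS3 /= derive_normalize // edotZr edotDr -scaleNr edotZr.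
by rewrite ((S3P _).1 (S3_normalize y0)) mulr1 subrr mulr0.
Qed.

Lemma derive_normalize_S3 x v : S3 x -> tangentS3 x v -> 'D_v N x = v.
Proof.
move=> Sx; rewrite /tangentS3 /= => xv.
rewrite derive_normalize ?S3_neq0 // normalize_S3 // xv scale0r subr0.
by move: Sx; rewrite /S3 /= => ->; rewrite invr1 scale1r.
Qed.

Lemma derive_normalize_qmul y v : y != 0 -> 'D_(y *q v) N y = N y *q (v - v 0 0 *: qone R).
Proof.
move=> y0; rewrite derive_normalize // edotZl.
have -> : edot y (y *q v) = edot y y * v 0 0.
  by rewrite -{1}[y]qmul1 edotMl; congr (_ * _); rewrite edotE /qone !quatE; ring.
rewrite -enorm_sqr /normalize.
have n0 : enorm y != 0 by rewrite enorm_eq0.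
apply/rowP => m; rewrite qmulBr qmulZr qmul1 !qmulZl !quatE; field.
exact: n0.
Qed.

Lemma tangent_qmul x v : S3 x -> v 0 0 = 0 -> tangentS3 x (x *q v).
Proof.
move=> Sx v0; rewrite /tangentS3 /= -{1}[x]qmul1 edotMl.
by rewrite [X in _ * X](_ : _ = 0) ?mulr0 // edotE /qone !quatE v0; ring.
Qed.

Lemma tangent_qconj x v : tangentS3 x v -> (qconj x *q v) 0 0 = 0.
Proof. by rewrite /tangentS3 /= edotE /qmul /qconj !quatE => <-; ring. Qed.

(** * Functions on an open subset of the sphere *)

Section OpenSubset.
Variable U : set (quat R).
Hypothesis U_open : open_in_S3 U.

Definition cone : set (quat R) := [set y | y != 0 /\ U (N y)].

Lemma U_S3 x : U x -> S3 x.
Proof. by case: U_open => A _ -> []. Qed.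

Lemma cone_U x : U x -> cone x.
Proof.
by move=> Ux; have Sx := U_S3 Ux; split; [exact: S3_neq0|rewrite normalize_S3].
Qed.

Lemma open_preimage_normalize W : open W -> open [set y | y != 0 /\ W (N y)].
Proof.
move=> oW; have -> : [set y | y != 0 /\ W (N y)] = nonzero `&` N @^-1` W by [].
have cN y : nonzero y -> {for y, continuous N}.
  by move=> y0; exact: differentiable_continuous (differentiable_normalize y0).
rewrite openE => y [/= y0 Wy]; rewrite /interior; apply: filterI.
  by apply: open_nbhs_nbhs; split=> //; exact: open_nonzero.
by apply: (cN y y0); exact: open_nbhs_nbhs.
Qed.

Lemma open_cone : open cone.
Proof.
have [A oA UE] := U_open.
have -> : cone = [set y | y != 0 /\ A (N y)].
  apply/seteqP; split=> y; rewrite /cone /= UE; first by move=> [y0 []].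
  by move=> [y0 Ay]; split=> //; split=> //; exact: S3_normalize.
exact: open_preimage_normalize.
Qed.

Lemma near_cone W y : open W -> cone y -> W (N y) -> \near y, [/\ y != 0, U (N y) & W (N y)].
Proof.
move=> oW Oy Wy.
have h1 : nbhs y cone by apply: open_nbhs_nbhs; split=> //; exact: open_cone.
have h2 : nbhs y [set z | z != 0 /\ W (N z)].
  apply: open_nbhs_nbhs; split; first exact: open_preimage_normalize.
  by split=> //; case: Oy.
by apply: filterS2 h1 h2 => z [z0 Uz] [_ Wz].
Qed.

Lemma derive_normalize_comp (V : normedModType R) (f h : quat R -> V) W y v :
  open W -> cone y -> W (N y) -> (forall z, W z -> U z -> h z = f z) ->
  differentiable h (N y) ->
  differentiable (f \o N) y /\ 'D_v (f \o N) y = 'D_('D_v N y) h (N y).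
Proof.
move=> oW Oy Wy hf dh.
have E : \near y, (h \o N) y = (f \o N) y.
  by apply: filterS (near_cone oW Oy Wy) => z [z0 Uz Wz]; exact: hf.
have [dhN DhN] := derive_comp v (differentiable_normalize Oy.1) dh.
split; first exact: differentiable_near_eq dhN.
by rewrite -DhN; apply/esym; exact: near_eq_derive.
Qed.

(** The radial projection is the identity to first order in tangential
    directions, so any local extension of f computes its differential. *)
Lemma dS3E (V : normedModType R) (f h : quat R -> V) W x v :
  open W -> U x -> W x -> (forall z, W z -> U z -> h z = f z) ->
  differentiable h x -> tangentS3 x v -> dS3 f x v = 'D_v h x.
Proof.
move=> oW Ux Wx hf dh xv; have Sx := U_S3 Ux; have Nx := normalize_S3 Sx.
have [] := @derive_normalize_comp V f h W x v oW (cone_U Ux).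
- by rewrite Nx.
- exact: hf.
- by rewrite Nx.
by rewrite derive_normalize_S3 // Nx /dS3 => _.
Qed.

Lemma smooth_extension (V : normedModType R) (f : quat R -> V) x : smoothS3 U f -> U x ->
  exists W h, [/\ open W, W x, Cinfty W h, (forall z, W z -> U z -> h z = f z) &
    forall z, W z -> differentiable h z].
Proof.
move=> sf Ux; have [W [h [oW Wx ch hf]]] := sf x Ux.
by exists W, h; split=> // z Wz; have [dh _] := ch 1; exact: dh.
Qed.

(** The radial extension turns derivatives on the sphere into derivatives at
    all points of the cone. *)
Lemma derive_normalizeE (V : normedModType R) (f : quat R -> V) y v :
  smoothS3 U f -> cone y ->
  differentiable (f \o N) y /\ 'D_v (f \o N) y = dS3 f (N y) ('D_v N y).
Proof.
move=> sf Oy; have [W [h [oW Wx ch hf dh]]] := smooth_extension sf Oy.2.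
have [d ->] := derive_normalize_comp v oW Oy Wx hf (dh _ Wx).
split=> //; apply/esym; apply: (dS3E oW Oy.2 Wx hf (dh _ Wx)).
exact: derive_normalize_tangent Oy.1.
Qed.

Lemma dS3D (V : normedModType R) (f : quat R -> V) x (a b : R) v w : smoothS3 U f -> U x ->
  tangentS3 x v -> tangentS3 x w ->
  dS3 f x (a *: v + b *: w) = a *: dS3 f x v + b *: dS3 f x w.
Proof.
move=> sf Ux xv xw; have [W [h [oW Wx ch hf dh]]] := smooth_extension sf Ux.
have xvw : tangentS3 x (a *: v + b *: w).
  by move: xv xw; rewrite /tangentS3 /= edotDr !edotZr => -> ->; rewrite !mulr0 addr0.
by rewrite !(dS3E oW Ux Wx hf (dh _ Wx)) // deriveDv ?deriveZv //; exact: dh.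
Qed.

Lemma Ck_normalize_comp n (f : quat R -> R) : smoothS3 U f -> Ck n cone (f \o N).
Proof.
move=> sf; apply: Ck_local => y Oy.
have [W [h [oW Wx ch hf dh]]] := smooth_extension sf Oy.2.
pose W' := cone `&` [set z | z != 0 /\ W (N z)].
have oW' : open W' by apply: openI; [exact: open_cone|exact: open_preimage_normalize].
exists W'; first by split=> //; split=> //; case: Oy.
apply: (Ck_ext oW' (f := h \o N)) => [z [[z0 Uz] [_ Wz]]|]; first exact: hf.
apply: (Ck_comp oW' oW) (ch n) => [z [_ [_ Wz]] //|].
by apply: Ck_sub (Ck_normalize n) => z [[]].
Qed.

Lemma smoothS3_dS3 (f : quat R -> R) (a : quat R) : a 0 0 = 0 -> smoothS3 U f ->
  smoothS3 U (fun x => dS3 f x (x *q a)).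
Proof.
move=> a0 sf x Ux; have [W [h [oW Wx ch hf dh]]] := smooth_extension sf Ux.
exists W, (fun y => \sum_m (y *q a) 0 m * 'D_(delta_mx 0 m) h y); split=> // [n|y Wy Uy].
  apply: Ck_sum => // m; apply: CkM => //.
    have := Ck_qmul oW (Ck_id n oW) (Ck_cst n W a).
    by move/(Ck_quatP _ _ oW); exact.
  by have [_ h'] := ch n.+1; exact: h'.
rewrite (dS3E oW Uy Wy hf (dh _ Wy)); last by apply: tangent_qmul => //; exact: U_S3.
by rewrite derive_sum_delta //; exact: dh.
Qed.

End OpenSubset.
End SphereCalculus.

(** * The connection form and its curvature *)

Section Connection.
Variable R : realType.
Implicit Types (x y u v w : quat R).
Notation N := (@normalize R).

Lemma qmulV y : y != 0 -> y *q qinv y = qone R.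
Proof.
by move=> y0; rewrite /qinv qmulZr qmulC scalerA mulVf ?scale1r // gt_eqF // edot_gt0.
Qed.

Lemma qVmul y : y != 0 -> qinv y *q y = qone R.
Proof.
by move=> y0; rewrite /qinv qmulZl qCmul scalerA mulVf ?scale1r // gt_eqF // edot_gt0.
Qed.

Lemma differentiable_qinv y : y != 0 -> differentiable (@qinv R) y.
Proof. by move=> y0; have [h _] := Ck_qinv R 1; exact: h. Qed.

Lemma derive_qinv y u : y != 0 ->
  'D_u (@qinv R) y = - (qinv y *q u *q qinv y).
Proof.
move=> y0; have dV := differentiable_qinv y0.
have did : differentiable (@id (quat R)) y by exact: ex_diff.
have [_ D] := derive_qmul u did dV.
have E : \near y, (fun x => id x *q qinv x) y = (fun=> qone R) y.
  by apply: (open_near (@open_nonzero R) y0) => z z0; exact: qmulV.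
move: D; rewrite (near_eq_derive u E) derive_cst derive_id => D0.
have : qinv y *q (u *q qinv y + id y *q 'D_u (@qinv R) y) = 0 by rewrite -D0 qmul0.
rewrite qmulDr !qmulA qVmul // q1mul => /eqP.
by rewrite addr_eq0 => /eqP ->; rewrite opprK.
Qed.

(** For r = q x the system becomes X1 r = - r i, X2 r = r (- b3 i + s j) and
    X3 r = r (b2 i - s k), with b2 = X2 beta, b3 = X3 beta and
    s = sqrt 3 exp (- 2 beta): the derivative of r along x t is r times the
    following imaginary quaternion. *)
Definition gauge (b2 b3 s : R) (t : quat R) : quat R :=
  mkq 0 (- t 0 1 - b3 * t 0 2 + b2 * t 0 3) (s * t 0 2) (- (s * t 0 3)).

(** The part of gauge that depends on the coefficients, which is linear in them. *)
Definition gauge_coef (b2 b3 s : R) (t : quat R) : quat R :=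
  mkq 0 (- (b3 * t 0 2) + b2 * t 0 3) (s * t 0 2) (- (s * t 0 3)).

Lemma derive_gauge (b2 b3 s : quat R -> R) (t : quat R -> quat R) y u :
  differentiable b2 y -> differentiable b3 y -> differentiable s y ->
  differentiable t y ->
  differentiable (fun x => gauge (b2 x) (b3 x) (s x) (t x)) y ->
  'D_u (fun x => gauge (b2 x) (b3 x) (s x) (t x)) y =
  gauge (b2 y) (b3 y) (s y) ('D_u t y) +
  gauge_coef ('D_u b2 y) ('D_u b3 y) ('D_u s y) (t y).
Proof.
move=> d2 d3 ds dt dg.
have dm m : derivable (fun x => t x 0 m) y u.
  by apply: diff_derivable; exact: differentiable_coordinate.
have Dm m : 'D_u (fun x => t x 0 m) y = 'D_u t y 0 m by exact: derive_coordinate.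
have d2' := @diff_derivable _ _ _ _ _ u d2; have d3' := @diff_derivable _ _ _ _ _ u d3.
have ds' := @diff_derivable _ _ _ _ _ u ds.
have D_M (f : quat R -> R) m : derivable f y u -> derivable (fun x => f x * t x 0 m) y u /\
    'D_u (fun x => f x * t x 0 m) y = f y * 'D_u t y 0 m + 'D_u f y * t y 0 m.
  move=> df; split; first exact: (derivableM df (dm m)).
  by have := deriveM df (dm m) => ->; rewrite Dm; congr (_ + _); exact: mulrC.
have [b3t b3tE] := D_M b3 2 d3'; have [b2t b2tE] := D_M b2 3 d2'.
have [s2 s2E] := D_M s 2 ds'; have [s3 s3E] := D_M s 3 ds'.
apply: quatP; rewrite -derive_coordinate // /gauge /gauge_coef !quatE; under eq_fun do rewrite quatE.
- by rewrite derive_cst addr0.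
- have := deriveD (derivableB (derivableN (dm 1)) b3t) b2t => ->.
  have := deriveB (derivableN (dm 1)) b3t => ->.
  have := deriveN (dm 1) => ->.
  by rewrite b3tE b2tE Dm; ring.
- exact: s2E.
- by have := deriveN s3 => ->; rewrite s3E; ring.
Qed.

Lemma gaugeD b2 b3 s t t' : gauge b2 b3 s (t + t') = gauge b2 b3 s t + gauge b2 b3 s t'.
Proof. apply: quatP; rewrite /gauge !quatE; ring. Qed.

Lemma gaugeZ b2 b3 s (k : R) t : gauge b2 b3 s (k *: t) = k *: gauge b2 b3 s t.
Proof. apply: quatP; rewrite /gauge !quatE; ring. Qed.

(** The curvature identity in the frame x i, x j, x k.  Here p, q, q' are
    X2 X2 beta, X3 X2 beta and X2 X3 beta; the equation for beta enters as
    X2 X2 beta + X3 X3 beta = 2 (s^2 - 1). *)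
Lemma gauge_flat (b2 b3 s p q q' : R) (a b : quat R) :
  let D2 (c : quat R) := 2 * b3 * c 0 1 + p * c 0 2 + q * c 0 3 in
  let D3 (c : quat R) := - (2 * b2) * c 0 1 + q' * c 0 2 + (2 * (s ^+ 2 - 1) - p) * c 0 3 in
  let Ds (c : quat R) := - (2 * s) * (b2 * c 0 2 + b3 * c 0 3) in
  let K (c d : quat R) := gauge b2 b3 s (- (c *q d)) +
    gauge_coef (D2 c) (D3 c) (Ds c) d in
  K a b - K b a + (gauge b2 b3 s a *q gauge b2 b3 s b -
                   gauge b2 b3 s b *q gauge b2 b3 s a) = 0.
Proof.
rewrite /=; apply: quatP; rewrite /gauge /gauge_coef /qmul !quatE; ring.
Qed.

Variables (U : set (quat R)).
Hypothesis U_open : open_in_S3 U.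

Lemma frame_derive (f : quat R -> R) y (a : quat R) : smoothS3 U f -> cone U y ->
  'D_(y *q a) (f \o N) y =
  X1 f (N y) * a 0 1 + X2 f (N y) * a 0 2 + X3 f (N y) * a 0 3.
Proof.
move=> sf Oy; have [y0 Uy] := Oy; have Sy := S3_normalize y0.
have [_ ->] := derive_normalizeE U_open (y *q a) sf Oy.
rewrite derive_normalize_qmul //.
have T1 : tangentS3 (N y) (N y *q qi) by apply: tangent_qmul => //; rewrite quatE.
have T2 : tangentS3 (N y) (N y *q qj) by apply: tangent_qmul => //; rewrite quatE.
have T3 : tangentS3 (N y) (N y *q qk) by apply: tangent_qmul => //; rewrite quatE.
have T23 : tangentS3 (N y) (a 0 2 *: (N y *q qj) + a 0 3 *: (N y *q qk)).
  by move: T2 T3; rewrite /tangentS3 /= edotDr !edotZr => -> ->; rewrite !mulr0 addr0.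
have -> : N y *q (a - a 0 0 *: qone R) = a 0 1 *: (N y *q qi) +
    1 *: (a 0 2 *: (N y *q qj) + a 0 3 *: (N y *q qk)).
  rewrite scale1r -!qmulZr -!qmulDr; congr (_ *q _).
  apply: quatP; rewrite /qone /qi /qj /qk !quatE; ring.
rewrite (dS3D U_open _ _ sf) // (dS3D U_open _ _ sf) //.
by rewrite /X1 /X2 /X3 /GRing.scale /= mul1r addrA !(mulrC (a 0 _)).
Qed.

(** The flow of x a is a right translation, so the vector fields x a and x b
    have the commutator x (b a - a b). *)
Lemma dS3_commutator (f : quat R -> R) x (a b : quat R) : smoothS3 U f -> U x ->
  a 0 0 = 0 -> b 0 0 = 0 ->
  dS3 (fun y => dS3 f y (y *q a)) x (x *q b) - dS3 (fun y => dS3 f y (y *q b)) x (x *q a) =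
  dS3 f x (x *q (b *q a - a *q b)).
Proof.
move=> sf Ux a0 b0; pose F := f \o N.
have oC := open_cone U_open; have Cx := cone_U U_open Ux.
have [dF ddF] := Ck_normalize_comp U_open 2 sf; rewrite -/F in dF ddF.
have second (c w : quat R) : c 0 0 = 0 -> dS3 (fun y => dS3 f y (y *q c)) x w =
    'D_(w *q c) F x + 'D_w (fun y => 'D_(x *q c) F y) x.
  move=> c0.
  (* Near x, the derivative along y c is a sum of smooth functions. *)
  pose G y := \sum_m (y *q c) 0 m * 'D_(delta_mx 0 m) F y.
  have E : \near x, ((fun y => dS3 f y (y *q c)) \o N) x = G x.
    apply: (open_near oC Cx) => y Oy; rewrite /G /=.
    transitivity ('D_(y *q c) F y); last by rewrite derive_sum_delta //; exact: dF.
    have [_ ->] := derive_normalizeE U_open (y *q c) sf Oy.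
    by rewrite (derive_normalize_qmul c Oy.1) c0 scale0r subr0.
  rewrite /dS3 (near_eq_derive _ E).
  have did : differentiable (@id (quat R)) x by exact: ex_diff.
  have [dc Dc] := derive_qmul w did (@differentiable_cst _ _ _ c x).
  have dm m : derivable (fun y => (y *q c) 0 m) x w.
    by apply: diff_derivable; exact: (differentiable_coordinate m dc).
  have Dm m : 'D_w (fun y => (y *q c) 0 m) x = (w *q c) 0 m.
    by rewrite (derive_coordinate w m dc) Dc derive_id derive_cst qmul0 addr0.
  have dD m : derivable (fun y => 'D_(delta_mx 0 m) F y) x w.
    by apply: diff_derivable; have [h _] := ddF (delta_mx 0 m); exact: h.
  have -> : 'D_(w *q c) F x = \sum_m (w *q c) 0 m * 'D_(delta_mx 0 m) F x.
    by rewrite derive_sum_delta //; exact: dF.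
  have -> : 'D_w (fun y => 'D_(x *q c) F y) x =
      \sum_m (x *q c) 0 m * 'D_w (fun y => 'D_(delta_mx 0 m) F y) x.
    transitivity ('D_w (\sum_m (x *q c) 0 m *: (fun y => 'D_(delta_mx 0 m) F y)) x).
      apply: near_eq_derive; apply: (open_near oC Cx) => y Oy.
      by rewrite fct_sumE derive_sum_delta //; exact: dF.
    rewrite derive_sum; last by move=> m; exact: derivableZ.
    by apply: eq_bigr => m _; rewrite deriveZ.
  rewrite /G (_ : (fun y => _) = \sum_m ((fun y => (y *q c) 0 m) * (fun y => 'D_(delta_mx 0 m) F y)));
    last by apply/funext => y; rewrite fct_sumE.
  rewrite derive_sum; last by move=> m; exact: derivableM.
  rewrite -big_split; apply: eq_bigr => m _ /=.
  by have := deriveM (dm m) (dD m) => ->; rewrite Dm addrC; congr (_ + _); exact: mulrC.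
have E1 := second a (x *q b) a0; have E2 := second b (x *q a) b0.
have S := derive_sym (x *q a) (x *q b) oC Cx (Ck_normalize_comp U_open 2 sf).
have E3 : dS3 f x (x *q (b *q a - a *q b)) = 'D_(x *q b *q a) F x - 'D_(x *q a *q b) F x.
  rewrite qmulBr !qmulA -scaleN1r; have dFx := dF x Cx.
  by apply: etrans (deriveDv _ _ dFx) _; rewrite (deriveZv _ _ dFx) scaleN1r.
have aux (k l m : R) : k + m - (l + m) = k - l by ring.
have E2' := etrans E2 (congr1 (fun k => _ + k) S).
exact: etrans (congr2 (fun k l : R => k - l) E1 E2') (etrans (aux _ _ _) (esym E3)).
Qed.

Variable beta : quat R -> R.
Hypothesis beta_smooth : smoothS3 U beta.
Hypothesis beta_X1 : forall x, U x -> X1 beta x = 0.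
Hypothesis beta_X2X3 : forall x, U x ->
  X2 (X2 beta) x + X3 (X3 beta) x = 2 * (3 - expR (4 * beta x)) / expR (4 * beta x).

Lemma smooth_X2 : smoothS3 U (X2 beta).
Proof. by apply: smoothS3_dS3 => //; rewrite quatE. Qed.

Lemma smooth_X3 : smoothS3 U (X3 beta).
Proof. by apply: smoothS3_dS3 => //; rewrite quatE. Qed.

Lemma dS3_X1_0 x v : U x -> dS3 (X1 beta) x v = 0.
Proof.
move=> Ux; rewrite -[RHS](@derive_cst R (quat R) R 0 x v); apply: near_eq_derive.
apply: (open_near (open_cone U_open) (cone_U U_open Ux)) => y [_ Uy].
exact: beta_X1.
Qed.

Lemma X1X2_beta x : U x -> X1 (X2 beta) x = 2 * X3 beta x.
Proof.
move=> Ux.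
have := @dS3_commutator beta x qj qi beta_smooth Ux (ltac:(by rewrite quatE)) (ltac:(by rewrite quatE)).
(* X2 (X1 beta) = 0, and i j - j i = 2 k. *)
rewrite -/(X1 (X2 beta) x) -/(X1 beta) dS3_X1_0 // subr0 => ->.
have -> : qi *q qj - qj *q qi = 1 *: qk + 1 *: qk :> quat R by quat_ring.
rewrite qmulDr qmulZr.
have T : tangentS3 x (x *q qk) by apply: tangent_qmul; [exact: U_S3 Ux|rewrite quatE].
by rewrite (dS3D U_open _ _ beta_smooth) // /X3 !scale1r -mulr2n mulr_natl.
Qed.

Lemma X1X3_beta x : U x -> X1 (X3 beta) x = - (2 * X2 beta x).
Proof.
move=> Ux.
have := @dS3_commutator beta x qk qi beta_smooth Ux (ltac:(by rewrite quatE)) (ltac:(by rewrite quatE)).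
rewrite -/(X1 (X3 beta) x) -/(X1 beta) dS3_X1_0 // subr0 => ->.
have -> : qi *q qk - qk *q qi = (-1) *: qj + (-1) *: qj :> quat R by quat_ring.
rewrite qmulDr qmulZr.
have T : tangentS3 x (x *q qj) by apply: tangent_qmul; [exact: U_S3 Ux|rewrite quatE].
by rewrite (dS3D U_open _ _ beta_smooth) // /X2 !scaleN1r mulr_natl mulr2n opprD.
Qed.

Definition b2 y := X2 beta (N y).
Definition b3 y := X3 beta (N y).
Definition sfun y := Num.sqrt 3 * expR (- 2 * beta (N y)).

Lemma Ck_b2 n : Ck n (cone U) b2.
Proof. exact: (Ck_normalize_comp U_open n smooth_X2). Qed.
Lemma Ck_b3 n : Ck n (cone U) b3.
Proof. exact: (Ck_normalize_comp U_open n smooth_X3). Qed.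
Lemma Ck_sfun n : Ck n (cone U) sfun.
Proof.
have oC := open_cone U_open; apply: CkM => //; first exact: Ck_cst.
apply: Ck_expR => //; apply: CkM => //; first exact: Ck_cst.
exact: Ck_normalize_comp.
Qed.

Lemma derive_b2 y (a : quat R) : cone U y -> 'D_(y *q a) b2 y =
  2 * b3 y * a 0 1 + X2 (X2 beta) (N y) * a 0 2 + X3 (X2 beta) (N y) * a 0 3.
Proof.
move=> Oy; have := frame_derive a smooth_X2 Oy => ->.
by rewrite X1X2_beta; case: Oy.
Qed.

Lemma derive_b3 y (a : quat R) : cone U y -> 'D_(y *q a) b3 y =
  - (2 * b2 y) * a 0 1 + X2 (X3 beta) (N y) * a 0 2 +
  (2 * (sfun y ^+ 2 - 1) - X2 (X2 beta) (N y)) * a 0 3.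
Proof.
move=> Oy; have [_ Uy] := Oy.
have E : X3 (X3 beta) (N y) = 2 * (sfun y ^+ 2 - 1) - X2 (X2 beta) (N y).
  have E0 : 2 * (3 - expR (4 * beta (N y))) / expR (4 * beta (N y)) = 2 * (sfun y ^+ 2 - 1).
    rewrite /sfun exprMn sqr_sqrtr //; move: (beta (N y)) => t.
    have -> : expR (- 2 * t) ^+ 2 = (expR (4 * t))^-1.
      by rewrite -expRN expr2 -expRD; congr expR; ring.
    by field; rewrite gt_eqF // expR_gt0.
  exact: etrans (canRL (addKr _) (etrans (beta_X2X3 Uy) E0)) (addrC _ _).
by rewrite -E -(X1X3_beta Uy); exact: frame_derive smooth_X3 Oy.
Qed.

Lemma derive_sfun y (a : quat R) : cone U y -> 'D_(y *q a) sfun y =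
  - (2 * sfun y) * (b2 y * a 0 2 + b3 y * a 0 3).
Proof.
move=> Oy; have [dB _] := derive_normalizeE U_open 0 beta_smooth Oy.
have dm : differentiable (fun z => -2 * beta (N z)) y.
  exact: (differentiableZ (-2) dB).
have Dm : 'D_(y *q a) (fun z => -2 * beta (N z)) y = -2 * 'D_(y *q a) (beta \o N) y.
  exact: (deriveZ (-2) (diff_derivable dB)).
have [de De] := derive_comp1 (y *q a) dm (is_derive_expR (-2 * beta (N y))).
have := deriveZ (Num.sqrt 3) (@diff_derivable _ _ _ _ _ (y *q a) de).
rewrite De Dm (frame_derive a beta_smooth Oy) beta_X1; last by case: Oy.
move=> E; apply: etrans E _; rewrite /GRing.scale /= /sfun /b2 /b3; ring.
Qed.

(** The real part of qinv y *q v, the radial component of v, is ignored, so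
    this is the pullback of the connection form under the radial projection. *)
Definition conn y v : quat R := gauge (b2 y) (b3 y) (sfun y) (qinv y *q v).

Lemma conn_im y v : conn y v 0 0 = 0.
Proof. by rewrite /conn /gauge quatE. Qed.

Lemma connD y u v : conn y (u + v) = conn y u + conn y v.
Proof. by rewrite /conn qmulDr gaugeD. Qed.

Lemma connZ y (k : R) v : conn y (k *: v) = k *: conn y v.
Proof. by rewrite /conn qmulZr gaugeZ. Qed.

Lemma Ck_conn n v : Ck n (cone U) (fun y => conn y v).
Proof.
have oC := open_cone U_open; apply/Ck_quatP => // m.
have cV : Ck n (cone U) (@qinv R) by apply: Ck_sub (Ck_qinv R n) => z [].
have /(Ck_quatP _ _ oC) ct := Ck_qmul oC cV (Ck_cst n _ v).
have [c2 c3 cs] : [/\ Ck n (cone U) b2, Ck n (cone U) b3 & Ck n (cone U) sfun].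
  by split; [exact: Ck_b2|exact: Ck_b3|exact: Ck_sfun].
rewrite /conn /gauge; have [->|->|->|->] := ord4P m; under eq_fun do rewrite quatE.
- exact: Ck_cst.
- by apply: CkD => //; [apply: CkB => //; [exact: CkN|exact: CkM]|exact: CkM].
- exact: CkM.
- by apply: CkN => //; exact: CkM.
Qed.

Lemma conn_flat y : cone U y -> flat_at conn y.
Proof.
move=> Oy u v; have [y0 _] := Oy.
have dV := differentiable_qinv y0.
have [c2 _] := Ck_b2 1; have [c3 _] := Ck_b3 1; have [cs _] := Ck_sfun 1.
have uE w : w = y *q (qinv y *q w) by rewrite qmulA qmulV // q1mul.
pose D2 (c : quat R) := 2 * b3 y * c 0 1 + X2 (X2 beta) (N y) * c 0 2 + X3 (X2 beta) (N y) * c 0 3.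
pose D3 (c : quat R) := - (2 * b2 y) * c 0 1 + X2 (X3 beta) (N y) * c 0 2 +
  (2 * (sfun y ^+ 2 - 1) - X2 (X2 beta) (N y)) * c 0 3.
pose Ds (c : quat R) := - (2 * sfun y) * (b2 y * c 0 2 + b3 y * c 0 3).
have D2E w : 'D_w b2 y = D2 (qinv y *q w).
  exact: etrans (congr1 (fun k => 'D_k b2 y) (uE w)) (derive_b2 (qinv y *q w) Oy).
have D3E w : 'D_w b3 y = D3 (qinv y *q w).
  exact: etrans (congr1 (fun k => 'D_k b3 y) (uE w)) (derive_b3 (qinv y *q w) Oy).
have DsE w : 'D_w sfun y = Ds (qinv y *q w).
  exact: etrans (congr1 (fun k => 'D_k sfun y) (uE w)) (derive_sfun (qinv y *q w) Oy).
have K w z : 'D_w (fun x => conn x z) y =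
    gauge (b2 y) (b3 y) (sfun y) (- ((qinv y *q w) *q (qinv y *q z))) +
    gauge_coef (D2 (qinv y *q w)) (D3 (qinv y *q w)) (Ds (qinv y *q w)) (qinv y *q z).
  have [dt Dt] := derive_qmul w dV (@differentiable_cst _ _ _ z y).
  have [dc _] := Ck_conn 1 z.
  have E := @derive_gauge b2 b3 sfun (fun x => qinv x *q z) y w (c2 y Oy) (c3 y Oy) (cs y Oy) dt (dc y Oy).
  have Dt' : 'D_w (fun x => qinv x *q z) y = - ((qinv y *q w) *q (qinv y *q z)).
    by apply: etrans Dt _; rewrite derive_cst qmul0 addr0 derive_qinv // qmulNl !qmulA.
  apply: etrans E _; apply: congr2 (congr1 _ Dt') _.
  apply: etrans (congr1 (fun k => gauge_coef k _ _ _) (D2E w)) _.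
  apply: etrans (congr1 (fun k => gauge_coef _ k _ _) (D3E w)) _.
  exact: (congr1 (fun k => gauge_coef _ _ k _) (DsE w)).
exact: etrans (congr2 (fun k l => k - l + _) (K u v) (K v u)) (gauge_flat _ _ _ _ _ _ _ _).
Qed.

End Connection.

(** * Solutions of the system *)

Section Solutions.
Variables (R : realType) (U : set (quat R)) (beta : quat R -> R).
Implicit Types (x y v w : quat R) (q r : quat R -> quat R).
Notation N := (@normalize R).
Hypothesis U_open : open_in_S3 U.

(** If r is of class C^n, so are its derivatives r Om, and r is of class
    C^(n+1). *)
Lemma parallel_smooth (Om : quat R -> quat R -> quat R) r W : open W ->
  (forall n v, Ck n W (fun y => Om y v)) -> parallel Om r W -> Cinfty W r.
Proof.
move=> oW cOm par; elim=> [|n ih].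
  by move=> y /par [_ dr _]; exact: differentiable_continuous.
split=> [y /par [_ dr _] //|v].
by apply: (Ck_ext oW) (Ck_qmul oW ih (cOm n v)) => y /par [_ _ ->].
Qed.

(** In the system for q every coefficient multiplies a conjugate by x; with the
    conjugation taken out, the coefficients refer to the fixed basis i, j, k. *)
Definition rate x (a : quat R) : quat R :=
  let s := Num.sqrt 3 * expR (- 2 * beta x) in
  mkq 0 (- 2 * a 0 1 - X3 beta x * a 0 2 + X2 beta x * a 0 3)
        (- (1 - s) * a 0 2) (- (1 + s) * a 0 3).

Definition system_rhs x (a : quat R) : quat R := x *q rate x a *q qconj x.

Lemma q_system_frame q : (forall x, U x -> forall a : quat R, a 0 0 = 0 ->
    dS3 q x (x *q a) = q x *q system_rhs x a) -> q_system U beta q.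
Proof.
move=> qa x Ux; rewrite (S3_qinv (U_S3 U_open Ux)) /=.
have conj_lin (a b : quat R) (k l : R) :
    x *q (k *: a + l *: b) *q qconj x = k *: (x *q a *q qconj x) + l *: (x *q b *q qconj x).
  by rewrite qmulDr qmulDl !qmulZr !qmulZl.
split.
- rewrite /X1 qa ?quatE // -qmulZr -qmulNr; congr (_ *q _).
  rewrite -scaleNr -qmulZl -qmulZr; congr (_ *q _ *q _).
  apply: quatP; rewrite /rate /qi !quatE; ring.
- rewrite /X2 qa ?quatE //; congr (_ *q _).
  rewrite -scaleNr -conj_lin; congr (_ *q _ *q _).
  apply: quatP; rewrite /rate /qi /qj !quatE; ring.
- rewrite /X3 qa ?quatE //; congr (_ *q _).
  rewrite -scaleNr -conj_lin; congr (_ *q _ *q _).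
  apply: quatP; rewrite /rate /qi /qk !quatE; ring.
Qed.

Lemma q_solution_dS3 q x w : q_solution U beta q -> U x -> tangentS3 x w ->
  dS3 q x w = q x *q system_rhs x (qconj x *q w).
Proof.
move=> [_ sq qsys] Ux xw; have Sx := U_S3 U_open Ux.
have [] := qsys x Ux; rewrite (S3_qinv Sx) /= => E1 E2 E3.
set a := qconj x *q w.
have a0 : a 0 0 = 0 by exact: tangent_qconj.
have T1 : tangentS3 x (x *q qi) by apply: tangent_qmul => //; rewrite quatE.
have T2 : tangentS3 x (x *q qj) by apply: tangent_qmul => //; rewrite quatE.
have T3 : tangentS3 x (x *q qk) by apply: tangent_qmul => //; rewrite quatE.
have T23 : tangentS3 x (a 0 2 *: (x *q qj) + a 0 3 *: (x *q qk)).
  by move: T2 T3; rewrite /tangentS3 /= edotDr !edotZr => -> ->; rewrite !mulr0 addr0.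
have -> : w = a 0 1 *: (x *q qi) + 1 *: (a 0 2 *: (x *q qj) + a 0 3 *: (x *q qk)).
  have -> : w = x *q a by rewrite /a qmulA S3_mulC // q1mul.
  rewrite scale1r -!qmulZr -!qmulDr; congr (_ *q _); clearbody a.
  apply: quatP; rewrite /qi /qj /qk !quatE ?a0; ring.
rewrite (dS3D U_open _ _ sq) // (dS3D U_open _ _ sq) //.
rewrite -/(X1 q x) -/(X2 q x) -/(X3 q x) E1 E2 E3 scale1r; clearbody a.
rewrite -!qmulZr -!qmulNr -!qmulZr -!qmulDr; congr (_ *q _).
rewrite /system_rhs.
have -> : rate x a = a 0 1 *: (- (2 *: qi)) + (a 0 2 *: (- X3 beta x *: qi -
     (1 - Num.sqrt 3 * expR (- 2 * beta x)) *: qj) + a 0 3 *: (X2 beta x *: qi -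
     (1 + Num.sqrt 3 * expR (- 2 * beta x)) *: qk)).
  apply: quatP; rewrite /rate /qi /qj /qk !quatE; ring.
rewrite !(qmulDr, qmulDl, qmulNr, qmulNl, qmulZr, qmulZl) ?scaleNr.
by [].
Qed.

Lemma system_rhs_im x (a : quat R) : qconj (system_rhs x a) = - system_rhs x a.
Proof.
rewrite /system_rhs !qconjM qconjK qmulA (_ : qconj (rate x a) = - rate x a).
  by rewrite qmulNr qmulNl.
by apply: qconj_im; rewrite /rate quatE.
Qed.

(** The function q' qbar has differential q' (w - w) qbar = 0, so it is constant
    on the connected set U. *)
Lemma solution_unique q q' x0 : connected U -> U x0 -> q_solution U beta q ->
  q_solution U beta q' -> exists2 c : quat R, S3 c & forall x, U x -> q' x = c *q q x.
Proof.
move=> cU Ux0 sol sol'; have [Sq sq _] := sol; have [Sq' sq' _] := sol'.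
pose k x := q' x *q qconj (q x).
have dk y v : cone U y -> differentiable (k \o N) y /\ 'D_v (k \o N) y = 0.
  move=> Oy; have [y0 Uy] := Oy.
  have [W [h [oW Wy _ hq dh]]] := smooth_extension sq Uy.
  have [W' [h' [oW' W'y _ hq' dh']]] := smooth_extension sq' Uy.
  have tw := derive_normalize_tangent v y0; set w := 'D_v N y in tw.
  have [dc Dc] := derive_qconj w (dh _ Wy).
  have [dp Dp] := derive_qmul w (dh' _ W'y) dc.
  have [] := @derive_normalize_comp _ _ U_open _ k (fun z => h' z *q qconj (h z))
    (W `&` W') y v (openI oW oW') Oy (conj Wy W'y) _ dp.
    by move=> z [Wz W'z] Uz; rewrite /k hq // hq'.
  move=> dkN ->; split=> //; apply: etrans Dp _; rewrite Dc.
  rewrite -(dS3E U_open oW Uy Wy hq (dh _ Wy) tw) -(dS3E U_open oW' Uy W'y hq' (dh' _ W'y) tw).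
  rewrite (q_solution_dS3 sol Uy tw) (q_solution_dS3 sol' Uy tw) hq // hq' //.
  by rewrite qconjM system_rhs_im qmulNl qmulNr !qmulA subrr.
have kc : forall x, U x -> k x = k x0.
  apply: (connected_locally_constant (P := fun x => k x = k x0) cU _ Ux0) => // z Uz.
  have [d d0 dC] := open_ballP (open_cone U_open) (cone_U U_open Uz).
  have nz : nbhs z [set y | `|y - z| < d].
    by apply: open_nbhs_nbhs; split; [exact: open_norm_ball|rewrite /= subrr normr0].
  apply: filterS nz => y /= yd Uy.
  have := @constant_of_derive0 _ (k \o N) z d (fun y yd => (dk y 0 (dC y yd)).1)
    (fun y v yd => (dk y v (dC y yd)).2) y yd.
  by rewrite /= (normalize_S3 (U_S3 U_open Uy)) (normalize_S3 (U_S3 U_open Uz)) => ->.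
exists (k x0); first by apply: S3M; [exact: Sq'|apply: S3conj; exact: Sq].
by move=> x Ux; rewrite -(kc x Ux) /k -qmulA S3_Cmul ?qmul1 //; exact: Sq.
Qed.

(** * The Lagrangian condition *)

(** Tangent vectors of the product at (x i x^-1, q), written in the frame given
    by right translations, in which J has constant coefficients. *)
Definition frame x (q0 : quat R) (A G : quat R) : quat R * quat R :=
  (x *q A *q qconj x, q0 *q (x *q G *q qconj x)).

Lemma commutator_qi (a : quat R) : a *q qi - qi *q a = mkq 0 0 (2 * a 0 3) (- (2 * a 0 2)).
Proof. quat_ring. Qed.

Lemma qi_mul (a : quat R) : qi *q a = mkq (- a 0 1) (a 0 0) (- a 0 3) (a 0 2).
Proof. quat_ring. Qed.

Lemma nkJ_frame x (q0 A G : quat R) : S3 x -> S3 q0 ->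
  nkJ (x *q qi *q qinv x, q0) (frame x q0 A G) =
  frame x q0 ((Num.sqrt 3)^-1 *: (2 *: (qi *q G) - A))
             ((Num.sqrt 3)^-1 *: (2 *: (qi *q A) + G)).
Proof.
move=> Sx Sq; rewrite /nkJ /frame /= (S3_qinv Sx) (S3_qinv Sq).
have Si : S3 (qi : quat R) by apply/S3P; rewrite edotE /qi !quatE; ring.
have Sp : S3 (x *q qi *q qconj x) by apply: S3M; [exact: S3M|exact: S3conj].
rewrite (S3_qinv Sp) !qconjM qconjK.
have -> : qconj qi = - qi :> quat R by apply: qconj_im; rewrite /qi quatE.
congr pair.
  have -> : x *q qi *q qconj x *q qconj q0 *q (q0 *q (x *q G *q qconj x)) =
      x *q (qi *q G) *q qconj x.
    rewrite -!qmulA (qmulA (qconj q0)) S3_Cmul // q1mul.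
    by rewrite (qmulA (qconj x)) S3_Cmul // q1mul.
  by rewrite !(qmulZr, qmulZl, qmulBr, qmulBl).
have -> : q0 *q (x *q (- qi *q qconj x)) *q (x *q A *q qconj x) =
    - (q0 *q (x *q (qi *q A) *q qconj x)).
  rewrite -!qmulA (qmulA (qconj x)) S3_Cmul // q1mul.
  by rewrite !(qmulNl, qmulNr).
by rewrite scalerN opprK !(qmulZr, qmulZl, qmulDr, qmulDl).
Qed.

Lemma edot2_frame x (q0 A G A' G' : quat R) : S3 x -> S3 q0 ->
  edot2 (frame x q0 A G) (frame x q0 A' G') = edot A A' + edot G G'.
Proof.
move=> /[dup] /S3conj /S3P Sx' /S3P Sx /S3P Sq; rewrite /edot2 /frame /=.
by rewrite !edotMl !edotMr !edotMl Sx Sx' Sq !mul1r.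
Qed.

(** J is orthogonal for g and squares to - 1, so g (J Z, Z') is the
    antisymmetrization of the Euclidean product of J Z and Z'. *)
Lemma nkg_frame x (q0 A G A' G' : quat R) : S3 x -> S3 q0 ->
  nkg (x *q qi *q qinv x, q0) (nkJ (x *q qi *q qinv x, q0) (frame x q0 A G))
      (frame x q0 A' G') =
  2^-1 * (Num.sqrt 3)^-1 *
   (edot (2 *: (qi *q G) - A) A' + edot (2 *: (qi *q A) + G) G'
    - edot A (2 *: (qi *q G') - A') - edot G (2 *: (qi *q A') + G')).
Proof.
move=> Sx Sq; rewrite /nkg !nkJ_frame // !edot2_frame //.
have c2 : (Num.sqrt 3)^-1 * (Num.sqrt 3)^-1 = 3^-1 :> R.
  by rewrite -invfM -expr2 sqr_sqrtr.
set c := (Num.sqrt 3)^-1 in c2 *.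
have ii (B : quat R) : qi *q (qi *q B) = - B by quat_ring.
have E1 : 2 *: (qi *q (c *: (2 *: (qi *q A) + G))) - c *: (2 *: (qi *q G) - A) = - (3 * c) *: A.
  rewrite qmulZr qmulDr qmulZr ii; clear.
  by apply/rowP => m; rewrite !quatE; ring.
have E2 : 2 *: (qi *q (c *: (2 *: (qi *q G) - A))) + c *: (2 *: (qi *q A) + G) = - (3 * c) *: G.
  rewrite qmulZr qmulBr qmulZr ii; clear.
  by apply/rowP => m; rewrite !quatE; ring.
rewrite E1 E2 !edotZl !edotZr; have c3 : 3 * (c * c) = 1 by rewrite c2 divff.
move: (edot _ A') (edot _ G') (edot A _) (edot G _) => P Q S T.
transitivity (2^-1 * c * (P + Q - 3 * (c * c) * (S + T))); first by ring.
by rewrite c3; ring.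
Qed.

(** The differential of f at x a has the frame components A = a i - i a and
    G = rate x a; the Lagrangian condition amounts to the symmetry of the
    bilinear form edot G A', which is diagonal in the frame. *)
Lemma lagrangian_frame x (q0 a a' : quat R) : S3 x -> S3 q0 -> a 0 0 = 0 -> a' 0 0 = 0 ->
  nkg (x *q qi *q qinv x, q0)
      (nkJ (x *q qi *q qinv x, q0) (frame x q0 (a *q qi - qi *q a) (rate x a)))
      (frame x q0 (a' *q qi - qi *q a') (rate x a')) = 0.
Proof.
move=> Sx Sq a0 a'0; rewrite nkg_frame // [X in _ * X](_ : _ = 0) ?mulr0 //.
rewrite !commutator_qi !qi_mul !edotE /rate; move: (Num.sqrt 3 * _) => s.
rewrite !quatE; ring.
Qed.

Lemma solution_lagrangian q : q_solution U beta q ->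
  lagrangian_immersion U (fun x => (x *q qi *q qinv x, q x)).
Proof.
move=> sol; have [Sq sq qsys] := sol; set f := fun x => _.
have S3i : S3 (qi : quat R) by apply/S3P; rewrite edotE /qi !quatE; ring.
have Sp x : S3 x -> S3 (x *q qi *q qinv x).
  by move=> Sx; rewrite S3_qinv //; apply: S3M; [exact: S3M|exact: S3conj].
pose p y : quat R := y *q qi *q qinv y.
have oN := @open_nonzero R.
have p_smooth n : Ck n (@nonzero R) p.
  by apply: Ck_qmul => //; [apply: Ck_qmul => //; [exact: Ck_id|exact: Ck_cst]|exact: Ck_qinv].
have f_ext x : U x -> exists W h, [/\ open W, W x, Cinfty W h,
    (forall z, W z -> U z -> (p z, h z) = f z) & W `<=` @nonzero R].
  move=> Ux; have [W [h [oW Wx ch hq _]]] := smooth_extension sq Ux.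
  exists (W `&` @nonzero R), h; split.
  - exact: openI.
  - by split=> //; exact: S3_neq0 (U_S3 U_open Ux).
  - by move=> n; apply: Ck_sub (ch n) => z [].
  - by move=> z [Wz _] Uz; rewrite /f hq.
  - by move=> z [].
have df x w : U x -> tangentS3 x w -> dS3 f x w =
    frame x (q x) ((qconj x *q w) *q qi - qi *q (qconj x *q w)) (rate x (qconj x *q w)).
  move=> Ux xw; have Sx := U_S3 U_open Ux; have x0 := S3_neq0 Sx.
  have [W [h [oW Wx ch hf WN]]] := f_ext x Ux.
  have dh : differentiable h x by have [d _] := ch 1; exact: d.
  have dp : differentiable p x by have [d _] := p_smooth 1; exact: d.
  have hq z : W z -> U z -> h z = q z by move=> Wz Uz; have [] := hf z Wz Uz.
  apply: etrans (dS3E U_open oW Ux Wx hf (differentiable_pair dp dh) xw) _.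
  apply: etrans (derive_pair w dp dh) _.
  apply: (congr2 pair); last first.
    exact: etrans (esym (dS3E U_open oW Ux Wx hq dh xw)) (q_solution_dS3 sol Ux xw).
  have did : differentiable (@id (quat R)) x by exact: ex_diff.
  have [d1 D1] := derive_qmul w did (@differentiable_cst _ _ _ (qi : quat R) x).
  have [_ D2] := derive_qmul w d1 (differentiable_qinv x0).
  apply: etrans D2 _; rewrite D1 derive_id derive_cst qmul0 addr0 derive_qinv // S3_qinv //.
  have {1}-> : w = x *q (qconj x *q w) by rewrite qmulA S3_mulC // q1mul.
  by rewrite qmulNr !(qmulBr, qmulBl) !qmulA.
split; first split.
- by move=> x Ux; split; [exact: Sp (U_S3 U_open Ux)|exact: Sq].
- move=> x Ux; have [W [h [oW Wx ch hf WN]]] := f_ext x Ux.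
  exists W, (fun z => (p z, h z)); split=> // n.
  by apply: Ck_pair => //; apply: Ck_sub (p_smooth n).
- move=> x Ux v xv; have Sx := U_S3 U_open Ux; rewrite df //.
  set a := qconj x *q v; have a0 : a 0 0 = 0 by exact: tangent_qconj.
  have vE : v = x *q a by rewrite /a qmulA S3_mulC // q1mul.
  clearbody a; rewrite /frame => -[hA hG].
  have cancel (b : quat R) : x *q b *q qconj x = 0 -> b = 0.
    move=> /(congr1 (fun z => qconj x *q z *q x)); rewrite qmul0 q0mul => <-.
    by rewrite !qmulA S3_Cmul // q1mul -qmulA S3_Cmul // qmul1.
  have A0 := cancel _ hA.
  have G0 : rate x a = 0.
    apply: cancel; move: hG => /(congr1 (fun z => qconj (q x) *q z)).
    by rewrite qmul0 qmulA S3_Cmul ?q1mul //; exact: Sq.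
  have a2 : a 0 2 = 0.
    by have := congr1 (fun z : quat R => z 0 3) A0; rewrite commutator_qi !quatE; lra.
  have a3 : a 0 3 = 0.
    by have := congr1 (fun z : quat R => z 0 2) A0; rewrite commutator_qi !quatE; lra.
  have a1 : a 0 1 = 0.
    by have := congr1 (fun z : quat R => z 0 1) G0; rewrite /rate !quatE a2 a3; lra.
  rewrite vE (_ : a = 0) ?qmul0 //.
  by apply: quatP; rewrite !quatE.
- move=> x Ux v xv; have Sx := U_S3 U_open Ux.
  have a0 := tangent_qconj xv; rewrite df //; set a := qconj x *q v in a0 *.
  split; last first.
    move=> w xw; have b0 := tangent_qconj xw; rewrite (df x w Ux xw).
    by apply: lagrangian_frame => //; exact: Sq.
  rewrite /f nkJ_frame //; last exact: Sq.
  rewrite /frame; split; rewrite /tangentS3 /=.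
    rewrite S3_qinv // edotMr edotMl [X in _ * (_ * X)](_ : _ = 0) ?mulr0 //.
    by rewrite commutator_qi qi_mul edotE /rate /qi !quatE; ring.
  have qE : q x = q x *q (x *q qone R *q qconj x) by rewrite qmul1 S3_mulC // qmul1.
  rewrite {1}qE edotMl edotMr edotMl.
  rewrite [X in _ * (_ * (_ * X))](_ : _ = 0) ?mulr0 //.
  by rewrite commutator_qi qi_mul edotE /rate /qone !quatE; ring.
Qed.

Hypothesis U_sc : simply_connected R U.
Hypothesis beta_smooth : smoothS3 U beta.
Hypothesis beta_X1 : forall x, U x -> X1 beta x = 0.
Hypothesis beta_X2X3 : forall x, U x ->
  X2 (X2 beta) x + X3 (X3 beta) x = 2 * (3 - expR (4 * beta x)) / expR (4 * beta x).

Lemma conn_local x : U x -> exists d r, [/\ 0 < d, (forall y, `|y - x| < d -> cone U y),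
  parallel (conn beta) r [set y | `|y - x| < d] & r x = qone R].
Proof.
move=> Ux; apply: (local_parallel (open_cone U_open) (cone_U U_open Ux)).
- exact: connD.
- exact: connZ.
- by move=> y v _; exact: conn_im.
- by move=> v; exact: (Ck_conn U_open beta_smooth).
- by move=> z Cz; exact: (conn_flat U_open beta_smooth beta_X1 beta_X2X3 Cz).
Qed.

(** Nearby points of U are joined in U by the radial projection of a segment. *)
Lemma short_path_in y (d : R) : U y -> 0 < d -> exists2 e, 0 < e & forall y', U y' -> `|y' - y| < e ->
  exists g : R -> quat R, [/\ path_in U g, g 0 = y, g 1 = y' &
                          forall t, I01 t -> `|g t - y| < d].
Proof.
move=> Uy d0; have Sy := U_S3 U_open Uy; have Ny := normalize_S3 Sy.
pose W := cone U `&` [set z | z != 0 /\ `|N z - y| < d].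
have oW : open W.
  apply: openI; first exact: open_cone.
  exact: (open_preimage_normalize (@open_norm_ball R y d)).
have Wy : W y.
  split; first exact: cone_U.
  by split; [exact: S3_neq0|rewrite Ny subrr normr0].
have [e e0 eW] := open_ballP oW Wy; exists e => // y' Uy' y'e.
have line t : I01 t -> W (y + t *: (y' - y)).
  by move=> ht; apply: eW; apply: norm_segment_lt ht => //; rewrite subrr normr0.
exists (fun t => N (y + t *: (y' - y))); split.
- apply/path_inP; split; last by move=> t /line [[_ h] _].
  apply/continP; apply: continuous_in_subspaceT => t; rewrite inE => /line [[z0 _] _].
  have [dl _] := derive_line y (y' - y) t.
  have [dN _] := @derive_comp R R _ (fun s : R => y + s *: (y' - y)) N t 1 dl
    (differentiable_normalize z0).
  exact: differentiable_continuous.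
- by rewrite scale0r addr0.
- by rewrite scale1r subrKC normalize_S3 //; exact: U_S3 Uy'.
- by move=> t /line [_ [_ h]].
Qed.

(** The value at y of the continuation from x0 does not depend on the path, and
    near y it is obtained by continuing along short paths from y. *)
Lemma global_parallel x0 : U x0 -> exists r0 : quat R -> quat R, forall y, U y ->
  exists d r, [/\ 0 < d, (forall z, `|z - y| < d -> cone U z),
    parallel (conn beta) r [set z | `|z - y| < d] &
    forall z, `|z - y| < d -> U z -> r0 z = r z].
Proof.
move=> Ux0; have im y v : conn beta y v 0 0 = 0 by exact: conn_im.
have loc x : U x -> exists d r,
    [/\ 0 < d, parallel (conn beta) r [set y | `|y - x| < d] & r x = qone R].
  by move=> /conn_local [d [r [d0 _ par rx]]]; exists d, r.
pose Q := reach U (conn beta) x0.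
pose r0 y := xget (qone R) [set q0 | Q y q0].
have r0P y : U y -> Q y (r0 y).
  move=> Uy; have [q0 hq] := reach_exists im loc U_sc Ux0 Uy.
  exact: (xgetPex (qone R) (ex_intro _ q0 hq)).
exists r0 => y Uy; have Qy := r0P y Uy.
have Sr0 : S3 (r0 y).
  have [c [s [_ _ _ sc [_ <-]]]] := Qy.
  by apply: section_at sc; rewrite /I01 /= ler01 lexx.
have [d [r [d0 dC par ry]]] := conn_local Uy.
pose r' z := r0 y *q r z.
have par' : parallel (conn beta) r' [set z | `|z - y| < d] by exact: parallelM.
have r'y : r' y = r0 y by rewrite /r' ry qmul1.
have [e e0 eP] := short_path_in Uy d0.
exists (Num.min d e), r'; split.
- by rewrite lt_min d0.
- by move=> z; rewrite lt_min => /andP[zd _]; exact: dC.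
- by apply: parallel_sub par' => z /=; rewrite lt_min => /andP[].
move=> z; rewrite lt_min => /andP[_ ze] Uz.
have [g [gp g0 g1 gd]] := eP z Uz ze.
have := reach_local im loc Qy d0 par' r'y gp g0 gd; rewrite g1 => Qz.
exact: (reach_unique im loc U_sc (r0P z Uz) Qz).
Qed.

(** Undoing the change of gauge: q = r x^-1. *)
Lemma solution_exists x0 : U x0 -> exists q, q_solution U beta q.
Proof.
move=> /global_parallel [r0 r0P].
exists (fun y => r0 y *q qconj y); split.
- move=> x Ux; have [d [r [d0 _ par r0r]]] := r0P x Ux.
  have xd : `|x - x| < d by rewrite subrr normr0.
  have [Sr _ _] := par x xd; rewrite r0r //.
  by apply: S3M => //; apply: S3conj; exact: U_S3 Ux.
- move=> x Ux; have [d [r [d0 dC par r0r]]] := r0P x Ux.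
  have oB := @open_norm_ball R x d.
  exists [set z | `|z - x| < d], (fun y => r y *q qconj y); split=> //.
  + by rewrite /= subrr normr0.
  + move=> n; apply: Ck_qmul => //; last by apply: Ck_qconj => //; exact: Ck_id.
    apply: (parallel_smooth oB _ par) => k v.
    by apply: Ck_sub (Ck_conn U_open beta_smooth k v) => z /dC.
  + by move=> z zd Uz; rewrite r0r.
apply: q_system_frame => x Ux a a0; have Sx := U_S3 U_open Ux.
have [d [r [d0 dC par r0r]]] := r0P x Ux.
have xd : `|x - x| < d by rewrite subrr normr0.
have [_ dr rE] := par x xd.
have did : differentiable (@id (quat R)) x by exact: ex_diff.
have [dc Dc] := derive_qconj (x *q a) did.
have [dh Dh] := derive_qmul (x *q a) dr dc.
have hq z : [set z | `|z - x| < d] z -> U z -> r z *q qconj z = r0 z *q qconj z.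
  by move=> zd Uz; rewrite r0r.
apply: etrans (dS3E U_open (@open_norm_ball R x d) Ux xd hq dh (tangent_qmul Sx a0)) _.
apply: etrans Dh _; rewrite Dc rE derive_id r0r // qconjM (qconj_im a0).
rewrite /conn /b2 /b3 /sfun (normalize_S3 Sx) (S3_qinv Sx) (qmulA (qconj x)) S3_Cmul // q1mul.
rewrite /system_rhs -!qmulA (qmulA (qconj x)) S3_Cmul // q1mul -qmulDr; congr (_ *q _).
rewrite -qmulDl; congr (_ *q _).
apply: quatP; rewrite /gauge /rate !quatE ?a0; ring.
Qed.

End Solutions.

Unset Implicit Arguments.
Set Strict Implicit.
Set Printing Implicit Defensive.

Theorem theorem5 (R : realType) (U : set (quat R)) (beta : quat R -> R)
  (U_open : open_in_S3 U) (U_connected : connected U)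
  (U_simply_connected : simply_connected R U)
  (beta_smooth : smoothS3 U beta)
  (beta_X1 : forall x, U x -> X1 beta x = 0)
  (beta_X2X3 : forall x, U x ->
     X2 (X2 beta) x + X3 (X3 beta) x
     = 2 * (3 - expR (4 * beta x)) / expR (4 * beta x)) :
  exists q : quat R -> quat R,
    [/\ q_solution U beta q,
        lagrangian_immersion U (fun x => (x *q qi *q qinv x, q x)) &
        forall q' : quat R -> quat R, q_solution U beta q' ->
          exists2 c : quat R, S3 c & forall x, U x -> q' x = c *q q x].
Proof.
have [[x0 Ux0]|U0] := pselect (exists x, U x).
  have [q sol] := solution_exists U_open U_simply_connected beta_smooth beta_X1
    beta_X2X3 Ux0.
  exists q; split=> [//||q' sol']; first exact: (solution_lagrangian U_open sol).
  exact: (solution_unique U_open U_connected Ux0 sol sol').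
have U0x x : U x -> False by move=> Ux; apply: U0; exists x.
have sol : q_solution U beta (fun=> qone R) by split=> x /U0x.
exists (fun=> qone R); split=> [//||q' _]; first exact: (solution_lagrangian U_open sol).
by exists (qone R) => [|x /U0x //]; exact: S3one.
Qed.
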